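(* Let $\Gamma$ and $\Gamma'$ be finite, connected, labelled simplicial graphs, and let $\phi\colon A_\Gamma\to A_{\Gamma'}$ be an isomorphism. Then there exists a bijection $\phi_\#\colon\mathcal{BC}(\Gamma)\to\mathcal{BC}(\Gamma')$ such that for every $\Lambda\in\mathcal{BC}(\Gamma)$: (1) $A_\Lambda\cong A_{\phi_\#(\Lambda)}$; (2) if $\Lambda$ is not a toral leaf, then $A_{\phi_\#(\Lambda)}$ is a conjugate of $\phi(A_\Lambda)$ in $A_{\Gamma'}$; (3) if $\Lambda$ is an even leaf, then so is $\phi_\#(\Lambda)$. Moreover, if $\phi$ maps each standard generator of $A_\Gamma$ (vertex of $\Gamma$) to a conjugate of a standard generator of $A_{\Gamma'}$, then $\phi_\#$ can be chosen so that, in addition, $A_{\phi_\#(\Lambda)}$ is a conjugate of $\phi(A_\Lambda)$ for every $\Lambda\in\mathcal{BC}(\Gamma)$.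
   Context: Labels $m_{ab}\in\mathbb{Z}_{\ge2}$ on edges; $A_\Gamma=\langle V(\Gamma)\mid \mathrm{prod}(a,b,m_{ab})=\mathrm{prod}(b,a,m_{ab})\ \forall\{a,b\}\in E(\Gamma)\rangle$ ($\mathrm{prod}(u,v,n)$ = prefix of length $n$ of $uvuv\cdots$); vertices of $\Gamma$ are identified with the standard generators. For a full subgraph $\Lambda$, $A_\Lambda=\langle V(\Lambda)\rangle\le A_\Gamma$ (isomorphic to the Artin group of $\Lambda$). A big chunk of $\Gamma$ is a connected induced subgraph with no separating vertex (a vertex whose removal disconnects it), maximal with respect to inclusion; $\mathcal{BC}(\Gamma)$ is the set of big chunks of $\Gamma$. A leaf is an edge $\{a,b\}$ one of whose endpoints has valence one in $\Gamma$; it is even if $m_{ab}$ is even, and toral if $m_{ab}=2$. *)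

(* Defs.v *)
(* Artin groups are encoded by their presentations:
   elements are words in letters (v, false) = v, (v, true) = v^-1, modulo the
   smallest congruence containing free cancellation and the Artin relations. *)
From mathcomp Require Import all_boot.
Set Implicit Arguments. Unset Strict Implicit. Unset Printing Implicit Defensive.

Record lgraph := LGraph {
  gV : finType;
  gadj : rel gV;
  glab : gV -> gV -> nat;
  gadj_sym : symmetric gadj;
  gadj_irr : irreflexive gadj;
  glab_sym : forall a b, gadj a b -> glab a b = glab b a;
  glab_ge2 : forall a b, gadj a b -> 1 < glab a b }.

Definition letter (V : Type) := (V * bool)%type.
Definition word (V : Type) := seq (letter V).

Definition winv (V : Type) (w : word V) : word V :=
  rev [seq (l.1, ~~ l.2) | l <- w].

Definition prodw (V : Type) (a b : V) (n : nat) : word V :=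
  mkseq (fun i => (if odd i then b else a, false)) n.

Inductive aeq (V : Type) (adj : rel V) (m : V -> V -> nat) : word V -> word V -> Prop :=
| aeq_refl w : aeq adj m w w
| aeq_sym u v : aeq adj m u v -> aeq adj m v u
| aeq_trans u v w : aeq adj m u v -> aeq adj m v w -> aeq adj m u w
| aeq_cat u u' v v' : aeq adj m u u' -> aeq adj m v v' -> aeq adj m (u ++ v) (u' ++ v')
| aeq_free a b : aeq adj m [:: (a, b); (a, ~~ b)] [::]
| aeq_rel a b : adj a b -> aeq adj m (prodw a b (m a b)) (prodw b a (m a b)).

Definition ext (V W : Type) (f : V -> word W) (w : word V) : word W :=
  flatten [seq (if l.2 then winv (f l.1) else f l.1) | l <- w].

Definition is_hom (V W : Type) (adj : rel V) (m : V -> V -> nat)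
  (adj' : rel W) (m' : W -> W -> nat) (f : V -> word W) : Prop :=
  forall a b, adj a b ->
    aeq adj' m' (ext f (prodw a b (m a b))) (ext f (prodw b a (m a b))).

Definition Aeq (G : lgraph) := aeq (@gadj G) (@glab G).
Arguments Aeq G : clear implicits.

Definition artin_iso (G G' : lgraph) (phi : gV G -> word (gV G'))
  (psi : gV G' -> word (gV G)) : Prop :=
  [/\ is_hom (@gadj G) (@glab G) (@gadj G') (@glab G') phi,
      is_hom (@gadj G') (@glab G') (@gadj G) (@glab G) psi,
      (forall w, Aeq G (ext psi (ext phi w)) w) &
      (forall w, Aeq G' (ext phi (ext psi w)) w)].

Definition word_over (V : finType) (L : {set V}) (w : word V) : bool :=
  all (fun l => l.1 \in L) w.

Definition restr_adj (V : finType) (adj : rel V) (L : {set V}) : rel V :=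
  fun x y => [&& adj x y, x \in L & y \in L].

Definition connected_in (G : lgraph) (L : {set gV G}) : Prop :=
  L != set0 /\ forall x y, x \in L -> y \in L -> connect (restr_adj (@gadj G) L) x y.

Definition no_sep_vertex (G : lgraph) (L : {set gV G}) : Prop :=
  forall v, v \in L -> forall x y, x \in L :\ v -> y \in L :\ v ->
    connect (restr_adj (@gadj G) (L :\ v)) x y.

Definition big_chunk (G : lgraph) (L : {set gV G}) : Prop :=
  [/\ connected_in L, no_sep_vertex L &
      forall M : {set gV G}, L \subset M -> connected_in M -> no_sep_vertex M -> M = L].

Definition connected_graph (G : lgraph) : Prop := connected_in [set: gV G].

Definition valence (G : lgraph) (v : gV G) : nat := #|[set x | gadj v x]|.

Definition is_leaf (G : lgraph) (L : {set gV G}) : Prop :=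
  exists a b, [/\ gadj a b, L = [set a; b] & (valence a == 1) || (valence b == 1)].

Definition even_leaf (G : lgraph) (L : {set gV G}) : Prop :=
  exists a b, [/\ gadj a b, L = [set a; b], (valence a == 1) || (valence b == 1)
               & ~~ odd (glab a b)].

Definition toral_leaf (G : lgraph) (L : {set gV G}) : Prop :=
  exists a b, [/\ gadj a b, L = [set a; b], (valence a == 1) || (valence b == 1)
               & glab a b = 2].

Definition bc_bijection (G G' : lgraph) (f : {set gV G} -> {set gV G'}) : Prop :=
  [/\ forall L, big_chunk L -> big_chunk (f L),
      forall L1 L2, big_chunk L1 -> big_chunk L2 -> f L1 = f L2 -> L1 = L2 &
      forall L', big_chunk L' -> exists2 L, big_chunk L & f L = L'].

(* A_L and A_L' are isomorphic (A_L viewed as the Artin group of the induced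
   subgraph on L, i.e. generated by L with the relations of edges inside L) *)
Definition sub_iso (G G' : lgraph) (L : {set gV G}) (L' : {set gV G'}) : Prop :=
  exists (f : gV G -> word (gV G')) (g : gV G' -> word (gV G)),
  [/\ (forall v, v \in L -> word_over L' (f v)) /\
        (forall v, v \in L' -> word_over L (g v)),
      is_hom (restr_adj (@gadj G) L) (@glab G) (restr_adj (@gadj G') L') (@glab G') f,
      is_hom (restr_adj (@gadj G') L') (@glab G') (restr_adj (@gadj G) L) (@glab G) g,
      (forall w, word_over L w -> aeq (restr_adj (@gadj G) L) (@glab G) (ext g (ext f w)) w) &
      (forall w, word_over L' w -> aeq (restr_adj (@gadj G') L') (@glab G') (ext f (ext g w)) w)].

Definition in_std (G : lgraph) (L : {set gV G}) (w : word (gV G)) : Prop :=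
  exists2 w', word_over L w' & Aeq G w w'.

Definition in_image (G G' : lgraph) (phi : gV G -> word (gV G')) (L : {set gV G})
  (w : word (gV G')) : Prop :=
  exists2 u, word_over L u & Aeq G' w (ext phi u).

Definition conj_image (G G' : lgraph) (phi : gV G -> word (gV G')) (L : {set gV G})
  (L' : {set gV G'}) : Prop :=
  exists g : word (gV G'), forall w, in_std L' w <-> in_image phi L (winv g ++ w ++ g).

Definition gens_to_conj_gens (G G' : lgraph) (phi : gV G -> word (gV G')) : Prop :=
  forall v, exists v' (g : word (gV G')),
    Aeq G' (phi v) (winv g ++ [:: (v', false)] ++ g).

(* Main.v *)
(* A connected labelled graph is a tree of big chunks glued along vertices, and
   retracting onto a chunk shows that A_Gamma is the corresponding tree of
   groups: it acts on a tree T_Gamma whose vertex stabilizers are the conjugates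
   of the A_Lambda and whose edge stabilizers are conjugates of the cyclic groups
   <v>, on which the total exponent is injective.  Hence the centralizer of a
   hyperbolic element embeds in Z^2, so every element with a larger centralizer
   fixes a vertex.  By an invariant counting crossings of reflection mirrors, a
   generator with two neighbours has such a centralizer.  It follows that, for every big
   chunk Lambda that is not a toral leaf, phi(A_Lambda) fixes a vertex of
   T_Gamma', hence lies in a conjugate of some A_Lambda'; going back along
   phi^-1 gives equality.  Edges with label at least 3 need one further tree, the one on which
   the dihedral Artin group acts modulo its centre.  Toral leaves, which
   transvections may move, are only counted, by means of the homomorphisms to
   Z/2 that kill all other chunks. *)
From HB Require Import structures.
From mathcomp Require Import all_boot all_order all_algebra all_field.
From mathcomp Require Import boolp zify ring.
Require Import Defs.
Set Implicit Arguments. Unset Strict Implicit. Unset Printing Implicit Defensive.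
Local Open Scope group_scope.

(** * Groups and presentations *)

(** That a graph of cosets is a tree is usually read off from normal forms in amalgams. Here each
    edge is shown to separate, and the separation is witnessed by an action of the group on two
    copies of itself in which crossing that edge exchanges the copies. Such an action is defined on
    generators, so only the relations of the presentation have to be checked. Integer weights,
    reflections and crossing counts are likewise lifts to groups of bijections. For a generator v
    with neighbours u and w, the large centralizer comes from v^2 and the central elements of the
    dihedral subgroups on {v, u} and {v, w}; the mirror counts show that these three are
    independent. A vertex of valence one has no third such element, and in a toral leaf it can be
    multiplied by powers of its neighbour: this is the one place where a generator may become
    hyperbolic and where the chunk is only determined up to a count. *)

Record bij (X : Type) := Bij {
  bfun : X -> X; binv : X -> X;
  bfunK : cancel bfun binv; binvK : cancel binv bfun }.

Section BijGroup.
Variable X : Type.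

Lemma bij_ext (f g : bij X) : bfun f =1 bfun g -> f = g.
Proof.
case: f g => [f f' fK f'K] [g g' gK g'K] /= /funext fg; subst g.
have e : f' = g' by apply: funext => x; rewrite -[in LHS](g'K x) fK.
by subst g'; congr Bij; exact: Prop_irrelevance.
Qed.

HB.instance Definition _ := gen_eqMixin (bij X).
HB.instance Definition _ := gen_choiceMixin (bij X).

Definition bij_one := @Bij X id id (fun=> erefl) (fun=> erefl).
Definition bij_mul (f g : bij X) :=
  Bij (can_comp (bfunK f) (bfunK g)) (can_comp (binvK g) (binvK f)).
Definition bij_inv (f : bij X) := Bij (binvK f) (bfunK f).

Lemma bij_mulA : associative bij_mul. Proof. by move=> f g h; apply: bij_ext. Qed.
Lemma bij_mul1 : left_id bij_one bij_mul. Proof. by move=> f; apply: bij_ext. Qed.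
Lemma bij_1mul : right_id bij_one bij_mul. Proof. by move=> f; apply: bij_ext. Qed.
Lemma bij_mulV : left_inverse bij_one bij_inv bij_mul.
Proof. by move=> f; apply: bij_ext => x /=; rewrite bfunK. Qed.
Lemma bij_Vmul : right_inverse bij_one bij_inv bij_mul.
Proof. by move=> f; apply: bij_ext => x /=; rewrite binvK. Qed.

HB.instance Definition _ :=
  isGroup.Build (bij X) bij_mulA bij_mul1 bij_1mul bij_mulV bij_Vmul.

Lemma bijM (f g : bij X) x : bfun (f * g) x = bfun f (bfun g x). Proof. by []. Qed.
Lemma bijV (f : bij X) x : bfun f^-1 x = binv f x. Proof. by []. Qed.

End BijGroup.

Section GroupFacts.
Variables K L : groupType.
Implicit Types x y g h : K.

Section Morphisms.
Variable f : K -> L.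
Hypothesis fM : {morph f : x y / x * y}.

Lemma mor1 : f 1 = 1.
Proof. by apply: (mulgI (f 1)); rewrite -fM !mulg1. Qed.

Lemma morV x : f x^-1 = (f x)^-1.
Proof. by apply: (mulgI (f x)); rewrite -fM !mulgV mor1. Qed.

Lemma morX x n : f (x ^+ n) = f x ^+ n.
Proof. by elim: n => [|n IH]; rewrite ?mor1 // !expgS fM IH. Qed.
End Morphisms.

Definition zexp x (i : int) := match i with Posz n => x ^+ n | Negz n => x ^- n.+1 end.

Lemma zexp0 x : zexp x 0%R = 1. Proof. by []. Qed.
Lemma zexp1 x : zexp x 1%R = x. Proof. by []. Qed.

Lemma zexpS x (i : int) : zexp x (i + 1)%R = zexp x i * x.
Proof.
case: i => n.
  by rewrite -PoszD addn1 /= expgSr.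
case: n => [|n]; first by rewrite /= expg1 mulVg.
have -> : (Negz n.+1 + 1)%R = Negz n by lia.
by rewrite /= [x ^+ n.+2]expgS invgM mulgVK.
Qed.

Lemma zexpP x (i : int) : zexp x (i - 1)%R = zexp x i / x.
Proof. by rewrite -[in RHS](GRing.subrK 1%R i) zexpS mulgK. Qed.

Lemma zexpD x i j : zexp x (i + j)%R = zexp x i * zexp x j.
Proof.
elim/int_rec: j => [|n IH|n IH]; first by rewrite GRing.addr0 mulg1.
  by rewrite -addn1 PoszD GRing.addrA !zexpS IH mulgA.
by rewrite -addn1 PoszD GRing.opprD GRing.addrA !zexpP IH mulgA.
Qed.

Lemma zexpN x i : zexp x (- i)%R = (zexp x i)^-1.
Proof. by apply: (mulgI (zexp x i)); rewrite -zexpD GRing.subrr mulgV. Qed.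

Lemma zexpM x i j : zexp x (i * j)%R = zexp (zexp x i) j.
Proof.
elim/int_rec: j => [|n IH|n IH]; first by rewrite GRing.mulr0.
  by rewrite -addn1 PoszD GRing.mulrDr GRing.mulr1 [LHS]zexpD IH zexpS.
rewrite -addn1 PoszD GRing.opprD GRing.mulrBr GRing.mulr1.
by rewrite [LHS]zexpD zexpN IH zexpP.
Qed.

Lemma commuteZ x y i : commute x y -> commute x (zexp y i).
Proof.
move=> xy; case: i => n /=; first exact: commuteX.
by apply: commuteV; apply: commuteX.
Qed.

Lemma zexpMn x y i : commute x y -> zexp (x * y) i = zexp x i * zexp y i.
Proof.
move=> xy; case: i => n /=; first exact: expgMn.
rewrite expgMn // invgM; apply: commute_sym.
by apply: commuteV; apply/commute_sym/commuteV/commute_sym; exact: commuteX2.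
Qed.

Lemma zexpJ x g i : zexp (g * x * g^-1) i = g * zexp x i * g^-1.
Proof.
have p n : (g * x * g^-1) ^+ n = g * x ^+ n * g^-1.
  elim: n => [|n IH]; first by rewrite mulg1 mulgV.
  by rewrite expgS IH [x ^+ n.+1]expgS !mulgA mulgVK.
by case: i => n /=; rewrite p // !invgM invgK mulgA.
Qed.

Lemma mulg_commute_inv x y : commute x y -> x * y * x^-1 = y.
Proof. by move=> ->; rewrite mulgK. Qed.

End GroupFacts.

Lemma morZ (K L : groupType) (f : K -> L) :
  {morph f : x y / x * y} -> forall x i, f (zexp x i) = zexp (f x) i.
Proof. by move=> fM x [] n /=; rewrite ?(morV fM) (morX fM). Qed.

Section Additive.
Variables (K : groupType) (l : K -> int).
Hypothesis lM : forall x y, l (x * y) = (l x + l y)%R.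

Lemma add1 : l 1 = 0%R. Proof. by have := lM 1 1; rewrite mulg1; lia. Qed.
Lemma addV x : l x^-1 = (- l x)%R.
Proof. by have := lM x x^-1; rewrite mulgV add1; lia. Qed.
Lemma addX x n : l (x ^+ n) = (l x * n%:Z)%R.
Proof. by elim: n => [|n IH]; rewrite ?add1 ?GRing.mulr0 // expgS lM IH; lia. Qed.
Lemma addZ x i : l (zexp x i) = (l x * i)%R.
Proof. by case: i => n /=; rewrite ?addV addX //; lia. Qed.
Lemma addJ x g : l (g * x * g^-1) = l x.
Proof. by rewrite !lM addV; lia. Qed.
End Additive.

Fixpoint alt (K : groupType) (x y : K) n := if n is n'.+1 then x * alt y x n' else 1.

Lemma mor_alt (K L : groupType) (f : K -> L) : {morph f : x y / x * y} ->
  forall x y n, f (alt x y n) = alt (f x) (f y) n.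
Proof.
move=> fM x y n; elim: n x y => [|n IH] x y /=; first exact: mor1.
by rewrite fM IH.
Qed.

Lemma alt_double (K : groupType) (x y : K) n : alt x y n.*2 = (x * y) ^+ n.
Proof. by elim: n => // n IH; rewrite doubleS /= IH mulgA expgS. Qed.

Lemma alt_double1 (K : groupType) (x y : K) n : alt x y n.*2.+1 = (x * y) ^+ n * x.
Proof.
elim: n => [|n IH]; first by rewrite /= mul1g mulg1.
by rewrite doubleS [LHS]/= -[y * _]/(alt y x n.*2.+2) [alt y x _]/= -/(alt x y n.*2.+1) IH expgS !mulgA.
Qed.

Lemma alt_same (K : groupType) (x : K) n : alt x x n = x ^+ n.
Proof. by elim: n => // n IH; rewrite /= IH expgS. Qed.

Section ArtinGroup.
Variables (V : Type) (adj : rel V) (m : V -> V -> nat).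
Notation E := (aeq adj m).

Lemma aeq_catV (w : word V) : E (w ++ winv w) [::].
Proof.
elim: w => [|[a b] w IH]; first exact: aeq_refl.
rewrite /winv /= rev_cons -cats1 -/(winv w).
have -> : (a, b) :: w ++ winv w ++ [:: (a, ~~ b)]
   = [:: (a,b)] ++ (w ++ winv w) ++ [:: (a, ~~ b)] by rewrite -catA.
apply: aeq_trans (aeq_free _ _ a b).
apply: (aeq_cat (aeq_refl _ _ [:: (a, b)])).
exact: (aeq_cat IH (aeq_refl _ _ [:: (a, ~~ b)])).
Qed.

Lemma winvK : involutive (@winv V).
Proof.
move=> w; rewrite /winv map_rev revK -map_comp -[RHS]map_id.
by apply: eq_map => -[a b] /=; rewrite negbK.
Qed.

(** Inversion is not a rule of the congruence; it follows from u^-1 = u^-1 v v^-1 = u^-1 u v^-1 =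
    v^-1. *)
Lemma aeq_winv u v : E u v -> E (winv u) (winv v).
Proof.
move=> uv.
apply: (@aeq_trans _ _ _ _ (winv u ++ (v ++ winv v))).
  by rewrite -{1}[winv u]cats0; apply: aeq_cat (aeq_refl _ _ _) (aeq_sym (aeq_catV v)).
rewrite catA; apply: (@aeq_cat _ _ _ _ [::]) (aeq_refl _ _ (winv v)).
apply: aeq_trans (aeq_catV (winv u)); rewrite winvK.
exact: aeq_cat (aeq_refl _ _ _) (aeq_sym uv).
Qed.

(** The congruence need not be decidable, so the quotient consists of the classes themselves, as
    predicates on words; [arep] picks representatives by choice. *)
Record art := Art { acls : word V -> Prop; aclsP : exists w, acls = E w }.

Definition cls w := Art (ex_intro (fun w' => E w = E w') w erefl).

Lemma cls_eq u v : cls u = cls v <-> E u v.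
Proof.
split=> [[/(congr1 (fun f => f v)) e]|uv]; first by rewrite e; exact: aeq_refl.
have e : E u = E v.
  apply: funext => w; apply: propext; split; apply: aeq_trans => //; exact: aeq_sym.
rewrite /cls; move: (ex_intro _ u _) (ex_intro _ v _); rewrite e => p q.
by rewrite (Prop_irrelevance p q).
Qed.

Lemma cls_surj (x : art) : exists w, x = cls w.
Proof.
case: x => c [w e]; exists w; subst c; rewrite /cls.
by congr Art; exact: Prop_irrelevance.
Qed.

Definition arep x := sval (cid (cls_surj x)).
Lemma arepK x : cls (arep x) = x.
Proof. by rewrite -(svalP (cid (cls_surj x))). Qed.
Lemma clsK w : E (arep (cls w)) w. Proof. by apply/cls_eq; rewrite arepK. Qed.

HB.instance Definition _ := gen_eqMixin art.
HB.instance Definition _ := gen_choiceMixin art.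

Definition art_mul x y := cls (arep x ++ arep y).
Definition art_inv x := cls (winv (arep x)).

Lemma art_mulA : associative art_mul.
Proof.
move=> x y z; apply/cls_eq.
apply: (@aeq_trans _ _ _ _ (arep x ++ arep y ++ arep z)).
  by apply: aeq_cat; [exact: aeq_refl|exact: clsK].
rewrite catA; apply: aeq_cat; [exact/aeq_sym/clsK|exact: aeq_refl].
Qed.

Lemma art_mul1 : left_id (cls [::]) art_mul.
Proof.
move=> x; rewrite -[RHS]arepK; apply/cls_eq.
exact: aeq_cat (clsK [::]) (aeq_refl _ _ (arep x)).
Qed.

Lemma art_1mul : right_id (cls [::]) art_mul.
Proof.
move=> x; rewrite -[RHS]arepK; apply/cls_eq; rewrite -[X in E _ X]cats0.
exact: aeq_cat (aeq_refl _ _ (arep x)) (clsK [::]).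
Qed.

Lemma art_Vmul : right_inverse (cls [::]) art_inv art_mul.
Proof.
move=> x; apply/cls_eq; apply: aeq_trans (aeq_catV (arep x)).
by apply: aeq_cat; [exact: aeq_refl|exact: clsK].
Qed.

Lemma art_mulV : left_inverse (cls [::]) art_inv art_mul.
Proof.
move=> x; apply/cls_eq; apply: aeq_trans (aeq_catV (winv (arep x))).
by rewrite winvK; apply: aeq_cat; [exact: clsK|exact: aeq_refl].
Qed.

HB.instance Definition _ :=
  isGroup.Build art art_mulA art_mul1 art_1mul art_mulV art_Vmul.

Lemma cls_cat u v : cls (u ++ v) = cls u * cls v.
Proof. by apply/cls_eq/aeq_sym; apply: aeq_cat; exact: clsK. Qed.

Lemma cls_winv u : cls (winv u) = (cls u)^-1.
Proof. by apply/cls_eq; apply/aeq_winv/aeq_sym/clsK. Qed.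

Definition gen v : art := cls [:: (v, false)].

End ArtinGroup.

Section Evaluation.
Variables (V : Type) (K : groupType) (f : V -> K).

Definition ev (w : word V) : K :=
  foldr (fun l x => (if l.2 then (f l.1)^-1 else f l.1) * x) 1 w.

Lemma ev_cat u v : ev (u ++ v) = ev u * ev v.
Proof. by elim: u => [|l u IH]; rewrite ?mul1g //= IH mulgA. Qed.

Lemma ev_winv u : ev (winv u) = (ev u)^-1.
Proof.
elim: u => [|[a b] u IH]; first by rewrite invg1.
rewrite /winv /= rev_cons -cats1 ev_cat -/(winv u) IH /= mulg1 invgM.
by case: b => /=; rewrite ?invgK.
Qed.

Lemma prodwS (a b : V) n : prodw a b n.+1 = (a, false) :: prodw b a n.
Proof.
rewrite /prodw /mkseq /=; congr cons.
rewrite -[1%N]/(1 + 0)%N iotaDl -map_comp; apply: eq_map => i /=.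
by case: (odd i).
Qed.

Lemma ev_prodw a b n : ev (prodw a b n) = alt (f a) (f b) n.
Proof. by elim: n a b => // n IH a b; rewrite prodwS /= IH. Qed.

Variables (adj : rel V) (m : V -> V -> nat).
Definition respects :=
  forall a b, adj a b -> alt (f a) (f b) (m a b) = alt (f b) (f a) (m a b).
Hypothesis fR : respects.

Lemma ev_aeq u v : aeq adj m u v -> ev u = ev v.
Proof.
elim=> //.
- by move=> ? ? ? _ -> _ ->.
- by move=> *; rewrite !ev_cat; congr (_ * _).
- by move=> a [] /=; rewrite mulg1 ?mulgV ?mulVg.
- by move=> a b ab; rewrite !ev_prodw; exact: fR.
Qed.

Definition lift (x : art adj m) := ev (arep x).

Lemma lift_cls w : lift (cls adj m w) = ev w.
Proof. exact/ev_aeq/clsK. Qed.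

Lemma liftM : {morph lift : x y / x * y}.
Proof.
move=> x y; rewrite -(arepK x) -(arepK y) -cls_cat !lift_cls; exact: ev_cat.
Qed.

Lemma lift_gen v : lift (gen adj m v) = f v.
Proof. by rewrite lift_cls /= mulg1. Qed.

End Evaluation.

Lemma ev_ext (V W : Type) (K : groupType) (phi : V -> word W) (f : W -> K) w :
  ev f (ext phi w) = ev (fun v => ev f (phi v)) w.
Proof.
elim: w => //= -[a b] w IH; rewrite /ext /= ev_cat -/(ext phi w) IH.
by case: b => //=; rewrite ev_winv.
Qed.

Lemma ev_mor (V : Type) (K L : groupType) (g : K -> L) (f : V -> K) w :
  {morph g : x y / x * y} -> g (ev f w) = ev (fun v => g (f v)) w.
Proof.
move=> gM; elim: w => [|[a b] w IH] /=; first exact: mor1.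
by rewrite gM IH; case: b => //=; rewrite morV.
Qed.

Lemma eq_ev (V : Type) (K : groupType) (f g : V -> K) (w : word V) :
  f =1 g -> ev f w = ev g w.
Proof. by move=> fg; elim: w => //= l w ->; rewrite fg. Qed.

Lemma cls_ev (V : Type) (adj : rel V) m w : cls adj m w = ev (gen adj m) w.
Proof.
elim: w => // -[a b] w IH; rewrite -cat1s cls_cat IH; congr (_ * _).
by case: b => //=; rewrite -cls_winv.
Qed.

Lemma gen_respects (V : Type) (adj : rel V) m : respects (gen adj m) adj m.
Proof.
by move=> a b ab; rewrite -!ev_prodw -!cls_ev; apply/cls_eq; exact: aeq_rel.
Qed.

(** * Group actions on trees *)

(** The cross product of the two rows is a relation unless all 2 by 2 minors vanish; in that case
    the first two columns are already dependent. *)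
Lemma int_dependent (a1 a2 a3 b1 b2 b3 : int) : exists i j k : int,
  [/\ (a1 * i + a2 * j + a3 * k = 0)%R, (b1 * i + b2 * j + b3 * k = 0)%R &
      ~ [/\ i = 0, j = 0 & k = 0]%R].
Proof.
have cross : (a2 * b3 - a3 * b2 != 0)%R || (a3 * b1 - a1 * b3 != 0)%R
    || (a1 * b2 - a2 * b1 != 0)%R -> exists i j k : int,
    [/\ (a1 * i + a2 * j + a3 * k = 0)%R, (b1 * i + b2 * j + b3 * k = 0)%R &
      ~ [/\ i = 0, j = 0 & k = 0]%R].
  move=> ne; exists (a2 * b3 - a3 * b2)%R, (a3 * b1 - a1 * b3)%R, (a1 * b2 - a2 * b1)%R.
  by split; [lia|lia|case=> e1 e2 e3; move: ne; rewrite e1 e2 e3].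
have [e1|n1] := eqVneq (a2 * b3 - a3 * b2)%R 0%R; last by apply: cross; rewrite n1.
have [e2|n2] := eqVneq (a3 * b1 - a1 * b3)%R 0%R; last by apply: cross; rewrite n2 orbT.
have [e3|n3] := eqVneq (a1 * b2 - a2 * b1)%R 0%R; last by apply: cross; rewrite n3 orbT.
have [a10|na1] := eqVneq a1 0%R.
  have [b10|nb1] := eqVneq b1 0%R; first by exists 1%R, 0%R, 0%R; split; [lia|lia|case].
  by exists b2, (- b1)%R, 0%R; split; [lia|lia|case; lia].
by exists a2, (- a1)%R, 0%R; split; [lia|lia|case; lia].
Qed.

(* Trees are presented metrically: an integral pseudo-metric satisfying the
   four-point condition in which every distance is realised by discrete
   geodesics.  The parity axioms say that the tree is bipartite and that the
   action preserves the two classes; points at distance 0 are identified. *)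
Record tree_action (A : groupType) := TreeAction {
  pt :> Type;
  base_pt : pt;
  dist : pt -> pt -> nat;
  act : A -> pt -> pt;
  distxx : forall x, dist x x = 0;
  distC : forall x y, dist x y = dist y x;
  dist4 : forall x y z w,
    (dist x y + dist z w <= maxn (dist x z + dist y w) (dist x w + dist y z))%N;
  dist_geo : forall x y k, (k <= dist x y)%N ->
    exists z, dist x z = k /\ (dist x z + dist z y = dist x y)%N;
  dist_par : forall x y z, ~~ odd (dist x y + dist y z + dist x z);
  act1 : forall x, act 1 x = x;
  actM : forall g h x, act (g * h) x = act g (act h x);
  dist_act : forall g x y, dist (act g x) (act g y) = dist x y;
  dist_inv : forall g x, ~~ odd (dist x (act g x)) }.

Section Geometry.
Variables (A : groupType) (T : tree_action A).
Implicit Types (x y z w p q r : T) (g h c : A).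
Notation d := (@dist A T).
Notation "g @ x" := (@act A T g x) (at level 30, right associativity).

Definition fixes g x := d x (g @ x) = 0.
Definition elliptic g := exists x, fixes g x.

Lemma dist_tri x y z : (d x z <= d x y + d y z)%N.
Proof. have := dist4 x z y y; rewrite distxx (distC z y); lia. Qed.

Lemma dist0l x y z : d x y = 0 -> d x z = d y z.
Proof. have := dist_tri x y z; have := dist_tri y x z; rewrite (distC y x); lia. Qed.

Lemma actK g x : g^-1 @ (g @ x) = x.
Proof. by rewrite -actM mulVg act1. Qed.

Lemma actVK g x : g @ (g^-1 @ x) = x.
Proof. by rewrite -actM mulgV act1. Qed.

Lemma fixes1 x : fixes 1 x.
Proof. by rewrite /fixes act1 distxx. Qed.

Lemma fixesM g h x : fixes g x -> fixes h x -> fixes (g * h) x.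
Proof.
rewrite /fixes actM => gx hx; have := dist_tri x (g @ x) (g @ h @ x).
by rewrite dist_act gx hx; lia.
Qed.

Lemma fixesV g x : fixes g x -> fixes g^-1 x.
Proof. by move=> gx; rewrite /fixes -(dist_act g x) actVK distC. Qed.

Lemma fixesX g x n : fixes g x -> fixes (g ^+ n) x.
Proof.
move=> gx; elim: n => [|n IH]; first exact: fixes1.
by rewrite expgS; apply: fixesM.
Qed.

Lemma fixesZ g x i : fixes g x -> fixes (zexp g i) x.
Proof. by case: i => n gx /=; [|apply: fixesV]; apply: fixesX. Qed.

Lemma fixesJ g h x : fixes (h * g * h^-1) (h @ x) <-> fixes g x.
Proof. by rewrite /fixes !actM actK dist_act. Qed.

Lemma fixes_act g h x : commute g h -> fixes g x -> fixes g (h @ x).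
Proof. by move=> gh; rewrite -(mulg_commute_inv (commute_sym gh)) fixesJ mulg_commute_inv //; exact: commute_sym. Qed.

Lemma fixes_dist0 g x y : d x y = 0 -> fixes g x -> fixes g y.
Proof.
rewrite /fixes => xy gx; have e : d (g @ x) (g @ y) = 0 by rewrite dist_act.
have := dist_tri y x (g @ x); have := dist_tri y (g @ x) (g @ y).
by rewrite (distC y x) xy gx e; lia.
Qed.

(** Fixed sets are convex: [z] and [g z] lie on geodesics from [x] to [y] at the same distances from
    the ends, so the four-point condition puts them at distance 0. *)
Lemma fixes_geo g x y z :
  fixes g x -> fixes g y -> (d x z + d z y = d x y)%N -> fixes g z.
Proof.
rewrite /fixes => gx gy e.
have e1 : d x (g @ z) = d x z by rewrite (dist0l _ gx) dist_act.
have e2 : d y (g @ z) = d y z by rewrite (dist0l _ gy) dist_act.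
have := dist4 z (g @ z) x y; rewrite (distC z x) (distC (g @ z) x) (distC (g @ z) y) e1 e2.
have := distC z y; lia.
Qed.

(** The action preserves the bipartition, so displacements are even and the midpoint is a point of
    the tree. *)
Lemma midpoint_ex g r : exists2 z, d r z = d z (g @ r) &
  (d r z + d z (g @ r) = d r (g @ r))%N.
Proof.
have ev := dist_inv g r; set D := d r (g @ r) in ev *.
have [z [rz e]] : exists z, d r z = D./2 /\ (d r z + d z (g @ r) = D)%N.
  by apply: dist_geo; rewrite -/D; lia.
exists z => //; lia.
Qed.

(** The path from [r] to [g r] runs to the fixed set of [g] and back, so its midpoint is the fixed
    point nearest to [r]. *)
Lemma midpoint g q r z : fixes g q -> d r z = d z (g @ r) ->
  (d r z + d z (g @ r) = d r (g @ r))%N -> fixes g z.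
Proof.
move=> gq rz e; set D := d r (g @ r) in e.
have e1 : d q (g @ r) = d q r by rewrite (dist0l _ gq) dist_act.
have e2 : d q (g @ z) = d q z by rewrite (dist0l _ gq) dist_act.
have e3 : d (g @ r) (g @ z) = d r z by rewrite dist_act.
have h1 := dist4 q z r (g @ r); rewrite -/D (distC z r) in h1.
have h2 := dist_tri q z (g @ r).
have h3 := dist4 z (g @ z) q (g @ r).
rewrite (distC z q) (distC (g @ z) q) (distC (g @ z) (g @ r)) in h3.
rewrite /fixes; lia.
Qed.

(** If [g h] fixes [r], then [h r] and [g^-1 r] coincide, and the midpoint between [r] and this
    point is fixed by both elements. *)
Lemma serre g h : elliptic g -> elliptic h -> elliptic (g * h) ->
  exists x, fixes g x /\ fixes h x.
Proof.
move=> [p gp] [q hq] [r]; rewrite /fixes actM => ghr.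
have e : d (g^-1 @ r) (h @ r) = 0 by rewrite -(dist_act g) actVK.
have [z ez1 ez2] := midpoint_ex h r.
exists z; split; last exact: midpoint hq ez1 ez2.
rewrite -(invgK g); apply/fixesV/(midpoint (fixesV gp) (r := r)).
  by rewrite ez1 [RHS]distC (dist0l _ e) distC.
by rewrite ![d _ (g^-1 @ r)]distC !(dist0l _ e) ![d (h @ r) _]distC.
Qed.

(** [h] preserves the fixed set of [g], so the midpoint of [p] and [h p] lies in that set by
    convexity. *)
Lemma commuting_elliptic g h : commute g h -> elliptic g -> elliptic h ->
  exists x, fixes g x /\ fixes h x.
Proof.
move=> gh [p gp] [q hq]; have [z ez1 ez2] := midpoint_ex h p.
exists z; split; last exact: midpoint hq ez1 ez2.
by apply: fixes_geo ez2 => //; apply: fixes_act.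
Qed.

Section Hyperbolic.
Variable g : A.
Hypothesis ghyp : ~ elliptic g.

Lemma axis_ex : exists p, (0 < d p (g @ p))%N /\
  forall n, d p (g ^+ n @ p) = (n * d p (g @ p))%N.
Proof.
have exd : exists n, `[< exists p, d p (g @ p) = n >].
  by exists (d (base_pt T) (g @ base_pt T)); apply/asboolP; exists (base_pt T).
case: (ex_minnP exd) => t /asboolP [p pt] tmin.
have {}tmin q : (t <= d q (g @ q))%N by apply: tmin; apply/asboolP; exists q.
have t0 : (0 < t)%N.
  by rewrite lt0n; apply/eqP => t0; apply: ghyp; exists p; rewrite /fixes pt.
exists p; rewrite pt; split=> //.
have tev : ~~ odd t by rewrite -pt; exact: dist_inv.
(* If the path from [p] through [g p] to [g g p] turned back at [g p], the neighbour [u] of [g p] on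
   it would be displaced by less than the minimum [t]. *)
have e2 : d p (g @ g @ p) = (2 * t)%N.
  have [|u [pu1 pu2]] := @dist_geo A T p (g @ p) t.-1; first by rewrite pt; lia.
  have h0 := tmin u.
  have a1 : d (g @ p) (g @ u) = t.-1 by rewrite dist_act.
  have a2 : d (g @ u) (g @ g @ p) = d u (g @ p) by rewrite dist_act.
  have a3 : d (g @ p) (g @ g @ p) = t by rewrite dist_act.
  have h1 := dist4 u (g @ u) p (g @ p); rewrite (distC u p) (distC (g @ u) (g @ p)) (distC (g @ u) p) in h1.
  have h2 := dist4 p (g @ u) (g @ p) (g @ g @ p).
  have h3 := dist4 p (g @ u) (g @ g @ p) (g @ p).
  have h4 := dist_tri p (g @ p) (g @ g @ p).
  rewrite ?(distC (g @ u) (g @ p)) ?(distC (g @ g @ p) (g @ p)) in h2 h3.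
  lia.
elim/ltn_ind => -[|[|[|n]]] IH; first by rewrite act1 distxx.
- by rewrite mul1n.
- by rewrite expgS expg1 actM.
have f1 := IH n.+2 (ltnSn _); have f2 := IH n.+1 (ltnW (ltnSn _)).
have b1 : d (g @ p) (g ^+ n.+3 @ p) = (n.+2 * t)%N by rewrite expgS actM dist_act.
have b2 : d (g @ p) (g ^+ n.+2 @ p) = (n.+1 * t)%N by rewrite expgS actM dist_act.
have b3 : d (g ^+ n.+2 @ p) (g ^+ n.+3 @ p) = t by rewrite [g ^+ n.+3]expgSr (actM (g ^+ n.+2)) dist_act.
have h1 := dist4 p (g ^+ n.+2 @ p) (g @ p) (g ^+ n.+3 @ p).
have h2 := dist_tri p (g @ p) (g ^+ n.+3 @ p).
rewrite (distC (g ^+ n.+2 @ p) (g @ p)) in h1.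
nia.
Qed.

(** A fixed point of [g ^+ n] is fixed by all powers of it, whereas the orbit of a point of the axis
    moves away linearly. *)
Lemma axis_power n : (0 < n)%N -> ~ elliptic (g ^+ n).
Proof.
move=> n0 [q gq]; have [p [t0 pt]] := axis_ex.
set D := d p q.
have fq k : fixes (g ^+ (n * k)) q by rewrite expgnA; apply: fixesX.
have := dist_tri p q (g ^+ (n * D.*2.+1) @ p).
rewrite (dist0l _ (fq D.*2.+1)) dist_act pt (distC q) -/D; nia.
Qed.

(* The displacement towards the attracting end of [g]. *)
Lemma translation_hom : exists tau : A -> int,
  [/\ forall c c', commute g c -> commute g c' -> tau (c * c') = (tau c + tau c')%R &
      forall c, commute g c -> tau c = 0%R ->
        exists p q, [/\ (0 < d p q)%N, fixes c p & fixes c q]].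
Proof.
have [p [t0 pt]] := axis_ex; set t := d p (g @ p) in t0 pt.
have pd n k : d (g ^+ n @ p) (g ^+ (n + k) @ p) = (k * t)%N.
  by rewrite expgnDr actM dist_act pt.
(* From the index [d q p] on, the path from [q] has joined the axis, and each application of [g]
   adds exactly [t]. *)
have stab q n : (d q p < n)%N -> d q (g ^+ n.+1 @ p) = (d q (g ^+ n @ p) + t)%N.
  move=> qn; have := dist4 q p (g ^+ n @ p) (g ^+ n.+1 @ p).
  have := dist4 q (g ^+ n @ p) p (g ^+ n.+1 @ p).
  have := dist4 q (g ^+ n.+1 @ p) p (g ^+ n @ p).
  have e := pd n 1%N; rewrite addn1 mul1n in e.
  have h1 := dist_tri p q (g ^+ n @ p).
  have h2 := dist_tri q (g ^+ n @ p) (g ^+ n.+1 @ p).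
  rewrite ?(distC (g ^+ _ @ p) p) !pt (distC (g ^+ n.+1 @ p) (g ^+ n @ p)) e in h1 h2 *.
  rewrite (distC p q) in h1. nia.
(* The Busemann function of the attracting end: the difference is constant in the exponent once this
   exceeds [d q p], so no limit is taken. *)
pose be q := (Posz (d q (g ^+ (d q p).+1 @ p)) - Posz (t * (d q p).+1))%R.
have beE q n : (d q p < n)%N -> Posz (d q (g ^+ n @ p)) = (be q + Posz (t * n))%R.
  move=> qn; rewrite -(subnKC qn); elim: (n - _)%N => [|k IH].
    by rewrite addn0 /be; lia.
  rewrite addnS stab; last by rewrite addSn ltnS leq_addr.
  by move: IH; lia.
(* An element commuting with [g] fixes its attracting end, hence shifts the Busemann function by a
   constant. *)
have beH c q q' : commute g c -> (be (c @ q) - be q = be (c @ q') - be q')%R.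
  move=> gc; pose r := c^-1 @ p.
  have gcn n : commute c (g ^+ n) by apply: commuteX; exact: commute_sym.
  have e n x : d (c @ x) (g ^+ n @ p) = d x (g ^+ n @ r).
    have -> : g ^+ n @ r = c^-1 @ g ^+ n @ p.
      rewrite /r -!actM; congr (_ @ _); apply: commuteV; exact/commute_sym.
    by rewrite -(dist_act c x) actVK.
  have [n nE] : exists n, n = (d q q' + d r p + d q p + d q' p + d (c @ q) p + d (c @ q') p).+1 by eexists.
  have b1 := @beE (c @ q) n; have b2 := @beE q n.
  have b3 := @beE (c @ q') n; have b4 := @beE q' n.
  rewrite !e in b1 b3.
  have k1 := dist4 q q' (g ^+ n @ r) (g ^+ n @ p).
  have k2 := dist4 q (g ^+ n @ r) q' (g ^+ n @ p).
  have k3 := dist4 q (g ^+ n @ p) q' (g ^+ n @ r).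
  have k5 : d (g ^+ n @ r) (g ^+ n @ p) = d r p by rewrite dist_act.
  have l1 := dist_tri p q (g ^+ n @ p); have l2 := dist_tri p q' (g ^+ n @ p).
  have l3 := dist_tri (g ^+ n @ p) (g ^+ n @ r) q'.
  rewrite !pt (distC p q) (distC p q') in l1 l2.
  rewrite ?(distC (g ^+ n @ r) q') ?(distC (g ^+ n @ p) q')
     ?(distC (g ^+ n @ p) (g ^+ n @ r)) ?k5 in k1 k2 k3 l3.
  have nt : (n <= n * t)%N by rewrite leq_pmulr.
  move: b1 b2 b3 b4; rewrite (mulnC t); lia.
pose tau c := (be (c @ p) - be p)%R.
exists tau; split.
  move=> c c' gc gc'; rewrite /tau actM.
  have := beH c (c' @ p) p gc; lia.
move=> c gc tc; exists p, (g @ p).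
suff cp : fixes c p by split=> //; exact: fixes_act (commute_sym gc) cp.
have be0 : be p = 0%R by have := beE p 1%N; rewrite distxx pt; lia.
have cpn n : (d (c @ p) p < n)%N -> d (c @ p) (g ^+ n @ p) = (n * t)%N.
  by move=> /beE; move: tc; rewrite /tau be0; lia.
have [n nE] : exists n, n = (d (c @ p) p).+1 by eexists.
have gcn k : commute (g ^+ k) c by apply: commute_sym; apply: commuteX; exact: commute_sym.
(* The vanishing shift controls [c p] only towards the attracting end. The point [b], far back on
   the axis, supplies the other direction and forces [c p] to coincide with [p]. *)
pose b := g ^- n @ p.
have cb : c @ b = g ^- n @ c @ p.
  by rewrite /b -!actM; congr (_ @ _); apply: commuteV; apply: commute_sym; exact: gcn.
have v1 : d b p = (n * t)%N by rewrite /b -(dist_act (g ^+ n)) actVK pt.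
have v2 : d b (g ^+ n @ p) = (2 * n * t)%N.
  rewrite /b -(dist_act (g ^+ n)) actVK -actM -expgnDr pt; lia.
have v3 : d (c @ b) (g ^+ n @ p) = (2 * n * t)%N.
  rewrite cb -(dist_act (g ^+ n)) actVK -actM -expgnDr cpn ?addnn -?mul2n // nE; lia.
have v4 : d (c @ p) (g ^+ n @ p) = (n * t)%N by rewrite cpn // nE.
have v5 : d b (c @ b) = d p (c @ p) by rewrite cb dist_act.
have v6 : d (c @ b) (c @ p) = (n * t)%N by rewrite dist_act.
have v7 : d p (g ^+ n @ p) = (n * t)%N by rewrite pt.
have k1 := dist4 b (g ^+ n @ p) p (c @ p).
have k2 := dist4 (c @ p) b (c @ b) (g ^+ n @ p).
rewrite ?(distC (g ^+ n @ p)) ?(distC (c @ p) b) ?(distC (c @ p) (c @ b)) in k1 k2.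
rewrite /fixes; nia.
Qed.

End Hyperbolic.

Lemma elliptic_root g n : (0 < n)%N -> elliptic (g ^+ n) -> elliptic g.
Proof. by move=> n0 gn; apply: contrapT => /axis_power /(_ n n0). Qed.

Section GoodTree.
(* [l] is injective on the stabilizer of every edge. *)
Variable l : A -> int.
Hypothesis lM : forall g h, l (g * h) = (l g + l h)%R.
Hypothesis good : forall g p q,
  (0 < d p q)%N -> fixes g p -> fixes g q -> l g = 0%R -> g = 1.

(** On the centralizer of [g] the pair ([tau], [l]) is an injective homomorphism to Z^2: [tau c = 0]
    gives [c] two distinct fixed points, and then [l c = 0] makes it trivial. The commutator and a
    suitable product of powers lie in its kernel. *)
Lemma hyperbolic_centralizer g c1 c2 c3 : ~ elliptic g ->
  commute g c1 -> commute g c2 -> commute g c3 ->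
  commute c1 c2 /\ exists i j k : int, zexp c1 i * zexp c2 j * zexp c3 k = 1 /\
    ~ [/\ i = 0, j = 0 & k = 0]%R.
Proof.
move=> /translation_hom [tau [tauM tau0]] g1 g2 g3.
have com1 : commute g (1 : A) by rewrite /commute mulg1 mul1g.
have cM c c' : commute g c -> commute g c' -> commute g (c * c') by exact: commuteM.
have triv c : commute g c -> tau c = 0%R -> l c = 0%R -> c = 1.
  by move=> gc /(tau0 _ gc) [p [q [pq cp cq]]]; apply: good pq cp cq.
have tau1 : tau 1 = 0%R by have := tauM 1 1 com1 com1; rewrite mulg1; lia.
have tauV c : commute g c -> tau c^-1 = (- tau c)%R.
  move=> gc; have := tauM c c^-1 gc (commuteV gc); rewrite mulgV tau1; lia.
have tauX c n : commute g c -> tau (c ^+ n) = (tau c * n%:Z)%R.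
  move=> gc; elim: n => [|n IH]; first by rewrite tau1; lia.
  by rewrite expgS tauM ?IH //; [lia|exact: commuteX].
have tauZ c i : commute g c -> tau (zexp c i) = (tau c * i)%R.
  move=> gc; case: i => n /=; rewrite ?tauV ?tauX //; [lia|exact: commuteX].
split.
  apply/(mulIg (c2 * c1)^-1); rewrite mulgV; apply: triv.
  - by apply: (cM); [|apply: commuteV]; apply: (cM).
  - have c21 := cM _ _ g2 g1; have c12 := cM _ _ g1 g2.
    by rewrite (tauM _ _ c12 (commuteV c21)) tauV // !tauM //; lia.
  - by rewrite lM (addV lM) !lM; lia.
have T3 i j k : tau (zexp c1 i * zexp c2 j * zexp c3 k) = (tau c1 * i + tau c2 * j + tau c3 * k)%R.
  by rewrite !tauM ?tauZ //; repeat (apply cM); apply: commuteZ.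
have L3 i j k : l (zexp c1 i * zexp c2 j * zexp c3 k) = (l c1 * i + l c2 * j + l c3 * k)%R.
  by rewrite !lM !(addZ lM).
have [i [j [k [e1 e2 ne]]]] := int_dependent (tau c1) (tau c2) (tau c3) (l c1) (l c2) (l c3).
exists i, j, k; split=> //; apply: triv; rewrite ?T3 ?L3 //.
by repeat (apply cM); apply: commuteZ.
Qed.

End GoodTree.

(* The two inequalities say that [x] and [y] lie on different sides of the
   edge [pw]. *)
Lemma first_edge p q : (0 < d p q)%N -> exists w, [/\ d p w = 1%N, 
  (d p w + d w q = d p q)%N &
  forall g x y, fixes g x -> fixes g y -> (d x p < d x w)%N -> (d y w < d y p)%N ->
    fixes g p /\ fixes g w].
Proof.
move=> pq; have [//|w [pw e]] := @dist_geo A T p q 1; exists w; split=> //.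
move=> g x y gx gy xs ys.
have := dist4 x w y p; have := dist_tri x p w; have := dist_tri y w p.
have := dist_tri x w y; have := dist_tri x p y.
rewrite (distC w p) (distC w y) (distC p y) pw => *.
by split; apply: (fixes_geo gx gy); rewrite (distC _ y); lia.
Qed.

End Geometry.

(** * Coset trees *)

Section WallGraph.
Variables (P : Type) (eqv E : P -> P -> Prop) (ty : P -> bool).
Hypothesis eqvxx : forall p, eqv p p.
Hypothesis eqvC : forall p q, eqv p q -> eqv q p.
Hypothesis eqvT : forall p q r, eqv p q -> eqv q r -> eqv p r.
Hypothesis edgeC : forall p q, E p q -> E q p.
Hypothesis edge_eqv : forall p p' q, eqv p p' -> E p q -> E p' q.
Hypothesis ty_eqv : forall p q, eqv p q -> ty p = ty q.
Hypothesis ty_edge : forall p q, E p q -> ty p = ~~ ty q.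

Fixpoint walk n p q := if n is n'.+1 then exists2 r, E p r & walk n' r q else eqv p q.

Hypothesis connected : forall p q, exists n, walk n p q.
(** Every edge separates: [f] names the two sides of the edge and changes along no other edge. For a
    connected graph this amounts to being a tree. *)
Hypothesis walls : forall u w, E u w -> exists f : P -> bool,
  [/\ f u != f w, forall p q, eqv p q -> f p = f q &
      forall p q, E p q -> f p != f q ->
        (eqv p u /\ eqv q w) \/ (eqv p w /\ eqv q u)].

Lemma walk_eqvl n p p' q : eqv p p' -> walk n p q -> walk n p' q.
Proof.
case: n => [|n] pp' /=; first by move=> pq; exact: eqvT (eqvC pp') pq.
by case=> r pr rq; exists r => //; exact: edge_eqv pp' pr.
Qed.

Lemma walk_cat n k p q r : walk n p q -> walk k q r -> walk (n + k) p r.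
Proof.
elim: n p => [|n IH] p /=; first by move=> pq; apply: walk_eqvl; exact: eqvC.
by move=> [s ps sq] qr; exists s => //; exact: IH.
Qed.

Lemma walk_edge p q : E p q -> walk 1 p q.
Proof. by move=> pq; exists q => //=. Qed.

Lemma walk_rev n p q : walk n p q -> walk n q p.
Proof.
elim: n p => [|n IH] p /=; first exact: eqvC.
by case=> r pr /IH rq; have := walk_cat rq (walk_edge (edgeC pr)); rewrite addn1.
Qed.

Lemma walk_ex p q : exists n, `[< walk n p q >].
Proof. by have [n w] := connected p q; exists n; apply/asboolP. Qed.

Definition wdist p q := ex_minn (walk_ex p q).

Lemma wdist_walk p q : walk (wdist p q) p q.
Proof. by rewrite /wdist; case: ex_minnP => n /asboolP. Qed.

Lemma wdist_le n p q : walk n p q -> (wdist p q <= n)%N.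
Proof. by move=> w; rewrite /wdist; case: ex_minnP => k _; apply; apply/asboolP. Qed.

Lemma wdist_eq0 p q : wdist p q = 0 <-> eqv p q.
Proof.
split=> [e|pq]; first by have := wdist_walk p q; rewrite e.
by apply/eqP; rewrite -leqn0; exact: (@wdist_le 0).
Qed.

Lemma wdistC p q : wdist p q = wdist q p.
Proof.
by apply/eqP; rewrite eqn_leq; apply/andP; split; apply/wdist_le/walk_rev/wdist_walk.
Qed.

Lemma wdist_tri p q r : (wdist p r <= wdist p q + wdist q r)%N.
Proof. by apply/wdist_le; apply: walk_cat; exact: wdist_walk. Qed.

Lemma walk_ty n p q : walk n p q -> odd n = (ty p != ty q).
Proof.
elim: n p => [|n IH] p /=; first by move/ty_eqv => ->; rewrite eqxx.
by case=> r /ty_edge -> /IH ->; case: (ty r); case: (ty q).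
Qed.

Lemma wdist_odd p q : odd (wdist p q) = (ty p != ty q).
Proof. exact/walk_ty/wdist_walk. Qed.

Lemma wdist_first p q : wdist p q != 0 ->
  exists r, E p r /\ wdist p q = (wdist r q).+1.
Proof.
have := wdist_walk p q; case e : (wdist p q) => [|n] // [r pr rq] _.
exists r; split=> //; have := wdist_le rq; have := wdist_tri p r q.
have := wdist_le (walk_edge pr); rewrite e; lia.
Qed.

Lemma wdist_edge p q : E p q -> wdist p q = 1%N.
Proof.
move=> pq; have := wdist_le (walk_edge pq); have := wdist_odd p q.
by rewrite (ty_edge pq); case: (ty q) => /=; case: (wdist p q) => [|[]].
Qed.

(** A walk between the two sides has to pass from [u] to [w], and its first passage splits it into a
    walk to [u] and a walk from [w]. *)
Lemma walk_separated f u w n x y : E u w ->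
  (forall p q, eqv p q -> f p = f q) ->
  (forall p q, E p q -> f p != f q -> (eqv p u /\ eqv q w) \/ (eqv p w /\ eqv q u)) ->
  f x = f u -> f y = f w -> f u != f w :> bool ->
  walk n x y -> (wdist x u + 1 + wdist w y <= n)%N.
Proof.
move=> uw fe fE + yw uw'; elim: n x => [|n IH] x xu /=.
  by move/fe => e; move: uw'; rewrite -xu e yw eqxx.
case=> r xr ry; have [e|ne] := eqVneq (f x) (f r).
  have := IH r; rewrite -e => /(_ xu ry).
  have := wdist_tri x r u; rewrite (wdist_edge xr); lia.
case: (fE _ _ xr ne) => [[xu' rw]|[/fe xw _]]; last by move: uw'; rewrite -xu xw eqxx.
have -> : wdist x u = 0 by apply/wdist_eq0.
by apply: wdist_le; exact: walk_eqvl rw ry.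
Qed.

Lemma wall_split u w : E u w -> exists f : P -> bool, f u != f w /\
  forall x y, f x = f u -> f y = f w -> wdist x y = (wdist x u + 1 + wdist w y)%N.
Proof.
move=> uw; have [f [fuw fe fE]] := walls uw; exists f; split=> // x y xu yw.
apply/eqP; rewrite eqn_leq (walk_separated uw fe fE xu yw fuw (wdist_walk x y)) andbT.
have := wdist_tri x u y; have := wdist_tri u w y; rewrite (wdist_edge uw); lia.
Qed.

(** Induction on the distance from [w] to [x]. Moving [w] to the next vertex [v] changes each
    distance by one, with a sign that depends only on the side of the edge [wv]. The three permuted
    inequalities are carried along together, since each case of the induction may use any of
    them. *)
Lemma wdist4 x y z w : (wdist x y + wdist z w
  <= maxn (wdist x z + wdist y w) (wdist x w + wdist y z))%N.
Proof.
suff: [/\ (wdist x y + wdist z w <= maxn (wdist x z + wdist y w) (wdist x w + wdist y z))%N,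
  (wdist x z + wdist y w <= maxn (wdist x y + wdist z w) (wdist x w + wdist y z))%N &
  (wdist x w + wdist y z <= maxn (wdist x z + wdist y w) (wdist x y + wdist z w))%N] by case.
have [n] := ubnP (wdist w x); elim: n w => // n IH w wn.
have [e|/wdist_first [v [wv e]]] := eqVneq (wdist w x) 0.
  have ww p q : wdist p q = wdist q p := wdistC p q.
  have t1 := wdist_tri x w y; have t2 := wdist_tri w x y.
  have t3 := wdist_tri x w z; have t4 := wdist_tri w x z.
  have t5 := wdist_tri y x z.
  rewrite (ww y w) (ww z w) (ww x w) (ww y x) in t1 t2 t3 t4 t5 *.
  split; lia.
have {}IH := IH v; have [|i1 i2 i3] := IH; first lia.
have [f [fvw sp]] := wall_split (edgeC wv).
have side p : f p = f v \/ f p = f w by move: fvw; case: (f p); case: (f v); case: (f w); auto.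
have vv : wdist v v = 0 by apply/wdist_eq0.
have ww : wdist w w = 0 by apply/wdist_eq0.
have s1 p : f p = f v -> wdist p w = (wdist p v).+1.
  by move=> pv; rewrite (sp _ w pv) // ww; lia.
have s2 p : f p = f w -> wdist v p = (wdist w p).+1.
  by move=> pw; rewrite (sp v _ _ pw) // vv; lia.
have xv : f x = f v.
  by case: (side x) => // /s2; rewrite e; lia.
have c1 := wdistC x v; have c2 := wdistC y v; have c3 := wdistC z v.
have d1 := wdistC x w; have d2 := wdistC y w; have d3 := wdistC z w.
have t := wdist_tri x v z; have t' := wdist_tri x v y.
have cyz := wdistC y z.
have t'' := wdist_tri y w z.
case: (side y) (side z) => [yv|yw] [zv|zw]; rewrite ?(s1 x) //.
- by rewrite ?(s1 y) ?(s1 z) //; split; lia.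
- have a1 := sp _ _ xv zw; have a2 := sp _ _ yv zw.
  have a3 := s1 _ yv; have a4 := s2 _ zw; split; lia.
- have a1 := sp _ _ xv yw; have a2 := sp _ _ zv yw.
  have a3 := s1 _ zv; have a4 := s2 _ yw; split; lia.
- have a1 := sp _ _ xv yw; have a2 := sp _ _ xv zw.
  have a3 := s2 _ zw; have a4 := s2 _ yw; split; lia.
Qed.

Lemma wdist_geo p q k : (k <= wdist p q)%N ->
  exists r, wdist p r = k /\ (wdist p r + wdist r q = wdist p q)%N.
Proof.
elim: k => [|k IH] kd.
  by exists p; have -> : wdist p p = 0 by apply/wdist_eq0.
have [|r [e1 e2]] := IH; first lia.
have [|s [rs e3]] := @wdist_first r q; first lia.
exists s; have := wdist_tri p r s; have := wdist_tri p s q; rewrite (wdist_edge rs); lia.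
Qed.

Lemma wdist_mor (a : P -> P) : (forall p q, eqv p q -> eqv (a p) (a q)) ->
  (forall p q, E p q -> E (a p) (a q)) -> forall p q, (wdist (a p) (a q) <= wdist p q)%N.
Proof.
move=> ae aE p q; apply: wdist_le; have := wdist_walk p q.
move: (wdist p q) => n; elim: n p => [|n IH] p /=; first exact: ae.
by case=> r pr /IH rq; exists (a r) => //; exact: aE.
Qed.

End WallGraph.

Record subgroup (A : groupType) (S : A -> Prop) : Prop := Subgroup {
  subg1 : S 1;
  subgM : forall x y, S x -> S y -> S (x * y);
  subgV : forall x, S x -> S x^-1 }.

Lemma subgX (A : groupType) (S : A -> Prop) x n : subgroup S -> S x -> S (x ^+ n).
Proof. by move=> [s1 sM _] Sx; elim: n => // n IH; rewrite expgS; apply: sM. Qed.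

Lemma subgZ (A : groupType) (S : A -> Prop) x i : subgroup S -> S x -> S (zexp x i).
Proof.
by move=> sS Sx; case: i => n /=; [|apply: (subgV sS)]; apply: subgX.
Qed.

Definition cyc (A : groupType) (x g : A) := exists i, g = zexp x i.

Lemma cyc_subgroup (A : groupType) (x : A) : subgroup (cyc x).
Proof.
split; first by exists 0%R.
  by move=> _ _ [i ->] [j ->]; exists (i + j)%R; rewrite zexpD.
by move=> _ [i ->]; exists (- i)%R; rewrite zexpN.
Qed.

Lemma cyc_id (A : groupType) (x : A) : cyc x x.
Proof. by exists 1%R. Qed.

Section CosetTree.
Variables (A : groupType) (I J : Type) (G : I -> A -> Prop) (H : J -> A -> Prop).
Variables (inc : J -> I -> Prop) (i0 : I).
Hypothesis sG : forall i, subgroup (G i).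
Hypothesis sH : forall j, subgroup (H j).
Hypothesis HG : forall j i x, inc j i -> H j x -> G i x.
Hypothesis incJ : forall j, exists i, inc j i.

(** The pair (g, inl i) stands for the coset g G_i and (g, inr j) for g H_j; two cosets are adjacent
    when the second is contained in the first. Giving the edge groups vertices of their own makes
    the graph bipartite. *)
Let pnt := (A * (I + J))%type.
Definition cstab (k : I + J) := match k with inl i => G i | inr j => H j end.
Definition ceqv (p q : pnt) := p.2 = q.2 /\ cstab p.2 (p.1^-1 * q.1).
Definition cedge (p q : pnt) := exists i j, [/\ inc j i, G i (p.1^-1 * q.1) &
  (p.2 = inl i /\ q.2 = inr j) \/ (p.2 = inr j /\ q.2 = inl i)].
Definition cty (p : pnt) := if p.2 is inl _ then true else false.
Definition cact (g : A) (p : pnt) : pnt := (g * p.1, p.2).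

Hypothesis gen_ind : forall Q : A -> Prop, Q 1 ->
  (forall i x g, G i x -> Q g -> Q (x * g)) -> forall g, Q g.
Hypothesis block_connected : forall k l,
  exists n, walk ceqv cedge n (1, k) (1, l).
(* [theta] is the action on a double cover of [A] ramified along one coset of
   [H j1]: the sheet changes when the edge [(j1, i1)] is crossed. *)
Hypothesis double_cover : forall i1 j1, inc j1 i1 ->
  exists (theta : A -> bij (A * bool)) (s : I + J -> bool),
  [/\ {morph theta : x y / x * y}, s (inl i1) != s (inr j1),
      forall i j, inc j i -> s (inl i) != s (inr j) -> i = i1 /\ j = j1 &
      forall k x t e, cstab k x -> bfun (theta x) (t, e) =
        (x * t, e (+) (s k && (`[< H j1 t >] (+) `[< H j1 (x * t) >])))].

Lemma cstab_subg k : subgroup (cstab k).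
Proof. by case: k => /=. Qed.

Lemma ceqvxx p : ceqv p p.
Proof. by split=> //; rewrite mulVg; exact: (subg1 (cstab_subg _)). Qed.

Lemma ceqvC p q : ceqv p q -> ceqv q p.
Proof.
case: p q => [g k] [h l] [/= <- s]; split=> //=.
by have := subgV (cstab_subg k) s; rewrite invgM invgK.
Qed.

Lemma ceqvT p q r : ceqv p q -> ceqv q r -> ceqv p r.
Proof.
case: p q r => [g k] [h l] [f m] [/= <- s] [/= <- s']; split=> //=.
by have := subgM (cstab_subg k) s s'; rewrite mulgA mulgK.
Qed.

Lemma cedgeC p q : cedge p q -> cedge q p.
Proof.
move=> [i [j [ij s e]]]; exists i, j; split=> //; last by case: e => -[]; auto.
by have := subgV (sG i) s; rewrite invgM invgK.
Qed.

Lemma cedge_eqv p p' q : ceqv p p' -> cedge p q -> cedge p' q.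
Proof.
case: p p' => [g k] [h _] [/= <- s] [i [j [ij s' e]]]; exists i, j; split=> //=.
have {}s : G i (g^-1 * h).
  by case: e s => -[/= -> _] //=; exact: HG.
by have := subgM (sG i) (subgV (sG i) s) s'; rewrite invgM invgK /= mulgA mulgK.
Qed.

Lemma cty_eqv p q : ceqv p q -> cty p = cty q.
Proof. by rewrite /cty => -[->]. Qed.

Lemma cty_edge p q : cedge p q -> cty p = ~~ cty q.
Proof. by rewrite /cty => -[i [j [_ _ [[-> ->]|[-> ->]]]]]. Qed.

Lemma cact_eqv g p q : ceqv p q -> ceqv (cact g p) (cact g q).
Proof. by move=> [e s]; split=> //=; rewrite invgM mulgA mulgVK. Qed.

Lemma cact_edge g p q : cedge p q -> cedge (cact g p) (cact g q).
Proof.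
by move=> [i [j [ij s e]]]; exists i, j; split=> //=; rewrite invgM mulgA mulgVK.
Qed.

Lemma walk_act g n p q : walk ceqv cedge n p q -> walk ceqv cedge n (cact g p) (cact g q).
Proof.
elim: n p => [|n IH] p /=; first exact: cact_eqv.
by case=> r pr /IH rq; exists (cact g r) => //; exact: cact_edge.
Qed.

Lemma cconnected p q : exists n, walk ceqv cedge n p q.
Proof.
have st g : forall k l, exists n, walk ceqv cedge n (1, k) (g, l).
  elim/gen_ind: g => [|i x g Gx IH] k l; first exact: block_connected.
  have [n w] := block_connected k (inl i).
  have [n' /(walk_act x)] := IH (inl i) l; rewrite /cact /= mulg1 => w'.
  exists (n + n')%N; apply: (walk_cat ceqvC ceqvT cedge_eqv w).
  apply: (walk_eqvl ceqvC ceqvT cedge_eqv _ w'); apply: ceqvC.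
  by split=> //=; rewrite invg1 mul1g.
case: p q => [g k] [h l]; have [n /(walk_act g)] := st (g^-1 * h) k l.
by rewrite /cact /= mulg1 mulVKg; exists n.
Qed.

Lemma cwalls u w : cedge u w -> exists f : pnt -> bool,
  [/\ f u != f w, forall p q, ceqv p q -> f p = f q &
      forall p q, cedge p q -> f p != f q ->
        (ceqv p u /\ ceqv q w) \/ (ceqv p w /\ ceqv q u)].
Proof.
move=> [i1 [j1 [ij su ku]]].
have [theta [s [thM s1 s2 thE]]] := double_cover ij.
have th1 g t e : bfun (theta g) (t, e) =
    (g * t, (bfun (theta g) (t, false)).2 (+) e).
  elim/gen_ind: g t e => [|i x g Gx IH] t e; first by rewrite (mor1 thM) mul1g.
  have e1 : bfun (theta g) (t, false) = (g * t, (bfun (theta g) (t, false)).2).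
    by rewrite {1}IH addbF.
  rewrite !thM !bijM IH e1 /= !(thE (inl i) x _ _ Gx) /= mulgA.
  by move: (_ && _) (bfun _ _).2 => b1 b2; case: b1; case: b2; case: e.
(* [theta g] carries the fibre over g^-1 to the fibre over 1. [f] records whether it exchanges the
   sheets, and the term with [s] makes the answer the same for all representatives of a coset. This
   is the wall of the edge at the identity; other edges are reached by translation. *)
pose f (p : pnt) := (bfun (theta p.1) (p.1^-1, false)).2 (+) (s p.2 && `[< H j1 p.1 >]).
have Hinv x : `[< H j1 x^-1 >] = `[< H j1 x >].
  by apply: asbool_equiv_eq; split=> /(subgV (sH j1)); rewrite ?invgK.
have fe p q : ceqv p q -> f p = f q.
  case: p q => [g k] [h _] [/= <- gh]; rewrite /f /=.
  rewrite -(mulVKg g h) in gh *; move: (g^-1 * h) gh => z; rewrite mulKg => gz.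
  rewrite thM bijM invgM (thE _ _ _ _ gz) mulVKg [in RHS]th1 /= -invgM !Hinv.
  move: `[< H j1 (g * z) >] `[< H j1 g >] (bfun _ _).2 (s k) => b1 b2 b3 b4.
  by case: b1; case: b2; case: b3; case: b4.
have fij g i j : inc j i -> f (g, inl i) != f (g, inr j) ->
    [/\ i = i1, j = j1 & H j1 g].
  move=> ji; rewrite /f /=; have [e|/(s2 _ _ ji) [-> ->]] := eqVneq (s (inl i)) (s (inr j)).
    by rewrite e eqxx.
  by case: asboolP => // _; rewrite !andbF eqxx.
have fij1 g : H j1 g -> f (g, inl i1) != f (g, inr j1).
  move=> /asboolP Hg; rewrite /f /= Hg !andbT; move: s1.
  by move: (s (inl i1)) (s (inr j1)) (bfun _ _).2 => [] [] [].
(* the common representative of the edge [uw] is its vertex of type [J] *)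
pose y := if w.2 is inr _ then w.1 else u.1.
have kij p q : cedge p q -> exists g i j, [/\ inc j i, f (cact y^-1 p) != f (cact y^-1 q) -> [/\ i = i1, j = j1 & H j1 (y^-1 * g)] &
   (ceqv p (g, inl i) /\ ceqv q (g, inr j)) \/ (ceqv p (g, inr j) /\ ceqv q (g, inl i))].
  case: p q => [g k] [h l] [i [j [ji /= gh [[-> ->]|[-> ->]]]]].
    have e : ceqv (g, inl i) (h, inl i) by [].
    exists h, i, j; split=> //; last by left; split=> //; exact: ceqvxx.
    by rewrite (fe _ _ (cact_eqv y^-1 e)) => /fij-/(_ ji).
  have e : ceqv (h, inl i) (g, inl i) by apply: ceqvC.
  exists g, i, j; split=> //; last by right; split=> //; exact: ceqvxx.
  by rewrite eq_sym (fe _ _ (cact_eqv y^-1 e)) => /fij-/(_ ji).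
have uy : (ceqv u (y, inl i1) /\ ceqv w (y, inr j1)) \/ (ceqv u (y, inr j1) /\ ceqv w (y, inl i1)).
  rewrite /y; case: u w su ku {y kij} => [g k] [h l] /= gh [[-> ->]|[-> ->]]; [left|right].
    by split=> //; exact: ceqvxx.
  by split; [exact: ceqvxx|apply: ceqvC].
have sw a b c : ceqv a c -> ceqv b c -> ceqv a b.
  by move=> ac bc; apply: ceqvT ac (ceqvC bc).
exists (fun p => f (cact y^-1 p)); split.
- have yy k : cact y^-1 (y, k) = (1, k) by rewrite /cact /= mulVg.
  have H1 := fij1 1 (subg1 (sH j1)).
  case: uy => -[/(cact_eqv y^-1)/fe -> /(cact_eqv y^-1)/fe ->]; rewrite !yy //.
  by rewrite eq_sym.
- by move=> p q /(cact_eqv y^-1)/fe.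
move=> p q /kij [g [i [j [ji fne pq]]]] /fne [ei ej yg]; subst i j.
have a1 : ceqv (g, inl i1) (y, inl i1).
  by apply: ceqvC; split=> //=; exact: HG yg.
have a2 : ceqv (g, inr j1) (y, inr j1) by apply: ceqvC.
case: pq uy => -[p1 q1] [] [u1 w1]; [left|right|right|left]; split;
  first [exact: sw (ceqvT p1 a1) u1 | exact: sw (ceqvT p1 a1) w1
        |exact: sw (ceqvT p1 a2) u1 | exact: sw (ceqvT p1 a2) w1
        |exact: sw (ceqvT q1 a1) u1 | exact: sw (ceqvT q1 a1) w1
        |exact: sw (ceqvT q1 a2) u1 | exact: sw (ceqvT q1 a2) w1].
Qed.

Notation cdist := (wdist cconnected).

Lemma cdist_act g p q : cdist (cact g p) (cact g q) = cdist p q.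
Proof.
have le h p' q' : (cdist (cact h p') (cact h q') <= cdist p' q')%N.
  by apply: wdist_mor; [exact: cact_eqv|exact: cact_edge].
apply/eqP; rewrite eqn_leq le /=.
by have := le g^-1 (cact g p) (cact g q); rewrite /cact /= !mulKg -!surjective_pairing.
Qed.

Lemma cdist_par p q r : ~~ odd (cdist p q + cdist q r + cdist p r).
Proof.
rewrite !oddD !(wdist_odd cty_eqv cty_edge).
by case: (cty p); case: (cty q); case: (cty r).
Qed.

Lemma cdist_inv g p : ~~ odd (cdist p (cact g p)).
Proof. by rewrite (wdist_odd cty_eqv cty_edge) /cty /= eqxx. Qed.

Definition coset_tree : tree_action A := @TreeAction A pnt (1, inl i0)
  cdist cact
  (fun p => (wdist_eq0 cconnected p p).2 (ceqvxx p))
  (wdistC ceqvxx ceqvC ceqvT cedgeC cedge_eqv cconnected)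
  (wdist4 ceqvxx ceqvC ceqvT cedgeC cedge_eqv cty_eqv cty_edge cconnected cwalls)
  (fun _ _ _ kd => wdist_geo ceqvxx ceqvC ceqvT cedge_eqv cty_eqv cty_edge kd)
  cdist_par
  (fun p => let: (g, k) := p in congr1 (pair^~ k) (mul1g g))
  (fun g h p => congr1 (pair^~ p.2) (esym (mulgA g h p.1)))
  cdist_act cdist_inv.

Lemma coset_fixes g h k :
  @fixes A coset_tree g (h, k) <-> cstab k (h^-1 * g * h).
Proof.
rewrite /fixes /=; split=> [/(wdist_eq0 _ _ _).1 [_]|s].
  by rewrite /= mulgA.
by apply/wdist_eq0; split=> //=; rewrite mulgA.
Qed.

Lemma coset_edge_fixes (p q : coset_tree) : (0 < dist p q)%N ->
  forall h i, p = (h, inl i) -> exists j k, [/\ inc j i, G i k,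
    forall g, fixes g p -> fixes g q -> H j ((h * k)^-1 * g * (h * k)) &
    forall h' i', q = (h', inl i') -> exists i'', inc j i'' /\ i'' <> i].
Proof.
move=> pq h i ep; have [|r [pr e]] := @wdist_first _ _ _ ceqvxx ceqvC ceqvT cedge_eqv cconnected p q.
  by rewrite -lt0n.
have pr1 : @dist _ coset_tree p r = 1%N by apply: (wdist_edge (ty := cty)) pr; [exact: ceqvxx|exact: cty_eqv|exact: cty_edge].
have fixr g : fixes g p -> fixes g q -> fixes g (r : coset_tree).
  by move=> gp gq; apply: (fixes_geo gp gq); rewrite pr1 /= e add1n.
have [i1 [j [ij s k]]] := pr; subst p; case: k => -[//= [ei] r2j]; subst i1.
case: r s pr e pr1 fixr r2j => r1 r2 /= s pr e pr1 fixr r2j; subst r2.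
exists j, (h^-1 * r1); rewrite mulVKg; split=> // [g gp gq|h' i' eq].
  by apply/(coset_fixes g r1 (inr j)); exact: fixr.
have [|r' [rr' e']] := @wdist_first _ _ _ ceqvxx ceqvC ceqvT cedge_eqv cconnected (r1, inr j) q.
  apply/eqP => e0; move: e; rewrite e0 => e1; subst q.
  by have := (wdist_eq0 cconnected _ _).1 e0 => -[].
have [i2 [j2 [ij2 s2 [[] //|[[ej] er']]]]] := rr'; subst j2.
exists i2; split=> // ei; subst i2.
(* With the same index the second step would lead back to the coset [h G_i], against the minimality
   of the path. *)
have : cdist (h, inl i) r' = 0.
  apply/wdist_eq0; split=> //=.
  by have := subgM (sG i) s s2; rewrite /= mulgA mulgK.
have := wdist_tri ceqvC ceqvT cedge_eqv cconnected (h, inl i) r' q.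
by rewrite e e'; lia.
Qed.

(** The interface through which such trees are used: [big h i] is the vertex [h G_i]. The fourth
    clause reads off the first edge of a path that starts there, the fifth puts every element with
    two distinct fixed points into a conjugate of an edge group. *)
Lemma coset_tree_exists : exists (T : tree_action A) (big : A -> I -> T),
  [/\ forall g h i, fixes g (big h i) <-> G i (h^-1 * g * h),
      forall g i h i', dist (big g i) (big h i') = 0 <-> i = i' /\ G i (g^-1 * h),
      (forall c h i, act c (big h i) = big (c * h) i) /\
      (forall p : T, exists h i, forall g, fixes g p -> fixes g (big h i)),
      forall h i (x : T), (0 < dist (big h i) x)%N -> exists j k, [/\ inc j i, G i k,
        forall g, fixes g (big h i) -> fixes g x -> H j ((h * k)^-1 * g * (h * k)) &
        forall h' i', x = big h' i' -> exists i'', inc j i'' /\ i'' <> i] &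
      forall g (p q : T), (0 < dist p q)%N -> fixes g p -> fixes g q ->
        exists j h, H j (h^-1 * g * h)].
Proof.
exists coset_tree, (fun h i => (h, inl i)); split.
- by move=> g h i; exact: (coset_fixes g h (inl i)).
- move=> g i h i'; split=> [/(wdist_eq0 cconnected _ _).1 [/= [->]] //|[<- s]].
  by apply/wdist_eq0.
- split=> // -[h [i|j]]; first by exists h, i.
  have [i ij] := incJ j; exists h, i => g gp; apply/(coset_fixes g h (inl i)).
  by apply: (HG ij); apply/(coset_fixes g h (inr j)).
- by move=> h i x hx; exact: coset_edge_fixes hx _ _ erefl.
- move=> g [h [i|j]] q pq gp gq; last by exists j, h; apply/(coset_fixes g h (inr j)).
  have [j [k [_ _ fx _]]] := coset_edge_fixes pq erefl.
  by exists j, (h * k); exact: fx.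
Qed.

End CosetTree.

(** * The reflection representation *)

Section Alternating.
Variable K : groupType.
Implicit Types x y : K.

Lemma altSr x y n : alt x y n.+1 = alt x y n * (if odd n then y else x).
Proof.
elim: n x y => [|n IH] x y; first by rewrite /= mulg1 mul1g.
by rewrite [LHS]/= -/(alt y x n.+1) IH mulgA /= if_neg.
Qed.

Lemma expgM_swap x y n : (x * y) ^+ n * x = x * (y * x) ^+ n.
Proof.
elim: n => [|n IH]; first by rewrite mulg1 mul1g.
by rewrite expgS [in RHS]expgS -(mulgA (x * y)) IH !mulgA.
Qed.

(** The power is the product of [alt x y m] with itself when [m] is even and with [alt y x m] when
    [m] is odd; in both cases it is the square of the common value of the two alternating words,
    hence symmetric in [x] and [y]. *)
Lemma alt_center x y m : alt x y m = alt y x m -> (x * y) ^+ m = (y * x) ^+ m.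
Proof.
rewrite -[m]odd_double_half addnC; case: (odd m); rewrite ?addn1 ?addn0 => e; last first.
  by rewrite !alt_double in e; rewrite -addnn !expgnDr e.
move: m./2 e => n; rewrite !alt_double1 => e.
have f (a b : K) : (a * b) ^+ n.*2.+1 = (a * b) ^+ n * a * ((b * a) ^+ n * b).
  by rewrite (expgM_swap b a) -addnn -addnS expgnDr expgS !mulgA.
by rewrite !f e.
Qed.

Lemma alt_center_commute x y m : alt x y m = alt y x m ->
  commute ((x * y) ^+ m) x /\ commute ((x * y) ^+ m) y.
Proof.
move=> /alt_center e; split; rewrite /commute; first by rewrite expgM_swap e.
by rewrite -expgM_swap e.
Qed.

Lemma alt_involution x y m : x * x = 1 -> y * y = 1 -> (x * y) ^+ m = 1 ->
  alt x y m = alt y x m.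
Proof.
move=> xx yy; have xV : x^-1 = x by apply/mulg1_eq.
have yV : y^-1 = y by apply/mulg1_eq.
have inv n : (y * x) ^+ n = (x * y) ^- n by rewrite -expVgn invgM xV yV.
rewrite -[m in _ ^+ m]odd_double_half -[m in alt x y m]odd_double_half -[m in alt y x m]odd_double_half.
rewrite addnC; case: (odd m); rewrite ?addn1 ?addn0; last first.
  by rewrite !alt_double inv -addnn expgnDr => e; apply: (mulIg ((x * y) ^+ m./2)); rewrite mulVg.
rewrite !alt_double1 inv -addnn expgSr expgnDr => e.
apply: (mulgI ((x * y) ^+ m./2)); rewrite mulVKg.
by apply: (mulIg y); rewrite yy -e !mulgA.
Qed.

End Alternating.

Lemma gadj_neq (G : lgraph) (a b : gV G) : gadj a b -> a != b.
Proof. by apply: contraTneq => ->; rewrite gadj_irr. Qed.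

Section Reflections.
Import GRing.Theory Num.Theory.
Variable G : lgraph.
Notation V := (gV G).
Local Open Scope ring_scope.

(** Writing [m.-1.+1] keeps the order positive for every [m]. Any primitive root of order 2m serves,
    because only identities shared by all conjugates of 2 cos(pi/m) are used. *)
Definition zeta (m : nat) : algC := sval (C_prim_root_exists (n := m.-1.+1.*2) isT).
Definition coxc (m : nat) : algC := zeta m + (zeta m)^-1.

Lemma zeta_prim m : (0 < m)%N -> (m.*2).-primitive_root (zeta m).
Proof. by case: m => // m _; exact: (svalP (C_prim_root_exists _)). Qed.

(** The entry 0 makes the reflections of nonadjacent vertices commute. What is wanted is a
    homomorphism out of the Artin group that tells generators apart, not a faithful representation
    of its Coxeter group. *)
Definition cartan (a b : V) : algC :=
  if a == b then -2%:R else if gadj a b then coxc (glab a b) else 0.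

Definition form (a : V) (x : V -> algC) : algC := \sum_b cartan a b * x b.
Definition refl_fun (a : V) (x : V -> algC) : V -> algC := fun b => x b + (b == a)%:R * form a x.

Lemma form_refl a b x : form a (refl_fun b x) = form a x + cartan a b * form b x.
Proof.
rewrite /form /refl_fun; under eq_bigr do rewrite mulrDr.
rewrite big_split /=; congr (_ + _).
rewrite (bigD1 b) //= eqxx mul1r big1 ?addr0 // => c /negPf ->.
by rewrite mul0r mulr0.
Qed.

Lemma reflK a : involutive (refl_fun a).
Proof.
move=> x; apply: funext => b; rewrite {1}/refl_fun form_refl /cartan eqxx /refl_fun.
by ring.
Qed.

Definition refl a : bij (V -> algC) := Bij (reflK a) (reflK a).

Lemma reflE a x b : bfun (refl a) x b = x b + (b == a)%:R * form a x.
Proof. by []. Qed.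

Lemma refl_sq a : (refl a * refl a)%g = 1%g.
Proof. by apply: bij_ext => x; exact: reflK. Qed.

Lemma reflV a : ((refl a)^-1)%g = refl a.
Proof. by apply: mulg1_eq; exact: refl_sq. Qed.

Lemma geom_root (m : nat) (y : algC) : y != 1 -> y ^+ m = 1 -> \sum_(i < m) y ^+ i = 0.
Proof.
move=> y1 ym; have := subrX1 y m; rewrite ym subrr => /esym/eqP.
by rewrite mulf_eq0 subr_eq0 (negPf y1) => /eqP.
Qed.

(** The characteristic roots [e] and [e^-1] are distinct m-th roots of unity other than 1, so the
    sequence combines two geometric sequences whose sums over a period vanish. *)
Lemma linrec_sum (m : nat) (e : algC) (q : nat -> algC) :
  e != 0 -> e ^+ m = 1 -> e != 1 -> e ^+ 2 != 1 ->
  (forall i, q i.+2 = (e + e^-1) * q i.+1 - q i) -> \sum_(i < m) q i = 0.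
Proof.
move=> e0 em e1 e2 qS.
have X i : q i.+1 - e^-1 * q i = e ^+ i * (q 1%N - e^-1 * q 0).
  elim: i => [|i IH]; first by rewrite mul1r.
  by rewrite exprS -mulrA -IH qS; field.
have Y i : q i.+1 - e * q i = (e^-1) ^+ i * (q 1%N - e * q 0).
  elim: i => [|i IH]; first by rewrite mul1r.
  by rewrite exprS -mulrA -IH qS; field.
have ee : e - e^-1 != 0.
  apply: contra e2 => /eqP h; apply/eqP.
  have -> : e ^+ 2 = 1 + e * (e - e^-1) by field.
  by rewrite h mulr0 addr0.
apply: (mulfI ee); rewrite mulr0 mulr_sumr.
transitivity (\sum_(i < m) (e ^+ i * (q 1%N - e^-1 * q 0) - (e^-1) ^+ i * (q 1%N - e * q 0))).
  by apply: eq_bigr => i _; rewrite -X -Y; ring.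
rewrite sumrB -!mulr_suml !geom_root ?mul0r ?subrr //.
  by rewrite invr_eq1.
by rewrite exprVn em invr1.
Qed.

Lemma coxc_rel m : (2 < m)%N -> exists e : algC,
  [/\ e != 0, e ^+ m = 1, e != 1, e ^+ 2 != 1 & coxc m ^+ 2 = e + e^-1 + 2%:R].
Proof.
move=> m2; have m0 : (0 < m)%N by lia.
have zp := zeta_prim m0.
have z0 : zeta m != 0 by apply/eqP => z0; have := prim_expr_order zp;
  rewrite z0 expr0n; case: m m2 {zp z0 m0} => //= m _ /eqP; rewrite eq_sym oner_eq0.
have pw k : (0 < k < m.*2)%N -> zeta m ^+ k != 1.
  by move=> k1; rewrite -(prim_order_dvd zp) gtnNdvd //; lia.
exists (zeta m ^+ 2); split; first by rewrite expf_neq0.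
- by rewrite -exprM mul2n (prim_expr_order zp).
- by apply: pw; lia.
- by rewrite -exprM; apply: pw; lia.
- by rewrite /coxc; field.
Qed.

Lemma coxc2 : coxc 2 = 0.
Proof.
have zp := zeta_prim (isT : (0 < 2)%N); set z := zeta 2 in zp.
have z4 : z ^+ 4 = 1 by exact: prim_expr_order zp.
have z2 : z ^+ 2 != 1 by rewrite -(prim_order_dvd zp).
have zm : z ^+ 2 = -1.
  have : (z ^+ 2 - 1) * (z ^+ 2 + 1) = 0.
    by rewrite -subr_sqr expr1n -exprM z4 subrr.
  by move/eqP; rewrite mulf_eq0 subr_eq0 (negPf z2) addr_eq0 => /eqP.
have z0 : z != 0 by apply/eqP => z0; move: z4; rewrite z0 expr0n => /eqP; rewrite eq_sym oner_eq0.
apply: (mulfI z0); rewrite mulr0 /coxc -/z mulrDr divff // -expr2 zm addNr //.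
Qed.

Lemma coxc_neq0 m : (2 < m)%N -> coxc m != 0.
Proof.
move=> /coxc_rel [e [e0 _ _ e2 ce]]; apply/eqP => c0; move: ce; rewrite c0 expr0n /=.
move=> h; have h2 : (e + 1) ^+ 2 = 0.
  have -> : (e + 1) ^+ 2 = e * (e + e^-1 + 2%:R) by field.
  by rewrite -h mulr0.
move: e2; rewrite -subr_eq0 (_ : e ^+ 2 - 1 = (e - 1) * (e + 1)); last by ring.
by move/eqP: h2; rewrite expf_eq0 /= => /eqP ->; rewrite mulr0 eqxx.
Qed.

(** The vector R^n x differs from x by multiples of the basis vectors at [a] and [b], with partial
    sums of [p] and [q] as coefficients. Both sequences obey the recurrence with roots [e] and
    [e^-1], so a full period contributes nothing. *)
Lemma refl_order a b : gadj a b -> ((refl a * refl b) ^+ glab a b = 1)%g.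
Proof.
move=> ab; have nab : a == b = false by apply/negbTE/eqP => e; move: ab; rewrite e gadj_irr.
have nba : b == a = false by rewrite eq_sym.
set m := glab a b; pose c := coxc m.
have cab : cartan a b = c by rewrite /cartan nab ab.
have cba : cartan b a = c by rewrite /cartan nba gadj_sym ab -glab_sym.
have caa v : cartan v v = -2%:R by rewrite /cartan eqxx.
apply: bij_ext => x.
pose R := (refl a * refl b)%g.
pose p i := form a (bfun (R ^+ i)%g x); pose q i := form b (bfun (R ^+ i)%g x).
have pS i : p i.+1 = - p i - c * q i.
  rewrite /p /q expgS bijM /R bijM /= !form_refl cab caa; ring.
have qS i : q i.+1 = c * p i + (c ^+ 2 - 1) * q i.
  rewrite /p /q expgS bijM /R bijM /= !form_refl cab cba caa; ring.
have RE n y : bfun (R ^+ n)%g x y = x y + (y == a)%:R * (\sum_(i < n) (p i + c * q i))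
     + (y == b)%:R * (\sum_(i < n) q i).
  elim: n => [|n IH]; first by rewrite !big_ord0 !mulr0 !addr0.
  rewrite expgS bijM {1}/R bijM !reflE !big_ord_recr /=.
  rewrite IH form_refl cab -/(p n) -/(q n); ring.
suff [sp sq] : \sum_(i < m) p i = 0 /\ \sum_(i < m) q i = 0.
  apply: funext => y; rewrite RE big_split /= -mulr_sumr sp sq; ring.
have m2 : (1 < m)%N := glab_ge2 ab.
(* For label 2 both characteristic roots are -1, so this case is computed directly. *)
have [e|n2] := eqVneq m 2%N.
  have c0 : c = 0 by rewrite /c e coxc2.
  rewrite e !big_ord_recr !big_ord0 /= pS qS c0; split; ring.
have [|e [e0 em e1 e2 ce]] := @coxc_rel m; first lia.
split; apply: (linrec_sum e0 em e1 e2) => i;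
  have -> : e + e^-1 = c ^+ 2 - 2%:R by rewrite ce addrK.
- by rewrite !(pS, qS); ring.
- by rewrite !(pS, qS); ring.
Qed.

Lemma refl_noncommute a b : gadj a b -> (2 < glab a b)%N -> ~ commute (refl a) (refl b).
Proof.
move=> ab m2 e.
have nab : a == b = false by apply/negbTE/eqP => h; move: ab; rewrite h gadj_irr.
pose x : gV G -> algC := fun y => (y == b)%:R.
have fx v : form v x = cartan v b.
  rewrite /form (bigD1 b) //= /x eqxx mulr1 big1 ?addr0 // => i /negPf ->.
  by rewrite mulr0.
have := congr1 (fun f => bfun f x a) e; rewrite !bijM !reflE !form_refl !fx eqxx nab.
rewrite /cartan eqxx nab ab /x nab !mul0r !add0r !addr0 !mul1r => h.
have /eqP : coxc (glab a b) * 2%:R = 0.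
  have -> : coxc (glab a b) * 2%:R = coxc (glab a b) - (coxc (glab a b) + coxc (glab a b) * -2%:R) by ring.
  by rewrite h subrr.
by rewrite mulf_eq0 pnatr_eq0 orbF (negPf (coxc_neq0 m2)).
Qed.

(** Plays the role of the parabolic subgroup on [S]: it is closed under products and contains
    [refl v] exactly when [v] lies in [S]. *)
Definition trivial_off (S : {set gV G}) (g : bij (gV G -> algC)) :=
  forall x y, y \notin S -> bfun g x y = x y.

Lemma trivial_off_subgroup S : subgroup (trivial_off S).
Proof.
split=> [x y //|f g fS gS x y yS|f fS x y yS].
  by rewrite bijM fS ?gS.
by rewrite -[RHS](congr1 (@^~ y) (binvK f x)) (fS (binv f x)).
Qed.

Lemma trivial_off_refl S v : (trivial_off S (refl v) <-> v \in S).
Proof.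
split=> [h|vS x y yS]; last first.
  by rewrite reflE; case: eqP => [e|_]; [rewrite e vS in yS|rewrite mul0r addr0].
apply: contraT => vS; have := h (fun y => (y == v)%:R) v vS.
rewrite reflE eqxx mul1r /form (bigD1 v) //= eqxx mulr1 big1 ?addr0; last first.
  by move=> i /negPf ->; rewrite mulr0.
rewrite /cartan eqxx => /eqP; rewrite -subr_eq0 addrAC subrr add0r oppr_eq0.
by rewrite pnatr_eq0.
Qed.

Lemma refl_inj : injective refl.
Proof.
move=> a b e; apply/set1P; apply/trivial_off_refl; rewrite e.
by apply/trivial_off_refl; exact: set11.
Qed.

End Reflections.

(** * Counting mirror crossings *)

Notation artin G := (art (@gadj G) (@glab G)).
Notation agen v := (gen (@gadj _) (@glab _) v).

Lemma art_ind (V : Type) (adj : rel V) m (P : art adj m -> Prop) : P 1 ->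
  (forall v g, P g -> P (gen adj m v * g)) ->
  (forall v g, P g -> P ((gen adj m v)^-1 * g)) -> forall g, P g.
Proof.
move=> P1 Pg PV g; have [w ->] := cls_surj g; rewrite cls_ev.
by elim: w => // -[a []] w IH /=; [apply: PV|apply: Pg].
Qed.

Definition translation (k : int) : bij int :=
  Bij (GRing.addrK k : cancel (fun n => n + k)%R (fun n => n - k)%R) (GRing.subrK k).

Lemma translationD k l : translation (k + l)%R = translation k * translation l.
Proof. by apply: bij_ext => n /=; lia. Qed.

(** The integers act on themselves by translations, so the weight is a lift. A relation of even
    length holds in every abelian group, and one of odd length asks for equal values. *)
Lemma weight_exists (V : Type) (adj : rel V) m (f : V -> int) :
  (forall a b, adj a b -> odd (m a b) -> f a = f b) ->
  exists chi : art adj m -> int,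
    (forall x y, chi (x * y) = (chi x + chi y)%R) /\ forall v, chi (gen adj m v) = f v.
Proof.
move=> fodd; pose t v := translation (f v).
have tR : respects t adj m.
  move=> a b ab; have c : commute (t a) (t b).
    by rewrite /commute -!translationD GRing.addrC.
  rewrite -[m a b]odd_double_half addnC.
  case mo: (odd (m a b)); rewrite ?addn1 ?addn0; first by rewrite /t (fodd a b ab mo).
  by rewrite !alt_double c.
have tr (g : art adj m) : exists k, lift t g = translation k.
  elim/art_ind: g => [|v g [k e]|v g [k e]].
  - by exists 0%R; rewrite (mor1 (liftM tR)); apply: bij_ext => n /=; lia.
  - by exists (f v + k)%R; rewrite (liftM tR) lift_gen // e translationD.
  exists (- f v + k)%R; rewrite (liftM tR) (morV (liftM tR)) lift_gen // e translationD.
  by congr (_ * _); apply: mulg1_eq; apply: bij_ext => n /=; lia.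
exists (fun g => bfun (lift t g) 0%R); split.
  move=> x y; rewrite (liftM tR); have [k ->] := tr x; have [l ->] := tr y.
  by rewrite bijM /=; lia.
by move=> v; rewrite lift_gen //= GRing.add0r.
Qed.

Section Cocycle.
Variable G : lgraph.
Notation V := (gV G).
Notation W := (bij (gV G -> algC)).
Notation s := (@refl G).

(** The classical action of a Coxeter group on reflections with signs, refined by an integer counter
    in place of the sign: conjugate by [s a], and add one when the mirror is that of [a]. The square
    of a generator adds two at its own mirror, so this is an action of the Artin group and not of
    the Coxeter group. *)
Definition count_fun (a : V) (p : W * int) : W * int :=
  (s a * p.1 * s a, (p.2 + (p.1 == s a)%:R)%R).
Definition count_inv (a : V) (p : W * int) : W * int :=
  (s a * p.1 * s a, (p.2 - (p.1 == s a)%:R)%R).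

Lemma conj_refl_eq a (t r : W) : (s a * t * s a == r) = (t == s a * r * s a).
Proof.
apply/eqP/eqP => [<-|->]; rewrite !mulgA refl_sq mul1g -mulgA refl_sq mulg1 //.
Qed.

Lemma count_funK a : cancel (count_fun a) (count_inv a).
Proof.
move=> [t k]; rewrite /count_fun /count_inv /= conj_refl_eq refl_sq mul1g.
by rewrite !mulgA refl_sq mul1g -mulgA refl_sq mulg1; congr pair; lia.
Qed.

Lemma count_invK a : cancel (count_inv a) (count_fun a).
Proof.
move=> [t k]; rewrite /count_fun /count_inv /= conj_refl_eq refl_sq mul1g.
by rewrite !mulgA refl_sq mul1g -mulgA refl_sq mulg1; congr pair; lia.
Qed.

Definition count a := Bij (count_funK a) (count_invK a).

Fixpoint ralt (K : groupType) (x y : K) n := if n is n'.+1 then ralt y x n' * x else 1.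

Lemma raltE (K : groupType) (x y : K) n : ralt x y n = if odd n then alt x y n else alt y x n.
Proof.
elim: n x y => // n IH x y; rewrite [LHS]/= IH !altSr /=.
by case: (odd n).
Qed.

Lemma count_ralt a b n t k : bfun (ralt (count a) (count b) n) (t, k) =
  (ralt (s a) (s b) n * t * (ralt (s a) (s b) n)^-1,
   (k + \sum_(j < n) (t == ((s a * s b) ^+ j * s a)%g)%:R)%R).
Proof.
elim: n a b t k => [|n IH] a b t k; first by rewrite big_ord0 GRing.addr0 /= invg1 mul1g mulg1.
rewrite bijM /= IH; congr pair.
  by rewrite !invgM reflV !mulgA.
rewrite big_ord_recl mul1g -GRing.addrA; congr (_ + (_ + _))%R.
apply: eq_bigr => j _; congr (_%:R)%R; rewrite conj_refl_eq; congr (nat_of_bool (_ == _)).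
by rewrite lift0 expgSr mulgA -expgM_swap !mulgA.
Qed.

(** The two sides of the relation meet the same mirrors, those of (s_a s_b)^j s_a for j < m, in
    opposite orders. *)
Lemma count_respects : respects count (@gadj G) (@glab G).
Proof.
move=> a b ab; set m := glab a b.
have sR : alt (s a) (s b) m = alt (s b) (s a) m.
  by apply: alt_involution; rewrite ?refl_sq ?refl_order.
suff e : ralt (count a) (count b) m = ralt (count b) (count a) m.
  by move: e; rewrite !raltE; case: (odd m).
apply: bij_ext => -[t k]; rewrite !count_ralt.
have -> : ralt (s a) (s b) m = ralt (s b) (s a) m by rewrite !raltE sR; case: (odd m).
congr (pair _ (_ + _)%R); rewrite [RHS](reindex_inj rev_ord_inj) /=.
apply: eq_bigr => j _; congr (_ (nat_of_bool (t == _)))%R.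
have inv : s b * s a = (s a * s b)^-1 by rewrite invgM !reflV.
rewrite inv expVgn; apply: (mulgI ((s a * s b) ^+ (m - j.+1))).
rewrite mulVKg mulgA -expgnDr; have -> : (m - j.+1 + j = m.-1)%N by have := ltn_ord j; lia.
have := refl_order ab; have := glab_ge2 ab; rewrite -/m.
case: m {sR j} => // m _ /=; rewrite expgSr => e.
by apply: (mulIg (s b)); rewrite refl_sq -e !mulgA.
Qed.

Definition theta : artin G -> bij (W * int) := @lift _ _ count _ _.

Lemma thetaM : {morph theta : x y / x * y}.
Proof. exact/liftM/count_respects. Qed.

Lemma theta_gen v : theta (agen v) = count v.
Proof. exact/lift_gen/count_respects. Qed.

(* [g] fixes the reflection [t] and crosses its mirror [c] times. *)
Definition crosses (t : W) (g : artin G) (c : int) :=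
  forall k, bfun (theta g) (t, k) = (t, k + c)%R.

Lemma crossesM t g h c d : crosses t g c -> crosses t h d -> crosses t (g * h) (c + d)%R.
Proof. by move=> gc hd k; rewrite thetaM bijM hd gc -GRing.addrA [(d + c)%R]GRing.addrC. Qed.

Lemma crosses_inj t g c d : crosses t g c -> crosses t g d -> c = d.
Proof. by move=> gc gd; have := gc 0%R; rewrite gd => -[]; lia. Qed.

Lemma crosses1 t : crosses t 1 0%R.
Proof. by move=> k; rewrite (mor1 thetaM) GRing.addr0. Qed.

Lemma crossesV t g c : crosses t g c -> crosses t g^-1 (- c)%R.
Proof.
move=> gc k; rewrite (morV thetaM) -[in LHS](GRing.subrK c k) -[(t, _ + c)%R]gc bijV.
by rewrite bfunK.
Qed.

Lemma crossesX t g c n : crosses t g c -> crosses t (g ^+ n) (c * n%:Z)%R.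
Proof.
move=> gc; elim: n => [|n IH]; first by rewrite GRing.mulr0; exact: crosses1.
by rewrite expgS (_ : c * n.+1%:Z = c + c * n%:Z)%R; [exact: crossesM|lia].
Qed.

Lemma crossesZ t g c i : crosses t g c -> crosses t (zexp g i) (c * i)%R.
Proof.
move=> gc; case: i => n /=; first exact: crossesX.
by rewrite (_ : c * Negz n = - (c * n.+1%:Z))%R; [exact/crossesV/crossesX|lia].
Qed.

(** A generator may move other mirrors, while its square fixes them all. This is why squares enter
    the independence statements. *)
Lemma crosses_square v t : crosses t (agen v ^+ 2) (2%:R * (t == s v)%:R)%R.
Proof.
move=> k; rewrite expgS expg1 thetaM !bijM theta_gen /= /count_fun /=.
rewrite !mulgA refl_sq mul1g -!mulgA refl_sq mulg1 mulgA conj_refl_eq refl_sq mul1g.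
by congr pair; lia.
Qed.

Definition zc (u v : V) : artin G := (agen u * agen v) ^+ glab u v.

(** The word is positive, so crossings accumulate without cancellation, beginning with the mirror of
    [v], the letter that acts first. Every mirror met comes from [u] and [v], which [trivial_off]
    detects. *)
Lemma count_power u v n t : exists c : nat,
  [/\ forall k, bfun (theta ((agen u * agen v) ^+ n)) (t, k) =
        ((s u * s v) ^+ n * t * ((s u * s v) ^+ n)^-1, (k + c%:Z)%R),
      (0 < n)%N -> t = s v -> (0 < c)%N &
      ~ trivial_off [set u; v] t -> c = 0%N].
Proof.
elim: n t => [|n IH] t.
  exists 0%N; split=> // k; rewrite (mor1 thetaM) GRing.addr0 /=.
  by rewrite mul1g invg1 mulg1.
have [c [e1 e2 e3]] := IH (s u * (s v * t * s v) * s u).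
exists (c + (t == s v) + ((s v * t * s v)%g == s u))%N; split.
- move=> k; rewrite expgSr (thetaM (_ ^+ n)) bijM thetaM bijM !theta_gen /= /count_fun /=.
  rewrite e1; congr pair; last by lia.
  by rewrite [_ ^+ n.+1]expgSr !invgM !reflV !mulgA.
- by move=> _ ->; rewrite eqxx; lia.
move=> tN; have sS := trivial_off_subgroup [set u; v].
have su : trivial_off [set u; v] (s u) by apply/trivial_off_refl; rewrite set21.
have sv : trivial_off [set u; v] (s v) by apply/trivial_off_refl; rewrite set22.
have tv : t == s v = false by apply/eqP => e; apply: tN; rewrite e.
have tu : (s v * t * s v)%g == s u = false.
  by apply/eqP/eqP; rewrite conj_refl_eq; apply/eqP => e; apply: tN; rewrite e; do 2?apply: (subgM sS).
rewrite tv tu e3 // => h; apply: tN.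
have -> : t = s v * (s u * (s u * (s v * t * s v) * s u) * s u) * s v.
  have cj a x : s a * (s a * x * s a) * s a = x by apply/eqP; rewrite conj_refl_eq.
  by rewrite !cj.
by do 4?apply: (subgM sS).
Qed.

Lemma zc_sym u v : gadj u v -> zc u v = zc v u.
Proof.
move=> uv; rewrite /zc -(glab_sym uv); apply: alt_center.
exact: (@gen_respects _ (@gadj G) (@glab G)).
Qed.

Lemma zc_commute u v : gadj u v -> commute (zc u v) (agen u) /\ commute (zc u v) (agen v).
Proof.
by move=> uv; apply: alt_center_commute; exact: (@gen_respects _ (@gadj G) (@glab G)).
Qed.

Lemma crosses_zc u v : gadj u v -> exists2 c, crosses (s v) (zc u v) c & (0 < c)%R.
Proof.
move=> uv; have [c [e1 e2 _]] := count_power u v (glab u v) (s v).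
exists (Posz c); last by rewrite ltz_nat; apply: e2 => //; exact: ltnW (glab_ge2 uv).
by move=> k; rewrite e1 refl_order // mul1g invg1 mulg1.
Qed.

Lemma crosses_zc0 u v w : gadj u v -> w != u -> w != v -> crosses (s w) (zc u v) 0%R.
Proof.
move=> uv wu wv; have [c [e1 _ e3]] := count_power u v (glab u v) (s w).
move=> k; rewrite e1 refl_order // mul1g invg1 mulg1 e3 //.
by move/trivial_off_refl; rewrite !inE (negPf wu) (negPf wv).
Qed.

(** The mirror of [u] is crossed by [zc v u] alone and that of [w] by [zc v w] alone, which gives j
    = k = 0; the mirror of [v] then settles the square. *)
Lemma independent u v w i j k : gadj v u -> gadj v w -> u != w ->
  zexp (agen v ^+ 2) i * zexp (zc v u) j * zexp (zc v w) k = 1 ->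
  [/\ i = 0, j = 0 & k = 0]%R.
Proof.
move=> vu vw uw e.
have vu' := gadj_neq vu.
have vw' := gadj_neq vw.
have sq t : crosses t (agen v ^+ 2) (2%:R * (t == s v)%:R)%R := @crosses_square v t.
have sne a b : a != b -> (s a == s b) = false.
  by move=> /negPf ab; rewrite (inj_eq (@refl_inj G)).
have tot t a b c : crosses t (agen v ^+ 2) a -> crosses t (zc v u) b -> crosses t (zc v w) c ->
    (a * i + b * j + c * k = 0)%R.
  move=> /(crossesZ i) ha /(crossesZ j) hb /(crossesZ k) hc.
  have := crossesM (crossesM ha hb) hc; rewrite e => h.
  exact: crosses_inj h (crosses1 t).
have j0 : j = 0%R.
  have [c cu c0] := crosses_zc vu.
  have := tot _ _ _ _ (sq (s u)) cu (crosses_zc0 vw _ uw).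
  by rewrite eq_sym in vu' *; rewrite sne // => /(_ vu'); nia.
have k0 : k = 0%R.
  have [c cw c0] := crosses_zc vw; have wu : w != u by rewrite eq_sym.
  have wv : w != v by rewrite eq_sym.
  have := tot _ _ _ _ (sq (s w)) (crosses_zc0 vu wv wu) cw.
  by rewrite sne //; nia.
split=> //; have := tot (s v) _ _ _ (sq _); move: e.
rewrite j0 k0 !zexp0 !mulg1 => /= e _.
have := crossesZ i (sq (s v)); rewrite e eqxx => h.
by have := crosses_inj h (crosses1 _); lia.
Qed.

(** Counted at the mirror of [u], which [zc v u] crosses and the square of [agen v] does not. The
    equation is squared first, because [agen v] itself may move this mirror. *)
Lemma independent2 u v i j : gadj v u ->
  zexp (agen v) i = zexp (zc v u) j -> j = 0%R.
Proof.
move=> vu e; have [c cu c0] := crosses_zc vu.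
have vu' : u != v by rewrite eq_sym gadj_neq.
have e2 : zexp (agen v ^+ 2) i = zexp (zc v u) (j + j)%R.
  by rewrite zexpD -e -zexpD -(zexpM _ 2%:R) (_ : 2%:R * i = i + i)%R //; lia.
have := crosses_inj (crossesZ i (@crosses_square v (s u))).
rewrite e2 => /(_ _ (crossesZ _ cu)); rewrite (inj_eq (@refl_inj G)) (negPf vu'); nia.
Qed.

Definition refl_hom : artin G -> W := @lift _ _ s _ _.

Lemma refl_respects : respects s (@gadj G) (@glab G).
Proof.
by move=> a b ab; apply: alt_involution; rewrite ?refl_sq ?refl_order.
Qed.

Lemma agen_inj : injective (fun v : V => agen v : artin G).
Proof.
move=> a b /(congr1 refl_hom); rewrite /refl_hom !lift_gen; try exact: refl_respects.
exact: refl_inj.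
Qed.

Lemma agen_noncommute (a b : V) : gadj a b -> (2 < glab a b)%N -> ~ commute (agen a : artin G) (agen b).
Proof.
move=> ab m2 /(congr1 refl_hom); rewrite /refl_hom !(liftM refl_respects) !lift_gen; try exact: refl_respects.
exact: refl_noncommute.
Qed.

Lemma total_weight : exists chi : artin G -> int,
  (forall x y, chi (x * y) = (chi x + chi y)%R) /\ forall v : V, chi (agen v) = 1%R.
Proof. exact: (weight_exists (f := fun=> 1%R)). Qed.

Lemma conj_gen_weight (chi : artin G -> int) (g : artin G) :
  (forall x y, chi (x * y) = (chi x + chi y)%R) -> (forall v : V, chi (agen v) = 1%R) ->
  (exists (v : V) h, cyc (agen v) (h^-1 * g * h)) -> chi g = 0%R -> g = 1.
Proof.
move=> cM c1 [v [h [i e]]].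
have -> : g = h * zexp (agen v) i * h^-1 by rewrite -e !mulgA mulgV mul1g mulgK.
by rewrite (addJ cM) (addZ cM) c1 GRing.mul1r => ->; rewrite mulg1 mulgV.
Qed.

(** Both generators have total exponent 1, hence are the same power of [h]. *)
Lemma agen_cyclic (a b : V) (h : artin G) : cyc h (agen a) -> cyc h (agen b) -> a = b.
Proof.
move=> [i ea] [j eb]; have [chi [cM c1]] := total_weight.
have := c1 a; have := c1 b; rewrite ea eb !(addZ cM) => hj hi.
have ij : i = j by rewrite -[i]GRing.mulr1 -hj GRing.mulrCA GRing.mulrA hi GRing.mul1r.
by apply: agen_inj; rewrite ea eb ij.
Qed.

End Cocycle.

(** * Big chunks *)

Section Chunks.
Variable G : lgraph.
Notation V := (gV G).
Implicit Types (L M S T : {set V}) (a b u v w x y z : V).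

Definition conn S := forall x y, x \in S -> y \in S ->
  connect (restr_adj (@gadj G) S) x y.

Lemma restr_sym S : symmetric (restr_adj (@gadj G) S).
Proof. by move=> x y; rewrite /restr_adj gadj_sym [(x \in S) && _]andbC. Qed.

Lemma conn_sym S x y :
  connect (restr_adj (@gadj G) S) x y = connect (restr_adj (@gadj G) S) y x.
Proof. exact: (sym_connect_sym (restr_sym S)). Qed.

Lemma conn_sub S T x y : S \subset T ->
  connect (restr_adj (@gadj G) S) x y -> connect (restr_adj (@gadj G) T) x y.
Proof.
move=> ST; apply: connect_sub => u v /and3P[uv uS vS].
by apply: connect1; rewrite /restr_adj uv !(subsetP ST).
Qed.

Lemma connect_ind (e : rel V) (Q : V -> Prop) x y : connect e x y -> Q x ->
  (forall u v, e u v -> Q u -> Q v) -> Q y.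
Proof.
move=> /connectP [p + ->] + QS; elim: p x => //= z p IH x /andP[xz zp] Qx.
by apply: IH => //; exact: QS xz Qx.
Qed.

Lemma conn_step S x y : connect (restr_adj (@gadj G) S) x y -> x != y ->
  exists z, [/\ gadj x z, x \in S & z \in S].
Proof.
move=> /connectP [[|z p] /= + ->]; first by rewrite eqxx.
by move=> /andP [/and3P[xz xS zS] _] _; exists z.
Qed.

Lemma conn_union S T z : conn S -> conn T -> z \in S -> z \in T -> conn (S :|: T).
Proof.
move=> cS cT zS zT; have toz x : x \in S :|: T -> connect (restr_adj (@gadj G) (S :|: T)) x z.
  by case/setUP => xS; [apply: conn_sub (subsetUl S T) _; exact: cS|
    apply: conn_sub (subsetUr S T) _; exact: cT].
by move=> x y /toz xz /toz; rewrite conn_sym; exact: connect_trans.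
Qed.

Definition biconnected L := connected_in L /\ no_sep_vertex L.

Lemma biconn_minus L v : biconnected L -> conn (L :\ v).
Proof.
case=> -[_ cL] nL; have [vL|vL] := boolP (v \in L).
  by move=> x y; exact: nL.
by rewrite (setDidPl _) // disjoint_sym disjoints1.
Qed.

Lemma big_chunk_biconn L : big_chunk L -> biconnected L.
Proof. by case. Qed.

Lemma big_chunk_max L M : big_chunk L -> L \subset M -> biconnected M -> M = L.
Proof. by case=> _ _ h LM [cM nM]; exact: h. Qed.

Lemma biconn_chunk L : biconnected L -> exists2 M, big_chunk M & L \subset M.
Proof.
move=> bL; have pL : `[< biconnected L >] by apply/asboolP.
have [M /maxsetP [/asboolP [cM nM] mM] LM] := @maxset_exists _ (fun S => `[< biconnected S >]) _ pL.
exists M => //; split=> // S MS cS nS; apply: mM => //; apply/asboolP; split=> //.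
Qed.

Lemma biconn1 v : biconnected [set v].
Proof.
split; first split; first by apply/set0Pn; exists v; exact: set11.
  by move=> x y /set1P -> /set1P ->; exact: connect0.
by move=> u /set1P -> x y; rewrite setDv inE.
Qed.

Lemma biconn_edge a b : gadj a b -> biconnected [set a; b].
Proof.
move=> ab; split; first split; first by apply/set0Pn; exists a; exact: set21.
  have e : connect (restr_adj (@gadj G) [set a; b]) a b.
    by apply: connect1; rewrite /restr_adj ab set21 set22.
  by move=> x y /set2P[] -> /set2P[] -> //; rewrite conn_sym.
move=> v vab x y /setD1P [xv /set2P xab] /setD1P [yv /set2P yab].
have -> : x = y; last exact: connect0.
case/set2P: vab xab yab xv yv => ->; case=> ->; case=> ->; by rewrite ?eqxx.
Qed.

Lemma vertex_chunk v : exists2 L, big_chunk L & v \in L.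
Proof.
by have [L cL] := biconn_chunk (biconn1 v); rewrite sub1set; exists L.
Qed.

Lemma edge_chunk a b : gadj a b -> exists2 L, big_chunk L & (a \in L) && (b \in L).
Proof.
move=> /biconn_edge /biconn_chunk [L cL]; rewrite subUset !sub1set; by exists L.
Qed.

(** After the deletion of any vertex one of the two shared vertices remains and links [L] with [M],
    so the union is biconnected and maximality applies. *)
Lemma chunk_meet L M x y : big_chunk L -> big_chunk M -> x != y ->
  x \in L -> y \in L -> x \in M -> y \in M -> L = M.
Proof.
move=> cL cM xy xL yL xM yM; have bL := big_chunk_biconn cL; have bM := big_chunk_biconn cM.
suff bU : biconnected (L :|: M).
  by rewrite -(big_chunk_max cL _ bU) ?subsetUl // -[RHS](big_chunk_max cM _ bU) ?subsetUr.
split; first split.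
- by apply/set0Pn; exists x; rewrite inE xL.
- exact: conn_union bL.1.2 bM.1.2 xL xM.
move=> v _; rewrite setDUl.
have [e|ne] := eqVneq x v.
  by apply: (@conn_union _ _ y); try exact: biconn_minus; rewrite !inE ?yL ?yM andbT -e eq_sym.
by apply: (@conn_union _ _ x); try exact: biconn_minus; rewrite !inE ?xL ?xM andbT.
Qed.

(** Addition of an ear: when a vertex is deleted, each remaining vertex of the path still reaches
    [L] along the part of the path that avoids the deleted vertex. *)
Lemma biconn_ear L a p : biconnected L -> a \in L -> last a p \in L ->
  uniq (a :: p) -> path (@gadj G) a p -> biconnected (L :|: [set x in p]).
Proof.
move=> bL aL bL' up pp; set M := L :|: _.
have inM z : z \in a :: p -> z \in M.
  by rewrite !inE => /orP[/eqP ->|->]; rewrite ?aL ?orbT.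
have sub S x q : path (@gadj G) x q -> {subset x :: q <= S} ->
    connect (restr_adj (@gadj G) S) x (last x q).
  move=> pq sq; apply/connectP; exists q => //.
  elim: q x pq sq => //= y q IH x /andP[xy yq] sq.
  rewrite IH // ?andbT; last by move=> z zq; apply: sq; rewrite inE zq orbT.
  by rewrite /restr_adj xy !sq // !inE eqxx ?orbT.
have key v z : z \in p -> z != v -> exists l, [/\ l \in L, l != v &
    connect (restr_adj (@gadj G) (M :\ v)) l z].
  move=> zp zv; case/path.splitP: zp up pp bL' inM => p1 p2 up pp bL' inM.
  have [va|va] := boolP (v \in a :: p1); last first.
    exists a; split=> //; first by apply: contraNneq va => ->; rewrite inE eqxx.
    have := sub (M :\ v) a (rcons p1 z); rewrite last_rcons; apply.
      by move: pp; rewrite cat_path => /andP[].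
    move=> y; rewrite -rcons_cons mem_rcons inE => yp; rewrite !inE.
    have yM : y \in M.
      apply: inM; move: yp; rewrite !inE mem_cat mem_rcons !inE => /orP[->|/orP[->|->]] //=; by rewrite ?orbT.
    move: yM; rewrite !inE => ->; rewrite andbT.
    case/orP: yp => [/eqP -> //|yp]; apply: contraNneq va => <-; exact: yp.
  have vp2 : v \notin p2.
    apply/negP => vp2; move: up; rewrite -cat_cons -rcons_cons cat_uniq => /and3P[_ /hasPn /(_ v vp2) h _].
    by case/negP: h; rewrite mem_rcons inE va orbT.
  exists (last z p2); split.
  - by move: bL'; rewrite last_cat last_rcons.
  - have := mem_last z p2; rewrite inE => /orP[/eqP -> //|h]; apply: contraNneq vp2 => <-; exact: h.
  rewrite conn_sym; apply: sub.
    by move: pp; rewrite cat_path last_rcons => /andP[].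
  move=> y; rewrite inE => yp.
  have yM : y \in M.
    by apply: inM; move: yp; rewrite !inE mem_cat mem_rcons inE => /orP[->|->]; rewrite ?orbT.
  rewrite in_setD1 yM andbT; case/orP: yp => [/eqP -> //|yp].
  by apply: contraNneq vp2 => <-.
have cM v : conn (M :\ v).
  have toL x : x \in M :\ v -> exists2 l, l \in L :\ v & connect (restr_adj (@gadj G) (M :\ v)) l x.
    rewrite !inE => /andP[xv /orP[xL|xp]].
      by exists x; rewrite ?inE ?xv ?xL //; exact: connect0.
    by have [l [lL lv lx]] := key v x xp xv; exists l; rewrite ?inE ?lv.
  move=> x y /toL [l lL lx] /toL [l' lL' ly].
  rewrite conn_sym in lx; apply: connect_trans lx (connect_trans _ ly).
  apply: (@conn_sub (L :\ v)); first by apply: setSD; exact: subsetUl.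
  exact: biconn_minus.
split; last by move=> v _; exact: cM.
split; first by apply/set0Pn; exists a; rewrite inE aL.
move=> x y xM yM; have [e|xy] := eqVneq x y; first by rewrite e connect0.
have toa z : z \in M -> connect (restr_adj (@gadj G) M) a z.
  rewrite !inE => /orP[zL|zp].
    by apply: conn_sub (subsetUl _ _) _; exact: bL.1.2.
  case/path.splitP: zp pp inM => p1 p2; rewrite cat_path => /andP[pp _] inM.
  have := sub M a (rcons p1 z) pp; rewrite last_rcons; apply=> u up1.
  by apply: inM; move: up1; rewrite !inE mem_cat => /orP[->|->]; rewrite ?orbT.
by have := toa y yM; apply: connect_trans; rewrite conn_sym; exact: toa.
Qed.

Hypothesis connG : connected_graph G.

Lemma connG_ind (Q : V -> Prop) x : Q x -> (forall u v, gadj u v -> Q u -> Q v) -> forall y, Q y.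
Proof.
move=> Qx QS y; apply: (connect_ind (connG.2 x y (in_setT _) (in_setT _))) => //.
by move=> u v /and3P[uv _ _]; exact: QS.
Qed.

(** A vertex outside [L] is sent to its foot, the vertex of [L] at which its component is attached.
    Two different feet would be joined by a path outside [L], an ear that contradicts maximality. *)
Lemma retraction L : big_chunk L -> exists r : V -> V,
  [/\ forall x, r x \in L, forall x, x \in L -> r x = x &
      forall x y, gadj x y -> r x = r y \/ (x \in L /\ y \in L)].
Proof.
move=> cL; have bL := big_chunk_biconn cL.
pose foot x a := a \in L /\ exists a1, [/\ a1 \notin L, gadj a a1 &
  connect (restr_adj (@gadj G) (~: L)) a1 x].
have footS x y a : x \notin L -> y \notin L -> gadj x y -> foot x a -> foot y a.
  move=> xL yL xy [aL [a1 [a1L aa1 c]]]; split=> //; exists a1; split=> //.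
  by apply: connect_trans c _; apply: connect1; rewrite /restr_adj xy !inE xL yL.
have foot_ex x : x \in L \/ exists a, foot x a.
  have /set0Pn [l lL] := bL.1.1.
  apply: (connG_ind (Q := fun x => x \in L \/ exists a, foot x a) (x := l)); first by left.
  move=> u v uv ih; have [vL|vL] := boolP (v \in L); [by left|right].
  have [uL|uL] := boolP (u \in L).
    by exists u; split=> //; exists v; split=> //; exact: connect0.
  by case: ih => [|[a fa]]; [rewrite (negPf uL)|exists a; exact: footS uL vL uv fa].
have foot_uniq x a b : foot x a -> foot x b -> a = b.
  move=> [aL [a1 [a1L aa1 ca]]] [bL' [b1 [b1L bb1 cb]]].
  apply/eqP; apply: contraT => ab.
  have /connectP [p pp lp] : connect (restr_adj (@gadj G) (~: L)) a1 b1.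
    by apply: connect_trans ca _; rewrite conn_sym.
  case/shortenP: pp lp => q qq uq _ lq.
  have qL : {in a1 :: q, forall z, z \notin L}.
    move=> z; rewrite inE => /orP[/eqP -> //|zq].
    elim: q a1 {a1L aa1 ca uq lq} qq zq => //= y q IH a1 /andP[/and3P[_ _ yL] yq].
    by rewrite inE => /orP[/eqP ->|]; [move: yL; rewrite inE|exact: IH yq].
  have gq : path (@gadj G) a1 q by apply: sub_path qq => u v /and3P[].
  have nq c : c \in L -> c \notin a1 :: q.
    by move=> cL'; apply/negP => /qL; rewrite cL'.
  have bM := @biconn_ear L a (rcons (a1 :: q) b) bL aL.
  have /(big_chunk_max cL) : biconnected (L :|: [set x in rcons (a1 :: q) b]).
    apply: bM; first by rewrite last_rcons.
    - rewrite cons_uniq mem_rcons inE negb_or ab nq // andTb rcons_uniq nq //.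
    - by rewrite rcons_path /= aa1 gq -lq gadj_sym bb1.
  move=> /(_ (subsetUl _ _)) e; case/negP: a1L; rewrite -e.
  by rewrite !inE eqxx ?orbT.
have rex x : exists a, (x \in L /\ a = x) \/ (x \notin L /\ foot x a).
  have [xL|xL] := boolP (x \in L); first by exists x; left.
  by case: (foot_ex x) => [|[a fa]]; [rewrite (negPf xL)|exists a; right].
have [r rP] := choice rex.
have rL x : r x \in L by case: (rP x) => [[xL ->]|[_ []]].
have rid x : x \in L -> r x = x by case: (rP x) => [[_ ->]|[/negPf ->]].
exists r; split=> // x y xy.
case: (rP x) (rP y) => [[xL ex]|[xL fx]] [[yL ey]|[yL fy]]; first by right.
- left; rewrite ex; apply: foot_uniq fy; split=> //.
  by exists y; split=> //; exact: connect0.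
- left; rewrite ey; apply: (foot_uniq x) => //; split=> //.
  by exists x; split=> //; rewrite ?(gadj_sym y) ?connect0.
- by left; apply: (foot_uniq y) => //; exact: footS fx.
Qed.

(** In a chunk with three or more vertices, a vertex still has a neighbour after one of its
    neighbours is deleted, since no vertex separates. *)
Lemma chunk_cases L : big_chunk L ->
  [\/ exists v, L = [set v] /\ forall x, x = v,
      exists a b, gadj a b /\ L = [set a; b] |
      forall v, v \in L -> exists u w, [/\ u \in L, w \in L, gadj v u, gadj v w & u != w]].
Proof.
move=> cL; have bL := big_chunk_biconn cL; have /set0Pn [v0 v0L] := bL.1.1.
have [L1|L1] := boolP (L \subset [set v0]).
  have eL : L = [set v0] by apply/eqP; rewrite eqEsubset L1 sub1set.
  constructor 1; exists v0; split=> // x.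
  apply/eqP; apply: contraT => xv.
  have c : connect (restr_adj (@gadj G) setT) v0 x by apply: connG.2; rewrite inE.
  have [|z [v0z _ _]] := conn_step c; first by rewrite eq_sym.
  have e := big_chunk_max cL _ (biconn_edge v0z).
  have zL : z \in L by rewrite -e ?set22 // eL sub1set set21.
  by move: zL v0z; rewrite eL inE => /eqP ->; rewrite gadj_irr.
have other v : v \in L -> exists2 x, x \in L & x != v.
  move=> vL; have [e|ne] := eqVneq v v0; last by exists v0 => //; rewrite eq_sym.
  by case/subsetPn: L1 => x xL; rewrite inE -e; exists x.
have nbr v x : v \in L -> x \in L -> x != v -> exists2 u, u \in L & gadj v u.
  move=> vL xL xv; have [|u [vu _ uL]] := conn_step (bL.1.2 v x vL xL); first by rewrite eq_sym.
  by exists u.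
have [x xL xv] := other v0 v0L; have [u uL vu] := nbr _ _ v0L xL xv.
have [L2|L2] := boolP (L \subset [set v0; u]).
  constructor 2; exists v0, u; split=> //.
  by apply/eqP; rewrite eqEsubset L2 subUset !sub1set v0L.
constructor 3 => v vL; have [x' xL' xv'] := other v vL.
have [u' uL' vu'] := nbr _ _ vL xL' xv'.
have vu1 := gadj_neq vu'.
have [y yL yn] : exists2 y, y \in L & y \notin [set v; u'].
  apply/subsetPn; apply/negP => L3; case/negP: L2.
  have L3' : L \subset [set v0; u].
    have v0u := gadj_neq vu.
    apply/subsetP => z zL; move: (subsetP L3 z zL) (subsetP L3 _ v0L) (subsetP L3 _ uL).
    rewrite !inE => /orP[/eqP ->|/eqP ->] /orP[/eqP e1|/eqP e1] /orP[/eqP e2|/eqP e2];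
      move: v0u; rewrite e1 e2 ?eqxx ?orbT //.
  exact: L3'.
move: yn; rewrite !inE negb_or => /andP[yv yu].
have c : connect (restr_adj (@gadj G) (L :\ u')) v y.
  by apply: biconn_minus => //; rewrite !inE ?vu1 ?yu.
have [|w [vw _ wL]] := conn_step c; first by rewrite eq_sym.
move: wL; rewrite !inE => /andP[wu wL].
by exists u', w; split=> //; rewrite eq_sym.
Qed.

Definition branching v := exists u w, [/\ gadj v u, gadj v w & u != w].

Lemma branchingP v u : gadj v u -> branching v <-> valence v != 1%N.
Proof.
move=> vu; split=> [[a [b [va vb ab]]]|].
  apply/negP; rewrite /valence => /cards1P [c ec].
  have : a \in [set x | gadj v x] by rewrite inE.
  have : b \in [set x | gadj v x] by rewrite inE.
  by rewrite ec !inE => /eqP e1 /eqP e2; rewrite e1 e2 eqxx in ab.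
rewrite /valence => n1; have : [set x | gadj v x] :\ u != set0.
  apply: contraNneq n1; rewrite (cardsD1 u) inE vu => ->; by rewrite cards0.
by move=> /set0Pn [w]; rewrite !inE => /andP[wu vw]; exists u, w; split=> //; rewrite eq_sym.
Qed.

Lemma chunk_neighbor L v : big_chunk L -> v \in L ->
  (forall x, x = v) \/ exists2 u, u \in L & gadj v u.
Proof.
move=> cL vL; case: (chunk_cases cL) => [[w [_ all]]|[a [b [ab eL]]]|/(_ v vL)].
- by left=> x; rewrite (all x) (all v).
- right; move: vL; rewrite eL => /set2P[] ->; first by exists b; rewrite ?set22.
  by exists a; rewrite ?set21 // gadj_sym.
- by case=> u [_ [uL _ vu _ _]]; right; exists u.
Qed.

Lemma two_chunks_branching L M v : big_chunk L -> big_chunk M -> L <> M ->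
  v \in L -> v \in M -> branching v.
Proof.
move=> cL cM LM vL vM.
have single : ~ (forall x, x = v).
  move=> all; apply: LM; apply/setP => x; by rewrite (all x) vL vM.
have [//|[u uL vu]] := chunk_neighbor cL vL.
have [//|[w wM vw]] := chunk_neighbor cM vM.
exists u, w; split=> //; apply/eqP => uw; subst w; apply: LM.
apply: (@chunk_meet _ _ u v) => //; by rewrite eq_sym gadj_neq.
Qed.

Lemma leaf_chunk a b M : gadj a b -> valence b == 1%N ->
  big_chunk M -> b \in M -> M = [set a; b].
Proof.
move=> ab b1 cM bM; have [all|[u uM bu]] := chunk_neighbor cM bM.
  by move: ab; rewrite (all a) gadj_irr.
have nab := gadj_neq ab.
have ba : gadj b a by rewrite gadj_sym.
have nbr : ~ branching b by move/(branchingP ba); rewrite b1.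
have ea : u = a by apply/eqP; apply: contraT => ua; case: nbr; exists u, a; split.
subst u; case: (chunk_cases cM) => [[v [_ all]]|[x [y [xy eM]]]|/(_ b bM)].
- by move: nab; rewrite (all a) (all b) eqxx.
- apply/eqP; rewrite eq_sym eqEcard subUset !sub1set uM bM cards2 nab eM cards2.
  by case: (x == y).
by case=> u [w [_ _ bu' bw uw]]; case: nbr; exists u, w; split.
Qed.

Lemma leaf_is_chunk a b : gadj a b -> valence b == 1%N -> big_chunk [set a; b].
Proof.
move=> ab b1; have [M cM bM] := vertex_chunk b.
by rewrite -(leaf_chunk ab b1 cM bM).
Qed.

Lemma non_leaf_edge a b : gadj a b -> ~ is_leaf [set a; b] -> branching a /\ branching b.
Proof.
move=> ab nl; have ba : gadj b a by rewrite gadj_sym.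
by split; [apply/(branchingP ab)|apply/(branchingP ba)]; apply/negP => e; case: nl;
  exists a, b; rewrite e ?orbT.
Qed.

End Chunks.

(** * The tree of big chunks *)

Section Cover.
Variables (A : groupType) (H : A -> Prop).
Hypothesis sH : subgroup H.

(** For [c = true] the two copies of [A] are exchanged on entering or leaving [H]. This action is
    plain translation conjugated by the swap of the sheets over [H], and on elements of [H] the two
    actions coincide. *)
Definition sheet (c : bool) (x t : A) := c && (`[< H t >] (+) `[< H (x * t) >]).

Lemma coverK c x : cancel (fun p : A * bool => (x * p.1, p.2 (+) sheet c x p.1))
  (fun p => (x^-1 * p.1, p.2 (+) sheet c x^-1 p.1)).
Proof.
move=> [t e] /=; rewrite /sheet mulKg; congr pair.
by case: c => //=; case: `[< H t >]; case: `[< H (x * t) >]; case: e.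
Qed.

Lemma coverVK c x : cancel (fun p : A * bool => (x^-1 * p.1, p.2 (+) sheet c x^-1 p.1))
  (fun p => (x * p.1, p.2 (+) sheet c x p.1)).
Proof. by move=> p; have := @coverK c x^-1 p; rewrite invgK. Qed.

Definition cover c x : bij (A * bool) := Bij (@coverK c x) (@coverVK c x).

Lemma coverM c : {morph cover c : x y / x * y}.
Proof.
move=> x y; apply: bij_ext => -[t e]; rewrite bijM /= /sheet mulgA; congr pair.
rewrite -!addbA; congr (_ (+) _); case: c => //=.
by case: `[< H t >]; case: `[< H (y * t) >]; case: `[< H _ >].
Qed.

Lemma cover_in c c' x : H x -> cover c x = cover c' x.
Proof.
move=> Hx; apply: bij_ext => -[t e] /=; congr (_, _ (+) _); rewrite /sheet.
have -> : `[< H (x * t) >] = `[< H t >].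
  apply: asbool_equiv_eq; split=> h; last exact: (subgM sH).
  by rewrite -(mulKg x t); apply: (subgM sH) => //; exact: (subgV sH).
by rewrite addbb !andbF.
Qed.

End Cover.

Lemma equalizer_subgroup (A L : groupType) (f g : A -> L) :
  {morph f : x y / x * y} -> {morph g : x y / x * y} -> subgroup (fun x => f x = g x).
Proof.
move=> fM gM; split; first by rewrite (mor1 fM) (mor1 gM).
  by move=> x y ex ey; rewrite fM gM ex ey.
by move=> x ex; rewrite (morV fM) (morV gM) ex.
Qed.

Section Standard.
Variable G : lgraph.
Notation V := (gV G).
Notation A := (artin G).
Implicit Types L : {set V}.

Definition std L (g : A) := exists2 w, word_over L w & g = cls (@gadj G) (@glab G) w.

Lemma std_subgroup L : subgroup (std L).
Proof.
split; first by exists [::].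
  by move=> _ _ [u uL ->] [v vL ->]; exists (u ++ v); rewrite ?cls_cat // /word_over all_cat; apply/andP.
move=> _ [u uL ->]; exists (winv u); rewrite ?cls_winv // /word_over /winv all_rev all_map.
by apply: sub_all uL => -[].
Qed.

Lemma std_gen L v : v \in L -> std L (agen v).
Proof. by move=> vL; exists [:: (v, false)] => //=; rewrite /word_over /= vL. Qed.

Lemma std_ind L (S : A -> Prop) : subgroup S -> (forall v, v \in L -> S (agen v)) ->
  forall g, std L g -> S g.
Proof.
move=> sS Sv g [w wL ->]; rewrite cls_ev; elim: w wL => [|[a b] w IH] /=; first by move=> _; exact: (subg1 sS).
case/andP=> /= aL /IH wS; apply: (subgM sS) => //; case: b => //=; last exact: Sv.
by apply: (subgV sS); exact: Sv.
Qed.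

Lemma std_setT g : std setT g.
Proof.
have [w ->] := cls_surj g; exists w => //.
by apply/allP => l _; rewrite inE.
Qed.

Definition vmap_respects (r : V -> V) L := forall x y, gadj x y -> r x = r y \/
  (x \in L /\ y \in L).

Lemma retract_respects r L : (forall x, x \in L -> r x = x) -> vmap_respects r L ->
  respects (fun v => agen (r v) : A) (@gadj G) (@glab G).
Proof.
move=> rid rR a b ab; have [e|[aL bL]] := rR a b ab; first by rewrite e !alt_same.
by rewrite !rid //; exact: (@gen_respects _ (@gadj G) (@glab G)).
Qed.

End Standard.

Section ChunkTree.
Variable G : lgraph.
Notation V := (gV G).
Notation A := (artin G).
Hypothesis connG : connected_graph G.

Definition chunk := {L : {set V} | `[< big_chunk L >]}.
Definition mkchunk L (cL : big_chunk L) : chunk := exist _ L (introT (asboolP _) cL).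
Lemma chunkP (L : chunk) : big_chunk (sval L).
Proof. by apply/asboolP; exact: (svalP L). Qed.

Lemma chunk_eq (L M : chunk) : sval L = sval M -> L = M.
Proof. exact: val_inj. Qed.

Lemma chunk_retraction_const (L1 L : {set V}) (r : V -> V) : big_chunk L1 -> big_chunk L -> L <> L1 ->
  vmap_respects r L1 -> forall x y, x \in L -> y \in L -> r x = r y.
Proof.
move=> cL1 cL LL1 rR x y xL yL.
have c := (big_chunk_biconn cL).1.2 x y xL yL.
apply: (connect_ind (Q := fun z => r x = r z) c) => // u v /and3P[uv uL vL] ->.
case: (rR u v uv) => // -[u1 v1]; case: LL1.
by apply: (@chunk_meet _ _ _ u v) => //; apply: contraTneq uv => ->; rewrite gadj_irr.
Qed.

(** Each vertex group acts by one of the two covers, according to its side of the edge from [v1] to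
    [L1]. The only incident pair on different sides is this edge itself, and there the covers agree
    because they agree on the powers of [agen v1]. *)
Lemma chunk_double_cover (L1 : chunk) (v1 : V) : v1 \in sval L1 ->
  exists (theta : A -> bij (A * bool)) (s : chunk + V -> bool),
  [/\ {morph theta : x y / x * y}, s (inl L1) != s (inr v1),
      forall (L : chunk) v, v \in sval L -> s (inl L) != s (inr v) -> L = L1 /\ v = v1 &
      forall k x t e, cstab (fun L : chunk => std (sval L)) (fun v => cyc (agen v : A)) k x ->
       bfun (theta x) (t, e) = (x * t, e (+) (s k &&
         (`[< cyc (agen v1 : A) t >] (+) `[< cyc (agen v1 : A) (x * t) >])))].
Proof.
move=> v1L; have [r [rL rid rR]] := retraction connG (chunkP L1).
(* The value is true on the side that retracts to [v1]. On a chunk other than [L1] the retraction is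
   constant, so one vertex decides. *)
pose s (k : chunk + V) := match k with
  | inl L => (L != L1) && [exists b, (b \in sval L) && (r b == v1)]
  | inr v => r v == v1 end.
have sH := cyc_subgroup (agen v1 : A).
pose cv := @cover A (cyc (agen v1 : A)).
have sE (L : chunk) v : v \in sval L -> s (inl L) != s (inr v) -> L = L1 /\ v = v1.
  move=> vL; rewrite [s (inl L)]/= [s (inr v)]/=; have [eL|LL1] := eqVneq L L1.
    rewrite eL in vL *; rewrite /= rid //.
    by have [->|_] := eqVneq v v1.
  have -> : [exists b, (b \in sval L) && (r b == v1)] = (r v == v1); last by rewrite /= eqxx.
  have LL : sval L <> sval L1 by move/chunk_eq/eqP; rewrite (negPf LL1).
  apply/existsP/eqP => [[b /andP[bL /eqP <-]]|e].
    exact: chunk_retraction_const (chunkP L1) (chunkP L) LL rR _ _ vL bL.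
  by exists v; rewrite vL e eqxx.
have fE (L : chunk) v : v \in sval L -> cv (s (inr v)) (agen v) = cv (s (inl L)) (agen v).
  move=> vL; have [->//|/(sE _ _ vL) [_ ->]] := eqVneq (s (inl L)) (s (inr v)).
  exact/cover_in/cyc_id.
pose f v := cv (s (inr v)) (agen v).
have fR : respects f (@gadj G) (@glab G).
  move=> a b ab; have [L cL /andP[aL bL]] := edge_chunk ab.
  rewrite /f (fE (mkchunk cL) a aL) (fE (mkchunk cL) b bL) -!(mor_alt (coverM _ _)).
  by congr cv; exact: (@gen_respects _ (@gadj G) (@glab G)).
exists (@lift _ _ f _ _), s; split.
- exact: liftM.
- by rewrite /= eqxx /= rid // eqxx.
- exact: sE.
have lE (L : chunk) v : v \in sval L -> lift f (agen v : A) = cv (s (inl L)) (agen v).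
  by move=> vL; rewrite lift_gen //; exact: fE.
move=> k x t e kx; suff -> : lift f x = cv (s k) x by [].
case: k kx => [L|v].
  move: x; apply: std_ind; last by move=> v vL; exact: lE.
  by apply: equalizer_subgroup; [exact: liftM|exact: coverM].
move=> [i ->]; have cvM : {morph cv (s (inr v)) : x y / x * y} by exact: coverM.
by rewrite (morZ (liftM fR)) (morZ cvM) lift_gen.
Qed.

Lemma chunk_tree : exists (T : tree_action A) (big : A -> chunk -> T),
  [/\ forall g h L, fixes g (big h L) <-> std (sval L) (h^-1 * g * h),
      forall g L h L', dist (big g L) (big h L') = 0 <-> L = L' /\ std (sval L) (g^-1 * h),
      (forall c h L, act c (big h L) = big (c * h) L) /\
      (forall p : T, exists h L, forall g, fixes g p -> fixes g (big h L)),
      forall h L (x : T), (0 < dist (big h L) x)%N -> exists v k, [/\ v \in sval L,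
        std (sval L) k,
        forall g, fixes g (big h L) -> fixes g x -> cyc (agen v : A) ((h * k)^-1 * g * (h * k)) &
        forall h' L', x = big h' L' -> exists M : chunk, v \in sval M /\ M <> L] &
      forall g (p q : T), (0 < dist p q)%N -> fixes g p -> fixes g q ->
        exists (v : V) h, cyc (agen v : A) (h^-1 * g * h)].
Proof.
have [v0 _] := set0Pn _ connG.1; have [L0 cL0 v0L] := vertex_chunk v0.
pose sG (L : chunk) := std_subgroup (sval L).
pose sH (v : V) := cyc_subgroup (agen v : A).
have HG (v : V) (L : chunk) x : v \in sval L -> cyc (agen v : A) x -> std (sval L) x.
  by move=> vL [i ->]; apply: subgZ; [exact: std_subgroup|exact: std_gen].
apply: (@coset_tree_exists A chunk V (fun L => std (sval L)) (fun v => cyc (agen v : A))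
  (fun v L => v \in sval L) (mkchunk cL0) sG sH HG).
- by move=> v; have [L cL vL] := vertex_chunk v; exists (mkchunk cL).
- move=> Q Q1 Qm; apply: art_ind => // v g Qg; have [L cL vL] := vertex_chunk v.
    by apply: (Qm (mkchunk cL)) => //; exact: std_gen.
  apply: (Qm (mkchunk cL)) => //; apply: (subgV (sG (mkchunk cL))); exact: std_gen.
- pose E := @cedge A chunk V (fun L => std (sval L)) (fun v L => v \in sval L).
  pose R := @ceqv A chunk V (fun L => std (sval L)) (fun v => cyc (agen v : A)).
  have wcat := walk_cat (ceqvC sG sH) (ceqvT sG sH) (cedge_eqv sG HG).
  have wrev := walk_rev (ceqvxx sG sH) (ceqvC sG sH) (ceqvT sG sH) (cedgeC sG) (cedge_eqv sG HG).
  have step (L : chunk) v : v \in sval L -> walk R E 1 (1, inl L) (1, inr v).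
    move=> vL; exists (1, inr v); last exact: ceqvxx sG sH _.
    exists L, v; split=> //=; last by left.
    by rewrite invg1 mulg1; exact: (subg1 (sG L)).
  have vv v : exists n, walk R E n (1, inr v0) (1, inr v).
    move: v; apply: (connG_ind connG (x := v0)).
      by exists 0; exact: ceqvxx sG sH _.
    move=> u v uv [n w]; have [L cL /andP[uL vL]] := edge_chunk uv.
    exists (n + (1 + 1))%N; apply: (wcat _ _ _ _ _ w); apply: (wcat _ _ _ _ _ _ (step (mkchunk cL) v vL)).
    by apply: (wrev); exact: (step (mkchunk cL) u uL).
  have kk k : exists n, walk R E n (1, inr v0) (1, k).
    case: k => [L|v]; last exact: vv.
    have /set0Pn [v vL] := (big_chunk_biconn (chunkP L)).1.1.
    have [n w] := vv v; exists (n + 1)%N; apply: (wcat _ _ _ _ _ w).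
    by apply: (wrev); exact: step vL.
  move=> k l; have [n w] := kk k; have [n' w'] := kk l.
  by exists (n + n')%N; apply: (wcat _ _ _ _ _ _ w'); exact: (wrev).
exact: chunk_double_cover.
Qed.

End ChunkTree.

(** * Dihedral Artin groups *)

(** The obstruction to being hyperbolic in a tree whose edge stabilizers embed in Z. It is stated
    inside the group and is preserved by injective homomorphisms, so it passes through [phi].
    Independence is formulated for ordered products, as the three elements are not assumed to
    commute. *)
Definition rank3 (A : groupType) (h : A) := exists c1 c2 c3,
  [/\ commute h c1, commute h c2, commute h c3 &
      forall i j k, zexp c1 i * zexp c2 j * zexp c3 k = 1 -> [/\ i = 0, j = 0 & k = 0]%R].

Lemma rank3_mor (A B : groupType) (f : A -> B) h : {morph f : x y / x * y} ->
  injective f -> rank3 h -> rank3 (f h).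
Proof.
move=> fM fI [c1 [c2 [c3 [h1 h2 h3 ind]]]]; exists (f c1), (f c2), (f c3).
split; try by rewrite /commute -!fM; congr f.
by move=> i j k; rewrite -!(morZ fM) -!fM -(mor1 fM) => /fI /ind.
Qed.

Lemma conj_mor (A : groupType) (g : A) : {morph (fun x => g * x * g^-1) : x y / x * y}.
Proof. by move=> x y; rewrite !mulgA mulgVK. Qed.

Lemma conj_inj (A : groupType) (g : A) : injective (fun x => g * x * g^-1).
Proof. by move=> x y /mulIg /mulgI. Qed.

Lemma rank3_conj (A : groupType) (g h : A) : rank3 h -> rank3 (g * h * g^-1).
Proof. exact: rank3_mor (@conj_mor _ g) (@conj_inj _ g). Qed.

Lemma branching_rank3 (G : lgraph) (v : gV G) : branching v -> rank3 (agen v : artin G).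
Proof.
move=> [u [w [vu vw uw]]]; exists (agen v ^+ 2), (zc v u), (zc v w); split.
- exact: commuteX.
- by apply: commute_sym; case: (zc_commute vu).
- by apply: commute_sym; case: (zc_commute vw).
- by move=> i j k; exact: independent.
Qed.

Section GoodTreeElliptic.
Variables (A : groupType) (T : tree_action A) (l : A -> int).
Hypothesis lM : forall g h, l (g * h) = (l g + l h)%R.
Hypothesis good : forall g (p q : T),
  (0 < dist p q)%N -> fixes g p -> fixes g q -> l g = 0%R -> g = 1.

Lemma rank3_elliptic h : rank3 h -> elliptic T h.
Proof.
move=> [c1 [c2 [c3 [h1 h2 h3 ind]]]]; apply: contrapT => hh.
by have [_ [i [j [k [/ind]]]]] := hyperbolic_centralizer lM good hh h1 h2 h3.
Qed.

Lemma noncommuting_elliptic h a b : commute h a -> commute h b -> ~ commute a b ->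
  elliptic T h.
Proof.
move=> ha hb nab; apply: contrapT => hh.
by have [] := hyperbolic_centralizer lM good hh ha hb hb.
Qed.

End GoodTreeElliptic.

Section RankTwo.
Variables (A : groupType) (y z : A).
Hypothesis yz : commute y z.

Definition span2 (g : A) := exists i j, g = zexp y i * zexp z j.

Lemma span2M i j i' j' : (zexp y i * zexp z j) * (zexp y i' * zexp z j') =
  zexp y (i + i')%R * zexp z (j + j')%R.
Proof.
have c : commute (zexp z j) (zexp y i').
  by apply: commuteZ; apply: commute_sym; apply: commuteZ.
by rewrite !zexpD -!mulgA (mulgA (zexp z j)) c !mulgA.
Qed.

Lemma span2Z i j k : zexp (zexp y i * zexp z j) k = zexp y (i * k)%R * zexp z (j * k)%R.
Proof.
have c : commute (zexp y i) (zexp z j).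
  by apply: commuteZ; apply: commute_sym; apply: commuteZ; exact: commute_sym.
by rewrite zexpMn // !zexpM.
Qed.

Lemma span2_subgroup : subgroup span2.
Proof.
split; first by exists 0%R, 0%R; rewrite mulg1.
  by move=> _ _ [i [j ->]] [i' [j' ->]]; rewrite span2M; eexists; eexists.
move=> _ [i [j ->]]; exists (i * -1)%R, (j * -1)%R.
by rewrite -span2Z (zexpN _ 1).
Qed.

Lemma span2_dependent c1 c2 c3 : span2 c1 -> span2 c2 -> span2 c3 ->
  exists i j k : int, zexp c1 i * zexp c2 j * zexp c3 k = 1 /\ ~ [/\ i = 0, j = 0 & k = 0]%R.
Proof.
move=> [a1 [b1 ->]] [a2 [b2 ->]] [a3 [b3 ->]].
have [i [j [k [e1 e2 ne]]]] := int_dependent a1 a2 a3 b1 b2 b3.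
by exists i, j, k; split=> //; rewrite !span2Z !span2M e1 e2 mulg1.
Qed.

Lemma rank3_span2 (h g : A) : rank3 h ->
  ~ forall c, commute h c -> span2 (g^-1 * c * g).
Proof.
move=> [c1 [c2 [c3 [h1 h2 h3 ind]]]] sp.
have [i [j [k []]]] := span2_dependent (sp _ h1) (sp _ h2) (sp _ h3).
have cj c i' : zexp (g^-1 * c * g) i' = g^-1 * zexp c i' * g.
  by rewrite -{2 4}[g]invgK zexpJ.
rewrite !cj => e; apply; apply: ind.
by apply: (mulgI g^-1); apply: (mulIg g); rewrite -[RHS](mulgA) mul1g mulVg -e !mulgA !mulgK.
Qed.

End RankTwo.

Lemma bool_sym : symmetric (fun x y : bool => x != y).
Proof. by case; case. Qed.
Lemma bool_irr : irreflexive (fun x y : bool => x != y).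
Proof. by case. Qed.

Definition edge_graph n : lgraph := @LGraph bool (fun x y => x != y) (fun _ _ => n.+2)
  bool_sym bool_irr (fun _ _ _ => erefl) (fun _ _ _ => isT).

Section DihedralWords.
(* [x = ab] and [y = a] (even case) or [y = (ab)^n a] (odd case) generate the
   dihedral group, which is then an amalgam over the cyclic group of [x^k]. *)
Variables (K : groupType) (m : nat).

Definition dih_y (a b : K) := if odd m then (a * b) ^+ m./2 * a else a.
Definition dih_k := if odd m then m else m./2.
Definition dih_a (x y : K) := if odd m then x ^- m./2 * y else y.
Definition dih_b (x y : K) := if odd m then y^-1 * x ^+ m./2.+1 else y^-1 * x.

Lemma dih_aE a b : dih_a (a * b) (dih_y a b) = a.
Proof. by rewrite /dih_a /dih_y; case: (odd m) => //; rewrite mulKg. Qed.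

Lemma dih_bE a b : dih_b (a * b) (dih_y a b) = b.
Proof.
rewrite /dih_b /dih_y; case: (odd m); rewrite ?mulKg // invgM expgSr.
by rewrite -mulgA mulKg mulKg.
Qed.

Lemma dih_xE x y : dih_a x y * dih_b x y = x.
Proof.
rewrite /dih_a /dih_b; case: (odd m); last by rewrite mulVKg.
by rewrite -mulgA mulVKg expgSr mulKg.
Qed.

Lemma dih_yE x y : dih_y (dih_a x y) (dih_b x y) = y.
Proof.
rewrite /dih_y dih_xE /dih_a; case: (odd m) => //; exact: mulVKg.
Qed.

Definition dih_rel (x y : K) :=
  if odd m then x ^+ m = y ^+ 2 else commute (x ^+ m./2) y.

Lemma dih_rel_alt a b : dih_rel (a * b) (dih_y a b) <-> alt a b m = alt b a m.
Proof.
rewrite /dih_rel /dih_y.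
rewrite -[m in alt a b m]odd_double_half -[m in alt b a m]odd_double_half addnC.
case mo: (odd m); rewrite ?addn1 ?addn0 ?alt_double ?alt_double1; last first.
  have sw : a * (b * a) ^+ m./2 = (a * b) ^+ m./2 * a by rewrite expgM_swap.
  by split=> [e|e]; [apply: (mulgI a); rewrite sw -e|rewrite /commute {2}e sw].
rewrite -[X in _ ^+ X]odd_double_half mo add1n expg2.
have e1 : (a * b) ^+ m./2.*2.+1 = (a * b) ^+ m./2 * a * ((b * a) ^+ m./2 * b).
  by rewrite (expgM_swap b a) -addnn -addnS expgnDr expgS !mulgA.
by rewrite e1; split=> [/mulgI ->|->].
Qed.

End DihedralWords.

Section DihedralTree.
Variable n : nat.
Notation m := n.+2.
Notation G := (edge_graph n).
Notation A := (artin (edge_graph n)).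
Let a : A := agen (false : gV G).
Let b : A := agen (true : gV G).
Let x := a * b.
Let y := dih_y m a b.
Definition dih_center : A := (agen (false : gV G) * agen (true : gV G)) ^+ dih_k m.
Let z := dih_center.

Lemma dih_relA : dih_rel m x y.
Proof. by apply/dih_rel_alt; exact: (@gen_respects _ (@gadj G) (@glab G) false true isT). Qed.

Lemma commute_zy : commute z y.
Proof.
have := dih_relA; rewrite /dih_rel /z /dih_center /dih_k -/a -/b -/x; case: (odd m) => // ->.
by apply: commute_sym; apply: commuteX.
Qed.

Lemma commute_zx : commute z x.
Proof. by apply: commute_sym; apply: commuteX. Qed.

Lemma commute_za : commute z a.
Proof.
rewrite -(dih_aE m a b) -/x -/y /dih_a; case: (odd m); last exact: commute_zy.
apply: commuteM commute_zy; apply: commuteV; apply: commuteX; exact: commute_zx.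
Qed.

Lemma commute_zb : commute z b.
Proof.
rewrite -(mulKg a b); apply: commuteM commute_zx.
exact: commuteV commute_za.
Qed.

Lemma dih_center_central g : commute z g.
Proof.
elim/art_ind: g => [|[] g IH|[] g IH]; first exact: commute1.
- exact: commuteM commute_zb IH.
- exact: commuteM commute_za IH.
- exact: commuteM (commuteV commute_zb) IH.
- exact: commuteM (commuteV commute_za) IH.
Qed.

Let sz := cyc_subgroup z.

(** The two factors of the amalgam over the powers of [z]. For an odd label z = y^2, so the second
    factor is generated by [y]; for an even label it is free abelian of rank two. *)
Definition dih_vertex (i : bool) (g : A) := if i then span2 y z g else cyc x g.

Lemma dih_vertex_subgroup i : subgroup (dih_vertex i).
Proof.
case: i => /=; last exact: cyc_subgroup.
exact: span2_subgroup (commute_sym commute_zy).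
Qed.

Lemma dih_cover (i1 : bool) : exists (theta : A -> bij (A * bool)) (s : bool + unit -> bool),
  [/\ {morph theta : g h / g * h}, s (inl i1) != s (inr tt),
      forall i (j : unit), True -> s (inl i) != s (inr j) -> i = i1 /\ j = tt &
      forall k g t e, cstab dih_vertex (fun=> cyc z) k g ->
       bfun (theta g) (t, e) = (g * t, e (+) (s k && (`[< cyc z t >] (+) `[< cyc z (g * t) >])))].
Proof.
pose s (k : bool + unit) := if k is inl i then i == i1 else false.
pose cv := @cover A (cyc z).
have cvM c : {morph cv c : g h / g * h} by exact: coverM.
have cvz c c' : cv c z = cv c' z by apply: cover_in => //; exact: cyc_id.
(* It suffices to prescribe the images of [x] and [y], each in its own cover, provided the covers
   agree on [z]; [dih_a] and [dih_b] convert them into images of the generators. *)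
pose X := cv (s (inl false)) x; pose Y := cv (s (inl true)) y.
have Xk : X ^+ dih_k m = cv (s (inl true)) z.
  by rewrite (cvz _ (s (inl false))) /X -(morX (cvM _)).
pose f (v : gV G) := if v then dih_b m X Y else dih_a m X Y.
have fR : alt (f false) (f true) m = alt (f true) (f false) m.
  apply/dih_rel_alt; rewrite dih_xE dih_yE; move: Xk dih_relA commute_zy.
  rewrite /dih_rel /z /dih_center -/a -/b -/x /dih_k; case: (odd m) => -> xy zy.
    by rewrite xy (morX (cvM _)).
  by rewrite /commute /Y -!cvM zy.
have {}fR : respects f (@gadj G) (@glab G) by case; case.
have tM := liftM fR.
have tx : lift f x = X by rewrite tM !lift_gen // dih_xE.
have ty : lift f y = Y.
  rewrite /y -[RHS](dih_yE m X Y) /dih_y; case: (odd m); last by rewrite lift_gen.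
  by rewrite tM (morX tM) tM !lift_gen.
have tz : lift f z = cv (s (inl true)) z by rewrite /z /dih_center (morX tM) -/a -/b -/x tx Xk.
exists (@lift _ _ f _ _), s; split=> //.
- by rewrite /= eqxx.
- by move=> i [] _ /=; have [->|_] := eqVneq i i1.
move=> k g t e kg; suff -> : lift f g = cv (s k) g by [].
case: k kg => [[|]|[]] /=.
- by move=> [i [j ->]]; rewrite tM !(morZ tM) cvM !(morZ (cvM _)) ty tz.
- by move=> [i ->]; rewrite (morZ tM) (morZ (cvM _)) tx.
- by move=> [i ->]; rewrite (morZ tM) (morZ (cvM _)) tz (cvz _ false).
Qed.

(** Such an [h] is elliptic. If it fixed one point only, its centralizer would lie in a vertex group
    spanned by two commuting elements; so it fixes two and lies in a conjugate of the edge group,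
    which is central. *)
Lemma dih_rank3 (h : A) : rank3 h -> cyc z h.
Proof.
move=> h3; have zx : cyc x z by exists (Posz (dih_k m)).
have HG (j : unit) i g : True -> cyc z g -> dih_vertex i g.
  move=> _ [k ->]; apply: subgZ; first exact: dih_vertex_subgroup.
  by case: i => //=; exists 0%R, 1%R; rewrite mul1g.
have yv : dih_vertex true y by exists 1%R, 0%R; rewrite mulg1.
have xv : dih_vertex false x by exact: cyc_id.
have [||| T [big [fixE _ [_ ellE] edgeE goodE]]] := @coset_tree_exists A bool unit
    dih_vertex (fun=> cyc z) (fun _ _ => True) true
    dih_vertex_subgroup (fun=> sz) HG (fun=> ex_intro _ true I).
- move=> Q Q1 Qm; have sV := dih_vertex_subgroup.
  have Qab (u v : A) : (forall k g, Q g -> Q (u ^+ k * g)) -> (forall k g, Q g -> Q (u ^- k * g)) ->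
      (forall g, Q g -> Q (v * g)) -> (forall g, Q g -> Q (v^-1 * g)) -> forall g, Q g ->
      [/\ Q (dih_a m u v * g), Q ((dih_a m u v)^-1 * g), Q (dih_b m u v * g) &
          Q ((dih_b m u v)^-1 * g)].
    move=> Qu QuV Qv QvV g Qg; rewrite /dih_a /dih_b.
    have Qu1 := Qu 1%N; have QuV1 := QuV 1%N; rewrite expg1 in Qu1 QuV1.
    case: (odd m); split; auto.
    - by rewrite -mulgA; auto.
    - by rewrite (invgM (u ^- _)) (invgK (u ^+ _)) -mulgA; auto.
    - by rewrite -mulgA; auto.
    - by rewrite (invgM v^-1) (invgK v) -mulgA; auto.
    - by rewrite -mulgA; auto.
    - by rewrite (invgM v^-1) (invgK v) -mulgA; auto.
  have Qg g : Q g -> [/\ Q (a * g), Q (a^-1 * g), Q (b * g) & Q (b^-1 * g)].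
    move=> Qg; have := Qab x y; rewrite dih_aE dih_bE; apply=> // [k|k||] g' Qg'.
    - by apply: (Qm false) => //; apply: (subgX _ (sV false)).
    - by apply: (Qm false) => //; apply: (subgV (sV false)); apply: (subgX _ (sV false)).
    - exact: (Qm true).
    - by apply: (Qm true) => //; apply: (subgV (sV true)).
  by apply: art_ind => // -[] g /Qg [].
- move=> k l.
  pose R := @ceqv A bool unit dih_vertex (fun=> cyc z).
  pose E := @cedge A bool unit dih_vertex (fun _ _ => True).
  have Rxx p : R p p by apply: ceqvxx => //; exact: dih_vertex_subgroup.
  have s1 i : E (1, inl i) (1, inr tt).
    exists i, tt; split=> //; last by left.
    by rewrite /= invg1 mulg1; exact: (subg1 (dih_vertex_subgroup i)).
  have s2 i : E (1, inr tt) (1, inl i).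
    exists i, tt; split=> //; last by right.
    by rewrite /= invg1 mulg1; exact: (subg1 (dih_vertex_subgroup i)).
  have w1 i : walk R E 1 (1, inr tt) (1, inl i).
    by exists (1, inl i); [exact: s2|exact: Rxx].
  case: k l => [i|[]] [j|[]].
  + by exists 2%N; exists (1, inr tt); [exact: s1|exact: w1].
  + by exists 1%N; exists (1, inr tt); [exact: s1|exact: Rxx].
  + by exists 1%N.
  + by exists 0%N; exact: Rxx.
- by move=> i1 [] _; exact: dih_cover.
have [l [lM l1]] := total_weight G.
(* Nonzero weight of [z] makes [l] injective on the edge groups. *)
have lz : (l z != 0)%R.
  rewrite /z /dih_center (addX lM) lM !l1 /dih_k; case mo: (odd m); lia.
have good g (p q : T) : (0 < dist p q)%N -> fixes g p -> fixes g q -> l g = 0%R -> g = 1.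
  move=> pq gp gq lg; have [_ [k [i e]]] := goodE g p q pq gp gq.
  have eg : g = k * zexp z i * k^-1 by rewrite -e !mulgA mulgV mul1g mulgK.
  move: lg; rewrite eg (addJ lM) (addZ lM) => li.
  have -> : i = 0%R by nia.
  by rewrite mulg1 mulgV.
have [p hp] := rank3_elliptic lM good h3.
have [g [i /(_ h hp) hg]] := ellE p.
have [[q [qg hq]]|nq] := pselect (exists q, (0 < dist (big g i) q)%N /\ fixes h q).
  have [_ [k [_ _ /(_ h hg hq) [j e] _]]] := edgeE g i q qg.
  exists j; have c : commute (g * k) (zexp z j).
    by apply: commuteZ; apply: commute_sym; exact: dih_center_central.
  rewrite -(mulg_commute_inv c) -e; move: (g * k) => u.
  by rewrite !mulgA mulgV mul1g mulgK.
exfalso; have sub c : commute h c -> dih_vertex i (g^-1 * c * g).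
  move=> hc; apply/fixE; apply: contrapT => nc; apply: nq.
  exists (act c (big g i)); split; last exact: fixes_act.
  by rewrite lt0n; apply/eqP.
have sp c : commute h c -> span2 (if i then y else x) (if i then z else 1) (g^-1 * c * g).
  move=> /sub; case: (i) => //= -[k ->]; exists k, 0%R; exact/esym/mulg1.
apply: rank3_span2 h3 sp; case: (i); first exact/commute_sym/commute_zy.
exact: commute1.
Qed.

End DihedralTree.

(** * Elliptic chunks *)

Lemma nearer_parity i j : ~~ odd (i + 1 + j) -> ~~ (i < j)%N -> (j < i)%N.
Proof. lia. Qed.

Section GoodTreeEdges.
Variables (A : groupType) (T : tree_action A) (l : A -> int).
Hypothesis lM : forall g h, l (g * h) = (l g + l h)%R.
Hypothesis good : forall g (p q : T),
  (0 < dist p q)%N -> fixes g p -> fixes g q -> l g = 0%R -> g = 1.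

(** [l] embeds the common stabilizer of [p] and [q] in Z; Bezout coefficients give an element whose
    weight is the greatest common divisor. *)
Lemma common_cyclic g h (p q : T) : (0 < dist p q)%N ->
  fixes g p -> fixes g q -> fixes h p -> fixes h q -> exists c, cyc c g /\ cyc c h.
Proof.
move=> pq gp gq hp hq; have [u [v uv]] := Bezoutz (l g) (l h).
pose c := zexp g u * zexp h v.
have cl : l c = gcdz (l g) (l h) by rewrite /c lM !(addZ lM) -uv; lia.
have cp : fixes c p by apply: fixesM; apply: fixesZ.
have cq : fixes c q by apply: fixesM; apply: fixesZ.
have key x : fixes x p -> fixes x q -> (l c %| l x)%Z -> cyc c x.
  move=> xp xq /dvdzP [k e]; exists k; apply: divg1_eq.
  apply: (good pq); first by apply: fixesM => //; apply: fixesV; apply: fixesZ.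
    by apply: fixesM => //; apply: fixesV; apply: fixesZ.
  by rewrite lM (addV lM) (addZ lM) e; lia.
by exists c; split; apply: key => //; rewrite cl ?dvdz_gcdl ?dvdz_gcdr.
Qed.

End GoodTreeEdges.

Section Iso.
Variables G G' : lgraph.
Notation A := (artin G).
Notation A' := (artin G').
Hypothesis connG : connected_graph G.
Hypothesis connG' : connected_graph G'.
Variables (phi : A -> A') (psi : A' -> A).
Hypothesis phiM : {morph phi : x y / x * y}.
Hypothesis psiM : {morph psi : x y / x * y}.
Hypothesis phiK : cancel phi psi.
Hypothesis psiK : cancel psi phi.

Lemma phi_inj : injective phi. Proof. exact: can_inj phiK. Qed.

Lemma phi_commute x y : commute x y -> commute (phi x) (phi y).
Proof. by move=> e; rewrite /commute -!phiM e. Qed.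

Lemma phi_noncyclic (u v : gV G) c : u != v ->
  cyc c (phi (agen u)) -> cyc c (phi (agen v)) -> False.
Proof.
move=> uv [i ei] [j ej]; move/eqP: uv; apply.
apply: (@agen_cyclic G u v (psi c)); [exists i|exists j].
  by rewrite -(morZ psiM) -ei phiK.
by rewrite -(morZ psiM) -ej phiK.
Qed.

Section Elliptic.
Variables (T : tree_action A') (l : A' -> int).
Hypothesis lM : forall g h, l (g * h) = (l g + l h)%R.
Hypothesis good : forall g (p q : T),
  (0 < dist p q)%N -> fixes g p -> fixes g q -> l g = 0%R -> g = 1.

Lemma fixes_two_gens (u v : gV G) (p q : T) : u != v -> (0 < dist p q)%N ->
  fixes (phi (agen u)) p -> fixes (phi (agen u)) q ->
  fixes (phi (agen v)) p -> fixes (phi (agen v)) q -> False.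
Proof.
move=> uv pq up uq vp vq; have [c [cu cv]] := common_cyclic lM good pq up uq vp vq.
exact: phi_noncyclic uv cu cv.
Qed.

Lemma branching_elliptic (v : gV G) : branching v -> elliptic T (phi (agen v)).
Proof.
move=> bv; apply: (rank3_elliptic lM good).
exact: (rank3_mor phiM phi_inj (branching_rank3 bv)).
Qed.

(** For label 2 the images commute. Otherwise [zc u v] commutes with two noncommuting generators, so
    its image is elliptic; hence so is the image of the product of [u] and [v], and Serre's lemma
    applies. *)
Lemma edge_common_fixpoint (u v : gV G) : gadj u v ->
  elliptic T (phi (agen u)) -> elliptic T (phi (agen v)) ->
  exists p : T, fixes (phi (agen u)) p /\ fixes (phi (agen v)) p.
Proof.
move=> uv eu ev; have m2 := glab_ge2 uv.
have [e|ne] := eqVneq (glab u v) 2%N.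
  apply: commuting_elliptic => //; apply: phi_commute.
  by have := @gen_respects _ (@gadj G) (@glab G) u v uv; rewrite e /= !mulg1.
apply: serre => //; apply: (@elliptic_root _ _ _ (glab u v)); first by lia.
rewrite -phiM -(morX phiM) -/(zc u v); have [zu zv] := zc_commute uv.
apply: (noncommuting_elliptic lM good (phi_commute zu) (phi_commute zv)).
rewrite /commute -!phiM => /phi_inj; apply: agen_noncommute => //; lia.
Qed.

(* At most one generator of [L] fixes a given edge [pw] of the tree.  Removing
   it leaves [L] connected, and along edges of [L] the side of [pw] on which
   the fixed points lie cannot change. *)
Lemma biconnected_common_fixpoint (L : {set gV G}) (a b : gV G) : biconnected L ->
  gadj a b -> a \in L -> b \in L ->
  (forall v, v \in L -> elliptic T (phi (agen v))) ->
  exists p : T, forall v, v \in L -> fixes (phi (agen v)) p.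
Proof.
move=> bL ab aL bL' ell.
have [p [pa pb]] := edge_common_fixpoint ab (ell a aL) (ell b bL').
exists p; apply: contrapT => /existsNP [c /not_implyP [cL cp]].
have ac : a != c by apply: contra_notN cp => /eqP <-.
have [|d [ca _ dL]] := conn_step (bL.1.2 c a cL aL); first by rewrite eq_sym.
have cd := gadj_neq ca.
have [q [qc qd]] := edge_common_fixpoint ca (ell c cL) (ell d dL).
have pq : (0 < dist p q)%N.
  by rewrite lt0n; apply/eqP => e; apply: cp; apply: fixes_dist0 qc; rewrite distC.
have [w [pw pwq key]] := first_edge pq.
pose near (x : T) := (dist x p < dist x w)%N.
have far x : ~~ near x -> (dist x w < dist x p)%N.
  by have := dist_par x p w; rewrite /near pw; exact: nearer_parity.
pose bad v := fixes (phi (agen v)) p /\ fixes (phi (agen v)) w.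
have side v : ~ bad v -> forall x y, fixes (phi (agen v)) x -> fixes (phi (agen v)) y ->
    near x -> near y.
  move=> nb x y vx vy nx; apply: contraT => /far fy.
  by case: nb; exact: key vx vy nx fy.
(* Deleting the one possible bad vertex spares an end of [ab], fixing [p], and an end of [cd],
   fixing [q]. *)
have [S [cS SL Sbad Sab Scd]] : exists S : {set gV G}, [/\ conn S, S \subset L,
    forall v, v \in S -> ~ bad v, a \in S \/ b \in S & c \in S \/ d \in S].
  have nab := gadj_neq ab.
  have [[v0 [v0L v0b]]|nb] := pselect (exists v, v \in L /\ bad v); last first.
    exists L; split; [exact: bL.1.2|exact: subxx| |by left|by left].
    by move=> v vL vb; apply: nb; exists v.
  exists (L :\ v0); split; [exact: biconn_minus|exact: subsetDl| | |].
  - move=> v /setD1P[vv0 vL] [vp vw]; case: v0b => v0p v0w.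
    by apply: (@fixes_two_gens v v0 p w) => //; rewrite pw.
  - rewrite !inE aL bL'; have [<-|_] := eqVneq a v0; last by left.
    by right; rewrite eq_sym nab.
  - rewrite !inE cL dL; have [<-|_] := eqVneq c v0; last by left.
    by right; rewrite eq_sym cd.
have [a' [a'S a'p]] : exists a', a' \in S /\ fixes (phi (agen a')) p.
  by case: Sab => ?; [exists a|exists b].
have [c' [c'S c'q]] : exists c', c' \in S /\ fixes (phi (agen c')) q.
  by case: Scd => ?; [exists c|exists d].
have np : near p by rewrite /near pw distxx.
have : near q.
  have Q := connect_ind (Q := fun v => forall x, fixes (phi (agen v)) x -> near x) (cS a' c' a'S c'S).
  apply: (Q _ _ q c'q); first by move=> x xa; exact: (side _ (Sbad _ a'S) p x a'p xa np).
  move=> u v /and3P[uv uS vS] Qu x vx.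
  have [r [ru rv]] := edge_common_fixpoint uv (ell u (subsetP SL _ uS)) (ell v (subsetP SL _ vS)).
  exact: (side _ (Sbad _ vS) _ _ rv vx (Qu r ru)).
by rewrite /near (distC q p) (distC q w) -pwq pw ltnNge leq_addl.
Qed.

End Elliptic.

Definition maps_into (L : {set gV G}) (L' : {set gV G'}) :=
  exists g, forall x, std L x -> std L' (g^-1 * phi x * g).

Lemma fixes_std (T : tree_action A') (p : T) (L : {set gV G}) :
  (forall v, v \in L -> fixes (phi (agen v)) p) -> forall x, std L x -> fixes (phi x) p.
Proof.
move=> Lp; apply: std_ind => //; split; first by rewrite (mor1 phiM); exact: fixes1.
  by move=> x y px py; rewrite phiM; exact: fixesM.
by move=> x px; rewrite (morV phiM); exact: fixesV.
Qed.

(** The two alternatives serve the two halves of the theorem: large centralizers in general, and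
    conjugates of generators under the additional assumption. *)
Lemma elliptic_maps_into (L : {set gV G}) (a b : gV G) : biconnected L ->
  gadj a b -> a \in L -> b \in L ->
  (forall v, v \in L -> branching v \/
     exists g v', phi (agen v) = g * agen v' * g^-1) ->
  exists2 L', big_chunk L' & maps_into L L'.
Proof.
move=> bL ab aL bL' LE; have [T [big [fixE _ [_ bigE] _ goodE]]] := chunk_tree connG'.
have [l [lM l1]] := total_weight G'.
have good g (p q : T) : (0 < dist p q)%N -> fixes g p -> fixes g q -> l g = 0%R -> g = 1.
  by move=> pq gp gq; apply: (conj_gen_weight lM l1); exact: goodE gp gq.
have [v vL|p Lp] := biconnected_common_fixpoint lM good bL ab aL bL'.
  case: (LE v vL) => [/(branching_elliptic lM good) //|[g [v' ->]]].
  have [M cM v'M] := vertex_chunk v'; exists (big g (mkchunk cM)); apply/fixE.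
  by rewrite !mulgA mulVg mul1g mulgVK; exact: std_gen.
have [g [M pM]] := bigE p; exists (sval M); first exact: chunkP.
by exists g => x xL; apply/fixE/pM; exact: (fixes_std Lp).
Qed.

End Iso.

(** * Centralizers and uniqueness of conjugates, read off from the chunk tree *)

Section ChunkTreeConsequences.
Variable G : lgraph.
Notation V := (gV G).
Notation A := (artin G).
Hypothesis connG : connected_graph G.
Implicit Types L M : {set V}.

(** [x] fixes the vertex [g A_L]. If it fixes another chunk vertex, the path there leaves through a
    vertex shared with a further chunk, and [x] lies in the corresponding cyclic group. If not,
    everything commuting with [x] preserves its only fixed chunk vertex. *)
Lemma std_dichotomy L g (x : A) : big_chunk L -> std L (g^-1 * x * g) ->
  (exists v k M, [/\ v \in L, std L k, big_chunk M /\ v \in M, M <> L &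
     cyc (agen v) ((g * k)^-1 * x * (g * k))]) \/
  (forall c, commute x c -> std L (g^-1 * c * g)).
Proof.
move=> cL xL; have [T [big [fixE distE [actE bigE] edgeE _]]] := chunk_tree connG.
have xf : fixes x (big g (mkchunk cL)) by apply/fixE.
have [[h [M [pq xq]]]|nq] := pselect (exists h (M : chunk G), (0 < dist (big g (mkchunk cL)) (big h M))%N /\ fixes x (big h M)).
  left; have [v [k [vL kL fx /(_ _ _ erefl) [N [vN NL]]]]] := edgeE _ _ _ pq.
  exists v, k, (sval N); split=> //; first by split; [exact: chunkP|].
    by move=> e; apply: NL; exact: chunk_eq.
  exact: fx.
right=> c xc; apply/(fixE _ _ (mkchunk cL)); apply: contrapT => nc; apply: nq.
exists (c * g), (mkchunk cL); rewrite -actE; split; last exact: fixes_act.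
by rewrite lt0n; apply/eqP.
Qed.

(** Elements fixing two different vertices lie in the cyclic stabilizer of an edge between them. *)
Lemma std_conj_unique L M g h (x y : A) : big_chunk L -> big_chunk M ->
  std L (g^-1 * x * g) -> std L (g^-1 * y * g) ->
  std M (h^-1 * x * h) -> std M (h^-1 * y * h) ->
  (exists c, cyc c x /\ cyc c y) \/ (L = M /\ std L (g^-1 * h)).
Proof.
move=> cL cM xL yL xM yM; have [T [big [fixE distE _ edgeE _]]] := chunk_tree connG.
pose p := big g (mkchunk cL); pose q := big h (mkchunk cM).
have [e|pq] := eqVneq (dist p q) 0.
  by right; have [/(congr1 sval)] := (distE _ _ _ _).1 e.
have [v [k [_ _ fx _]]] : exists v k, [/\ v \in L, std L k,
    forall z, fixes z p -> fixes z q -> cyc (agen v : A) ((g * k)^-1 * z * (g * k)) & True].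
  have [|v [k [vL kL fx _]]] := edgeE g (mkchunk cL) q; first by rewrite lt0n.
  by exists v, k.
have cj z : cyc (agen v) ((g * k)^-1 * z * (g * k)) -> cyc ((g * k) * agen v * (g * k)^-1) z.
  by move: (g * k) => u [i e]; exists i; rewrite zexpJ -e !mulgA mulgV mul1g mulgK.
left; exists ((g * k) * agen v * (g * k)^-1).
by split; apply/cj/fx; apply/fixE.
Qed.

Lemma noncommuting_std (x a b : A) : commute x a -> commute x b -> ~ commute a b ->
  exists g L, big_chunk L /\ std L (g^-1 * x * g).
Proof.
move=> xa xb nab; have [T [big [fixE _ [_ bigE] _ goodE]]] := chunk_tree connG.
have [l [lM l1]] := total_weight G.
have [|p px] := noncommuting_elliptic (T := T) lM _ xa xb nab; last first.
  have [g [L /(_ x px) /fixE xL]] := bigE p.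
  by exists g, (sval L); split=> //; exact: chunkP.
by move=> g p q pq gp gq; apply: (conj_gen_weight lM l1); exact: goodE gp gq.
Qed.

Section Edge.
Variables a b : V.
Hypothesis ab : gadj a b.
Hypothesis cL : big_chunk [set a; b].
Local Notation L := [set a; b].

(** For labels at least 3 this generates the centre of the dihedral group on [a] and [b]; [zc a b]
    is this element or its square. *)
Definition edge_center (a b : V) : A := (agen a * agen b) ^+ dih_k (glab a b).

Let n := (glab a b).-2.
Let mn : n.+2 = glab a b.
Proof. by rewrite /n; have := glab_ge2 ab; lia. Qed.

Let i (v : gV (edge_graph n)) : A := if v then agen b else agen a.
Let iR : respects i (@gadj (edge_graph n)) (@glab (edge_graph n)).
Proof.
have e := @gen_respects _ (@gadj G) (@glab G) a b ab; rewrite -mn in e.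
by case; case.
Qed.
Let inc := @lift _ _ i (@gadj (edge_graph n)) (@glab (edge_graph n)).
Let incM : {morph inc : x y / x * y} := liftM iR.

Let inc_center : inc (dih_center n) = edge_center a b.
Proof. by rewrite /dih_center (morX incM) incM /inc !lift_gen // mn. Qed.

Lemma edge_center_commute x : std L x -> commute (edge_center a b) x.
Proof.
have cg v : commute (edge_center a b) (i v).
  rewrite -inc_center -(lift_gen iR) -/inc /commute -!incM.
  by congr inc; exact: dih_center_central.
move: x; apply: std_ind; last first.
  by move=> v /set2P[] ->; [exact: (cg false)|exact: (cg true)].
split; first exact: commute1.
  by move=> x y; exact: commuteM.
by move=> x; exact: commuteV.
Qed.

(** The retraction onto [L] induces a projection to the dihedral Artin group that is undone by [inc]
    on [std L], so [dih_rank3] can be transported. *)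
Lemma edge_rank3 h c1 c2 c3 : std L h -> std L c1 -> std L c2 -> std L c3 ->
  commute h c1 -> commute h c2 -> commute h c3 ->
  (forall i j k, zexp c1 i * zexp c2 j * zexp c3 k = 1 -> [/\ i = 0, j = 0 & k = 0]%R) ->
  cyc (edge_center a b) h.
Proof.
move=> hL L1 L2 L3 h1 h2 h3 ind; have [r [rL rid rR]] := retraction connG cL.
pose p (v : V) : artin (edge_graph n) := if r v == a then agen (false : gV (edge_graph n)) else agen (true : gV (edge_graph n)).
have nab : (b == a) = false by apply/eqP => e; move: ab; rewrite e gadj_irr.
have pR : respects p (@gadj G) (@glab G).
  pose g (v : bool) : artin (edge_graph n) := agen (v : gV (edge_graph n)).
  have e : alt (g false) (g true) (glab a b) = alt (g true) (g false) (glab a b).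
    by rewrite -mn; exact: (@gen_respects _ (@gadj (edge_graph n)) (@glab (edge_graph n)) false true isT).
  move=> u v uv; rewrite /p; have [->|[uL vL]] := rR u v uv; first by rewrite !alt_same.
  rewrite !rid //; move: uv uL vL => + /set2P[] -> /set2P[] ->;
    rewrite ?gadj_irr ?eqxx ?nab // => _.
  by rewrite -?(glab_sym ab) e.
pose proj := @lift _ _ p (@gadj G) (@glab G).
have projM : {morph proj : x y / x * y} := liftM pR.
have ip x : std L x -> inc (proj x) = x.
  move: x; apply: std_ind.
    apply: (@equalizer_subgroup _ _ (fun x => inc (proj x)) id) => // x y.
    by rewrite projM incM.
  move=> v vL; rewrite /proj lift_gen // /p rid //.
  by case/set2P: vL => ->; rewrite ?eqxx ?nab /inc lift_gen.
have [k e] : cyc (dih_center n) (proj h).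
  apply: dih_rank3; exists (proj c1), (proj c2), (proj c3).
  split; try by rewrite /commute -!projM; congr proj.
  move=> j1 j2 j3; rewrite -!(morZ projM) -!projM => e; apply: ind.
  rewrite -[LHS]ip ?e ?(mor1 incM) //; have sL := std_subgroup L.
  by do 2?[apply: (subgM sL)]; apply: subgZ.
by exists k; rewrite -(ip h hL) e (morZ incM) inc_center.
Qed.

Lemma edge_center_power : exists e, zc a b = edge_center a b ^+ e.
Proof.
rewrite /zc /edge_center /dih_k; case mo: (odd (glab a b)); first by exists 1%N.
by exists 2%N; rewrite -expgnA; congr (_ ^+ _); have := odd_double_half (glab a b); rewrite mo; lia.
Qed.

Lemma edge_center_not_gen v j : v \in L -> edge_center a b <> zexp (agen v) j.
Proof.
have [e ze] := edge_center_power.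
have key v' : zc v' (if v' == a then b else a) = zc a b -> gadj v' (if v' == a then b else a) ->
    edge_center a b <> zexp (agen v') j.
  move=> zv vv ej; have := @independent2 G _ v' (j * Posz e)%R 1%R vv.
  by rewrite zexp1 zv ze ej zexpM => /(_ erefl).
have nab : (b == a) = false by apply/eqP => h; move: ab; rewrite h gadj_irr.
case/set2P => ->; apply: key; rewrite ?eqxx ?nab //; last by rewrite gadj_sym.
by rewrite zc_sym // gadj_sym.
Qed.

(** The first case of the dichotomy would make the central element a power of a generator, since
    conjugation by an element of [A_L] does not change it. *)
Lemma edge_center_centralizer x : commute (edge_center a b) x -> std L x.
Proof.
move=> zx; have zL : std L (edge_center a b).
  apply: subgX; first exact: std_subgroup.
  by apply: (subgM (std_subgroup L)); apply: std_gen; rewrite ?set21 ?set22.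
have := @std_dichotomy L 1 (edge_center a b) cL; rewrite invg1 mul1g mulg1 => /(_ zL) [].
  move=> [v [k [M [vL kL _ _ [j]]]]]; rewrite mul1g => e.
  case: (@edge_center_not_gen v j vL); rewrite -e.
  by rewrite -mulgA (edge_center_commute kL) mulKg.
by move=> /(_ x zx); rewrite mul1g mulg1.
Qed.

End Edge.
End ChunkTreeConsequences.

Lemma dih_k_gt1 m : (2 < m)%N -> (1 < dih_k m)%N.
Proof. by rewrite /dih_k; case mo: (odd m); have := odd_double_half m; rewrite mo; lia. Qed.

Lemma int_nonunit_mul (q t : int) d : (1 < d)%N -> (q * Posz d * t)%R <> 1%R.
Proof.
move=> d1 e; have : (Posz d %| 1)%Z.
  by apply/dvdzP; exists (q * t)%R; rewrite GRing.mulrAC e.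
by rewrite dvdz1 absz_nat; lia.
Qed.

Lemma std_edge_commute (G : lgraph) (a b : gV G) (x : artin G) : gadj a b -> glab a b = 2 ->
  std [set a; b] x -> commute x (agen a) /\ commute x (agen b).
Proof.
move=> ab m2; have c : commute (agen a : artin G) (agen b).
  by have := @gen_respects _ (@gadj G) (@glab G) a b ab; rewrite m2 /= !mulg1.
move: x; apply: std_ind; last first.
  by move=> v /set2P[] ->; split=> //; exact: commute_sym.
split; first by split; exact/commute_sym/commute1.
  move=> x y [xa xb] [ya yb].
  by split; apply: commute_sym; apply: commuteM; exact: commute_sym.
by move=> x [xa xb]; split; apply: commute_sym; apply: commuteV; exact: commute_sym.
Qed.

Lemma std_edge_span2 (G : lgraph) (a b : gV G) (x : artin G) : gadj a b -> glab a b = 2 ->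
  std [set a; b] x -> span2 (agen a) (agen b) x.
Proof.
move=> ab m2; have c : commute (agen a : artin G) (agen b).
  by have := @gen_respects _ (@gadj G) (@glab G) a b ab; rewrite m2 /= !mulg1.
move: x; apply: std_ind; first exact: span2_subgroup.
move=> v /set2P[] ->; first by exists 1%R, 0%R; rewrite mulg1.
by exists 0%R, 1%R; rewrite mul1g.
Qed.

(** * Images of chunks under an isomorphism *)

Section Iso.
Variables G G' : lgraph.
Notation A := (artin G).
Notation A' := (artin G').
Hypothesis connG : connected_graph G.
Hypothesis connG' : connected_graph G'.
Variables (phi : A -> A') (psi : A' -> A).
Hypothesis phiM : {morph phi : x y / x * y}.
Hypothesis psiM : {morph psi : x y / x * y}.
Hypothesis phiK : cancel phi psi.
Hypothesis psiK : cancel psi phi.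

(** The image of the centre [z] commutes with two noncommuting elements, hence is elliptic. If its
    centralizer did not stay in one chunk group, [z] would be a power of some [h] that [phi] sends
    to a conjugate of a branching generator. The centralizer of [h] then lies in [A_L], so [h] is in
    turn a power of [z]; but [phi h] has weight 1, while the weight of [phi z] is divisible by
    [dih_k], which exceeds 1. *)
Lemma edge_maps_into (a b : gV G) : gadj a b -> (2 < glab a b)%N -> big_chunk [set a; b] ->
  exists2 L', big_chunk L' & maps_into phi [set a; b] L'.
Proof.
move=> ab m3 cL; set L := [set a; b]; set z : A := edge_center a b.
have pc x y : commute x y -> commute (phi x) (phi y) by exact: phi_commute.
have zc x : std L x -> commute z x := @edge_center_commute G a b ab x.
have aL : std L (agen a) by apply: std_gen; exact: set21.
have bL : std L (agen b) by apply: std_gen; exact: set22.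
have nab : ~ commute (phi (agen a)) (phi (agen b)).
  by rewrite /commute -!phiM => /(phi_inj phiK); exact: agen_noncommute.
have [g [L' [cL' zL']]] := noncommuting_std connG' (pc _ _ (zc _ aL)) (pc _ _ (zc _ bL)) nab.
have [[v [k [M [vL' _ [cM vM] ML' [j e]]]]]|cz] := std_dichotomy connG' cL' zL'; last first.
  by exists L' => //; exists g => x xL; apply: cz; exact/pc/zc.
exfalso; move: (g * k) e => u e.
have bv : branching v := two_chunks_branching connG' cM cL' ML' vM vL'.
pose h := psi (u * agen v * u^-1).
have zh : z = zexp h j.
  rewrite -(morZ psiM) zexpJ -e -[LHS]phiK; congr psi.
  by rewrite !mulgA mulgV mul1g mulgK.
have h3 : rank3 h by apply: (rank3_mor psiM (can_inj psiK)); exact/rank3_conj/branching_rank3.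
have [c1 [c2 [c3 [h1 h2 h3' ind]]]] := h3.
have cL2 c : commute h c -> std L c.
  move=> hc; apply: (edge_center_centralizer connG ab cL).
  by rewrite -/z zh; apply: commute_sym; apply: commuteZ; exact: commute_sym.
have [t ht] : cyc z h by apply: (edge_rank3 connG ab cL _ _ _ _ h1 h2 h3' ind); exact: cL2.
have [l [lM l1]] := total_weight G'.
have := dih_k_gt1 m3; have : l (phi h) = 1%R by rewrite /h psiK (addJ lM) l1.
rewrite ht (morZ phiM) (addZ lM) /z /edge_center (morX phiM) (addX lM).
by move=> lh d1; case: (@int_nonunit_mul (l (phi (agen a * agen b))) t _ d1).
Qed.

Lemma chunk_maps_into (L : {set gV G}) (a b : gV G) : big_chunk L -> ~ toral_leaf L ->
  gadj a b -> a \in L -> b \in L -> exists2 L', big_chunk L' & maps_into phi L L'.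
Proof.
move=> cL ntL ab aL bL; have bic := big_chunk_biconn cL.
have nab := gadj_neq ab.
case: (chunk_cases connG cL) => [[v [_ all]]|[c [d [cd eL]]]|br].
- by move: nab; rewrite (all a) (all b) eqxx.
- have m2 := glab_ge2 cd; have [e2|n2] := eqVneq (glab c d) 2%N; last first.
    by rewrite eL; apply: edge_maps_into; rewrite -?eL //; lia.
  have [|bc bd] := non_leaf_edge cd.
    move=> [c' [d' [cd' e lf]]]; apply: ntL; exists c', d'; split=> //; first by rewrite eL.
    have : (c' \in [set c; d]) && (d' \in [set c; d]) by rewrite e set21 set22.
    case/andP => /set2P[] e1 /set2P[] e3; move: cd'; rewrite e1 e3 ?gadj_irr //.
    by move=> _; rewrite -(glab_sym cd).
  apply: (elliptic_maps_into connG' phiM psiM phiK bic ab aL bL) => v.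
  by rewrite eL => /set2P[] ->; left.
apply: (elliptic_maps_into connG' phiM psiM phiK bic ab aL bL) => v vL; left.
by have [u [w [_ _ vu vw uw]]] := br v vL; exists u, w.
Qed.

Definition conj_onto (L : {set gV G}) (L' : {set gV G'}) :=
  exists g, forall x, std L' (g^-1 * x * g) <-> exists2 y, std L y & x = phi y.

(** Going forth and back places [A_L] inside the conjugate of [A_L2] by [u]. Two distinct generators
    lie in no common cyclic group, so the two vertices of the chunk tree coincide and [u] belongs to
    [A_L]. *)
Lemma maps_into_onto (L L2 : {set gV G}) (a b : gV G) (L1 : {set gV G'}) : a != b ->
  a \in L -> b \in L -> big_chunk L -> big_chunk L2 ->
  maps_into phi L L1 -> maps_into psi L1 L2 -> L2 = L /\ conj_onto L L1.
Proof.
move=> ab aL bL cL c2 [g m1] [h m2]; pose u := psi g * h.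
have m x : std L x -> std L2 (u^-1 * x * u).
  move=> /m1 /m2; rewrite !psiM (morV psiM) phiK /u; rewrite !mulgA.
  by rewrite invgM.
have id1 x : std L x -> std L (1^-1 * x * 1) by rewrite invg1 mul1g mulg1.
have aS := std_gen aL; have bS := std_gen bL.
have [[c [ca cb]]|[e]] := std_conj_unique connG cL c2 (id1 _ aS) (id1 _ bS) (m _ aS) (m _ bS).
  by move/eqP: ab => []; exact: agen_cyclic ca cb.
rewrite invg1 mul1g => uL; split; first by rewrite e.
exists g => x; split=> [xL|[y yL ->]]; last exact: m1.
exists (psi x); last by rewrite psiK.
have := m2 _ xL; rewrite !psiM (morV psiM) -e => yL.
have sL := std_subgroup L.
have -> : psi x = u * (h^-1 * ((psi g)^-1 * psi x * psi g) * h) * u^-1.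
  by rewrite /u invgM !mulgA !mulgK mulgV mul1g.
by apply: (subgM sL); [apply: (subgM sL)|apply: (subgV sL)].
Qed.

(** Suppose [L'] is a toral leaf with tip [b']. A branching generator of [L] has too large a
    centralizer to stay in Z^2, so by the dichotomy its image is, up to the conjugation by [g], a
    power of [a'], the tip being in no other chunk. Two such generators would lie in one cyclic
    group. *)
Lemma maps_into_not_toral (L : {set gV G}) (a b : gV G) (L' : {set gV G'}) :
  gadj a b -> a \in L -> b \in L -> big_chunk L -> ~ toral_leaf L ->
  big_chunk L' -> maps_into phi L L' -> ~ toral_leaf L'.
Proof.
move=> ab aL bL cL ntL cL' [g m1].
suff key a' b' : gadj a' b' -> L' = [set a'; b'] -> valence b' == 1%N -> glab a' b' = 2 -> False.
  case=> [a' [b' [ab' eL' lf m2]]]; case/orP: lf => lf; last exact: (key a' b').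
  by apply: (key b' a') => //; rewrite ?(gadj_sym b') // -?(glab_sym ab') // eL' setUC.
move=> ab' eL' b1 m2.
have br : exists u v, [/\ u \in L, v \in L, u != v, branching u & branching v].
  have nab := gadj_neq ab.
  case: (chunk_cases connG cL) => [[v [_ all]]|[c [d [cd eL]]]|br].
  - by move: nab; rewrite (all a) (all b) eqxx.
  - have cL2 : c \in L /\ d \in L by rewrite eL set21 set22.
    have ncd := gadj_neq cd.
    have e2 : glab c d = 2.
      apply/eqP; apply: contraT => n2.
      have : commute (agen c : A) (agen d).
        apply: (can_inj phiK); rewrite !phiM; apply: (mulgI g^-1); apply: (mulIg g).
        have xc := m1 _ (std_gen cL2.1); have xd := m1 _ (std_gen cL2.2).
        have : commute (g^-1 * phi (agen c) * g) (g^-1 * phi (agen d) * g).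
          rewrite eL' in xc xd; have [i [j ->]] := std_edge_span2 ab' m2 xd.
          have [ya yb] := std_edge_commute ab' m2 xc.
          by apply: commuteM; apply: commuteZ.
        by rewrite /commute !mulgA !mulgK.
      have m3 : (2 < glab c d)%N by rewrite ltn_neqAle eq_sym n2 glab_ge2.
      by move=> cc; case: (agen_noncommute cd m3 cc).
    have [|bc bd] := non_leaf_edge cd; last by exists c, d; case: cL2.
    move=> [c' [d' [cd' e lf]]]; apply: ntL; exists c', d'; split=> //; first by rewrite eL.
    have : (c' \in [set c; d]) && (d' \in [set c; d]) by rewrite e set21 set22.
    case/andP => /set2P[] e1 /set2P[] e3; move: cd'; rewrite e1 e3 ?gadj_irr //.
    by move=> _; rewrite -(glab_sym cd).
  exists a, b; split=> //.
    by have [u [w [_ _ vu vw uw]]] := br a aL; exists u, w.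
  by have [u [w [_ _ vu vw uw]]] := br b bL; exists u, w.
have in_a u : u \in L -> branching u -> cyc (g * agen a' * g^-1) (phi (agen u)).
  move=> uL bu; have uS := m1 _ (std_gen uL).
  have [[v [k [M [vL' kL' [cM vM] ML' [j e]]]]]|cu] := std_dichotomy connG' cL' uS; last first.
    have := rank3_mor phiM (phi_inj phiK) (branching_rank3 bu).
    have cab : commute (agen a' : A') (agen b').
      by have := @gen_respects _ (@gadj G') (@glab G') a' b' ab'; rewrite m2 /= !mulg1.
    move/(rank3_span2 cab (g := g)); case=> c /cu; rewrite eL'; exact: std_edge_span2.
  have va : v = a'.
    rewrite eL' in vL'; case/set2P: vL' => // vb; case: ML'; rewrite eL'.
    by apply: (leaf_chunk connG' ab' b1 cM); rewrite -vb.
  rewrite va in e; exists j; rewrite zexpJ.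
  rewrite eL' in kL'; have [ka _] := std_edge_commute ab' m2 kL'.
  have kj : k * zexp (agen a') j * k^-1 = zexp (agen a') j.
    by apply: mulg_commute_inv; exact: commuteZ.
  by rewrite -kj -e invgM !mulgA !mulgK mulgV mul1g.
have [u [v [uL vL uv bu bv]]] := br.
exact: (phi_noncyclic psiM phiK uv (in_a u uL bu) (in_a v vL bv)).
Qed.

End Iso.

Lemma odd_conj (G : lgraph) (a b : gV G) : gadj a b -> odd (glab a b) ->
  exists k : artin G, agen b = k * agen a * k^-1.
Proof.
move=> ab mo; have := @gen_respects _ (@gadj G) (@glab G) a b ab.
rewrite -[glab a b]odd_double_half mo add1n !alt_double1 => e.
exists ((agen a * agen b) ^+ (glab a b)./2); rewrite e.
by rewrite expgM_swap mulgK.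
Qed.

Lemma leaf_neighbor (G : lgraph) (a b v : gV G) : gadj a b -> valence b == 1%N ->
  gadj b v -> v = a.
Proof.
move=> ab b1 bv; have ba : gadj b a by rewrite gadj_sym.
apply/eqP; apply: contraTT b1 => va; apply/(branchingP ba).
by exists v, a.
Qed.

Lemma singleton_cyclic (G : lgraph) (v : gV G) : (forall x, x = v) ->
  forall x : artin G, cyc (agen v) x.
Proof.
move=> all x; have := std_setT x; move: x; apply: std_ind; first exact: cyc_subgroup.
by move=> u _; rewrite (all u); exact: cyc_id.
Qed.

(** * Even leaves with label greater than two *)

Section EvenLeaf.
Variables G G' : lgraph.
Notation A := (artin G).
Notation A' := (artin G').
Hypothesis connG : connected_graph G.
Hypothesis connG' : connected_graph G'.
Variables (phi : A -> A') (psi : A' -> A).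
Hypothesis phiM : {morph phi : x y / x * y}.
Hypothesis psiM : {morph psi : x y / x * y}.
Hypothesis phiK : cancel phi psi.
Hypothesis psiK : cancel psi phi.

Variables (a b : gV G) (L' : {set gV G'}).
Hypothesis ab : gadj a b.
Hypothesis b1 : valence b == 1%N.
Hypothesis meven : ~~ odd (glab a b).
Hypothesis m3 : (2 < glab a b)%N.
Hypothesis cL' : big_chunk L'.
Local Notation L := [set a; b].
Variable g : A'.
Hypothesis gL : forall x, std L' (g^-1 * x * g) <-> exists2 y, std L y & x = phi y.

Let cL : big_chunk L := leaf_is_chunk connG ab b1.
Let nab : a != b. Proof. exact: (gadj_neq ab). Qed.

Let back y := psi (g * y * g^-1).
Let fwd x := g^-1 * phi x * g.

Let backM : {morph back : x y / x * y}.
Proof. by move=> x y; rewrite /back -psiM; congr psi; rewrite !mulgA mulgVK. Qed.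
Let backK : cancel back fwd.
Proof. by move=> y; rewrite /fwd /back psiK !mulgA mulVg mul1g mulgVK. Qed.
Let fwdK : cancel fwd back.
Proof. by move=> x; rewrite /fwd /back !mulgA mulgV mul1g mulgK phiK. Qed.
Let back_inj : injective back := can_inj backK.
Let back_std y : std L' y -> std L (back y).
Proof.
move=> yL; have [|x xL e] := (gL (g * y * g^-1)).1; first by rewrite !mulgA mulVg mul1g mulgVK.
by rewrite /back e phiK.
Qed.
Let fwd_std x : std L x -> std L' (fwd x).
Proof. by move=> xL; apply/gL; exists x. Qed.

Let back_cyc c u v : cyc c (back (agen u)) -> cyc c (back (agen v)) -> u = v.
Proof.
have fM : {morph fwd : x y / x * y} by move=> x y; rewrite /fwd phiM !mulgA mulgK.
move=> [i ei] [j ej]; apply: (@agen_cyclic G' u v (fwd c)); [exists i|exists j].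
  by rewrite -(morZ fM) -ei backK.
by rewrite -(morZ fM) -ej backK.
Qed.

Let center_rank3 h c1 c2 c3 : std L h -> std L c1 -> std L c2 -> std L c3 ->
  commute h c1 -> commute h c2 -> commute h c3 ->
  (forall i j k, zexp c1 i * zexp c2 j * zexp c3 k = 1 -> [/\ i = 0, j = 0 & k = 0]%R) ->
  cyc (edge_center a b) h.
Proof. exact: (edge_rank3 connG ab cL). Qed.

(** If every vertex of [L'] had two neighbours in [L'], each generator would have three independent
    centralizing elements inside [A_L']; all of them would pull back into the cyclic group of the
    edge centre. *)
Let target_edge : exists c d, gadj c d /\ L' = [set c; d].
Proof.
case: (chunk_cases connG' cL') => [[v [_ all]]|//|br].
  have cy := singleton_cyclic all.
  by case: (phi_noncyclic psiM phiK nab (cy (phi (agen a))) (cy (phi (agen b)))).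
have cz v : v \in L' -> cyc (edge_center a b) (back (agen v)).
  move=> vL; have [u [w [uL wL vu vw uw]]] := br v vL.
  have sL := std_subgroup L'.
  have uS := std_gen uL; have vS := std_gen vL; have wS := std_gen wL.
  have bc x y : commute x y -> commute (back x) (back y).
    by move=> e; rewrite /commute -!backM e.
  apply: (@center_rank3 _ (back (agen v ^+ 2)) (back (zc v u)) (back (zc v w))).
  - exact: back_std.
  - by apply: back_std; apply: subgX.
  - by apply: back_std; apply: subgX => //; apply: (subgM sL).
  - by apply: back_std; apply: subgX => //; apply: (subgM sL).
  - by apply: bc; exact: commuteX.
  - by apply: bc; apply: commute_sym; case: (zc_commute vu).
  - by apply: bc; apply: commute_sym; case: (zc_commute vw).
  move=> i j k; rewrite -!(morZ backM) -!backM -(mor1 backM) => /back_inj.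
  exact: independent.
have /set0Pn [v vL] := (big_chunk_biconn cL').1.1.
have [u [_ [uL _ vu _ _]]] := br v vL.
by move: vu; rewrite (back_cyc (cz v vL) (cz u uL)) gadj_irr.
Qed.

Let std_back_ind (S : A -> Prop) : subgroup S -> (forall v, v \in L' -> S (back (agen v))) ->
  forall x, std L x -> S x.
Proof.
move=> sS Sv x xL; rewrite -[x]fwdK; have := fwd_std xL; move: (fwd x).
apply: std_ind => //; split; first by rewrite (mor1 backM); exact: (subg1 sS).
  by move=> u v Su Sv'; rewrite backM; exact: (subgM sS).
by move=> u Su; rewrite (morV backM); exact: (subgV sS).
Qed.

(** The only edge at [b] has an even label, so no relation ties the weight of [b] to the weights of
    the other vertices. *)
Let leaf_weight (p q : int) : exists w : A -> int,
  [/\ forall x y, w (x * y) = (w x + w y)%R, w (agen a) = p & w (agen b) = q].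
Proof.
have [u v uv mo|w [wM wv]] := @weight_exists _ (@gadj G) (@glab G) (fun v => if v == b then q else p).
  have [eu|nu] := eqVneq u b; have [ev|nv] := eqVneq v b => //.
    move: meven; rewrite (glab_sym ab) -eu -(leaf_neighbor ab b1 (_ : gadj b v)) ?mo //.
    by rewrite -eu.
  move: meven; rewrite -ev -(leaf_neighbor ab b1 (_ : gadj b u)) ?mo //.
  by rewrite -ev gadj_sym.
by exists w; rewrite !wv eqxx (negPf nab).
Qed.

Lemma even_leaf_image : even_leaf L'.
Proof.
have [c [d [cd eL']]] := target_edge.
have cS : c \in L' by rewrite eL' set21.
have dS : d \in L' by rewrite eL' set22.
have sL := std_subgroup L.
have aS : std L (agen a) by apply: std_gen; exact: set21.
have bS : std L (agen b) by apply: std_gen; exact: set22.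
have [w [wM wa wb]] := leaf_weight 0%R 1%R.
exists c, d; split=> //; last first.
  (* With an odd label the pulled-back generators are conjugate, so any two weights are proportional
     on [A_L]; the exponents of [a] and of [b] are not. *)
  apply/negP => mo; have [k ek] := odd_conj cd mo.
  have [w' [w'M w'a w'b]] := leaf_weight 1%R 0%R.
  have ce (u : A -> int) : (forall x y, u (x * y) = (u x + u y)%R) ->
      u (back (agen d)) = u (back (agen c)).
    by move=> uM; rewrite ek !backM (morV backM) (addJ uM).
  set h := back (agen c) in ce.
  have comb x : std L x -> (w h * w' x = w' h * w x)%R.
    move: x; apply: std_back_ind.
      split; first by rewrite (add1 wM) (add1 w'M) !GRing.mulr0.
        by move=> x y ex ey; rewrite wM w'M !GRing.mulrDr ex ey.
      by move=> x ex; rewrite (addV wM) (addV w'M) !GRing.mulrN ex.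
    move=> v; rewrite eL' => /set2P[] ->; first by rewrite GRing.mulrC.
    by rewrite (ce w wM) (ce w' w'M) GRing.mulrC.
  have := comb _ aS; have := comb _ bS; rewrite wa wb w'a w'b !GRing.mulr1 !GRing.mulr0 => _ wh.
  have : w (agen b) = 0%R.
    move: bS; move: (agen b : A); apply: std_back_ind.
      split; first exact: add1.
        by move=> x y ex ey; rewrite wM ex ey.
      by move=> x ex; rewrite (addV wM) ex.
    by move=> v; rewrite eL' => /set2P[] ->; rewrite ?(ce w wM).
  by rewrite wb.
(* If both [c] and [d] were branching, each would pull back to a conjugate of a power of [a] or to a
   power of the edge centre. The exponent of [b] would be a multiple of [dih_k] on all of [A_L],
   although it is 1 on [b]. *)
apply: contraT; rewrite negb_or => /andP[nc nd]; exfalso.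
have dc : gadj d c by rewrite gadj_sym.
have br v : v \in L' -> branching v.
  by rewrite eL' => /set2P[] ->; [apply/(branchingP cd)|apply/(branchingP dc)].
have div v : v \in L' -> (Posz (dih_k (glab a b)) %| w (back (agen v)))%Z.
  move=> vL; have hL := back_std (std_gen vL); have bv := br v vL.
  have := @std_dichotomy G connG L 1 (back (agen v)) cL; rewrite invg1 mul1g mulg1 => /(_ hL) [].
    move=> [u [k [M [uL kL [cM uM] ML [j]]]]]; rewrite mul1g => e.
    have ua : u = a.
      by case/set2P: uL => // ub; case: ML; apply: (leaf_chunk connG ab b1 cM); rewrite -ub.
    have : w (k^-1 * back (agen v) * k) = 0%R by rewrite e (addZ wM) ua wa GRing.mul0r.
    rewrite !wM (addV wM) => we; have -> : w (back (agen v)) = 0%R by move: we; clear; lia.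
    exact: dvdz0.
  move=> cent; have cent' x : commute (back (agen v)) x -> std L x.
    by move=> /cent; rewrite mul1g mulg1.
  have [c1 [c2 [c3 [h1 h2 h3 ind]]]] := rank3_mor backM back_inj (branching_rank3 bv).
  have [t ->] := center_rank3 hL (cent' _ h1) (cent' _ h2) (cent' _ h3) h1 h2 h3 ind.
  rewrite (addZ wM) /edge_center (addX wM) wM wa wb GRing.add0r GRing.mul1r.
  exact: dvdz_mulr.
have : (Posz (dih_k (glab a b)) %| w (agen b))%Z.
  move: bS; move: (agen b : A); apply: std_back_ind div.
  split; first by rewrite (add1 wM); exact: dvdz0.
    by move=> x y dx dy; rewrite wM; exact: GRing.rpredD.
  by move=> x dx; rewrite (addV wM) GRing.rpredN.
by rewrite wb dvdz1 absz_nat; have := dih_k_gt1 m3; case: (dih_k _) => [|[]].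
Qed.

End EvenLeaf.

(** * Toral leaves *)

Section ToralLeaves.
Variable G : lgraph.
Notation V := (gV G).
Notation A := (artin G).
Hypothesis connG : connected_graph G.
Hypothesis nontriv : exists u v : V, u != v.

Lemma chunk_edge (L : {set V}) : big_chunk L -> exists a b, [/\ gadj a b, a \in L & b \in L].
Proof.
move=> cL; have /set0Pn [v vL] := (big_chunk_biconn cL).1.1.
have [all|[u uL vu]] := chunk_neighbor connG cL vL; last by exists v, u.
by have [x [y]] := nontriv; rewrite (all x) (all y) eqxx.
Qed.

Definition toral_leaves : {set {set V}} := [set L | `[< big_chunk L /\ toral_leaf L >]].
Definition nontoral_part : {set V} :=
  [set v | `[< exists L : {set V}, [/\ big_chunk L, ~ toral_leaf L & v \in L] >]].
Local Notation U := nontoral_part.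

Lemma toral_leavesP (L : {set V}) : reflect (big_chunk L /\ toral_leaf L) (L \in toral_leaves).
Proof. by rewrite inE; apply: asboolP. Qed.

Lemma nontoral_partP v : reflect (exists L : {set V}, [/\ big_chunk L, ~ toral_leaf L & v \in L]) (v \in U).
Proof. by rewrite inE; apply: asboolP. Qed.

Lemma toral_chunk v (L : {set V}) : v \notin U -> big_chunk L -> v \in L -> toral_leaf L.
Proof. by move=> vU cL vL; apply: contrapT => tL; case/nontoral_partP: vU; exists L. Qed.

Lemma toral_leaf_ends (L : {set V}) : toral_leaf L -> exists a b,
  [/\ gadj a b, L = [set a; b], valence b == 1%N & glab a b = 2].
Proof.
move=> [a [b [ab eL /orP[a1|b1] m2]]]; last by exists a, b.
by exists b, a; split; rewrite // ?(gadj_sym b) // -?(glab_sym ab) // setUC.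
Qed.

Lemma toral_edge (L : {set V}) u v : toral_leaf L -> gadj u v -> u \in L -> v \in L ->
  [/\ L = [set u; v], glab u v = 2 & (valence u == 1%N) || (valence v == 1%N)].
Proof.
move=> [a [b [ab -> lf m2]]] uv /set2P[] eu /set2P[] ev; subst u v;
  rewrite ?gadj_irr // in uv *; split=> //.
- by rewrite setUC.
- by rewrite -(glab_sym ab).
- by rewrite orbC.
Qed.

(** Every edge at [v] is a toral leaf, and its end of valence one is not [v]; hence the whole graph
    is a star around [v]. *)
Lemma star_center v : v \notin U -> branching v -> forall M, big_chunk M -> v \in M.
Proof.
move=> vU bv M cM.
have Q : forall x : V, x = v \/ (gadj v x /\ valence x == 1%N).
  apply: (connG_ind connG (x := v)); first by left.
  have nb u : gadj v u -> valence u == 1%N.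
    move=> vu; have [N cN /andP[vN uN]] := edge_chunk vu.
    have [_ _ /orP[v1|//]] := toral_edge (toral_chunk vU cN vN) vu vN uN.
    by move/(branchingP vu): bv; rewrite v1.
  move=> x y xy [ex|[vx x1]]; first by right; rewrite -ex; rewrite ex in xy *; split=> //; exact: nb.
  by left; exact: (leaf_neighbor vx x1 xy).
have /set0Pn [z zM] := (big_chunk_biconn cM).1.1.
case: (Q z) => [<- //|[vz z1]].
by rewrite (leaf_chunk connG vz z1 cM zM) set21.
Qed.

Lemma chunk_of_ex (v : V) : exists L : {set V}, big_chunk L /\ v \in L.
Proof. by have [L cL vL] := vertex_chunk v; exists L. Qed.

Lemma exists_neighbor (v : V) : exists u : V, gadj v u.
Proof.
have [L [cL vL]] := chunk_of_ex v.
have [all|[u uL vu]] := chunk_neighbor connG cL vL; last by exists u.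
by have [x [y]] := nontriv; rewrite (all x) (all y) eqxx.
Qed.

Lemma not_branching_leaf (v u : V) : gadj u v -> ~ branching v -> valence v == 1%N.
Proof.
move=> uv nb; apply: contraT => v1; case: nb; apply/(@branchingP _ _ u) => //.
by rewrite gadj_sym.
Qed.

Lemma two_leaves (u v : V) : gadj u v -> valence u == 1%N -> valence v == 1%N ->
  forall x, x = u \/ x = v.
Proof.
move=> uv u1 v1; apply: (connG_ind connG (x := u)); first by left.
have vu : gadj v u by rewrite gadj_sym.
move=> x y xy [] ex; rewrite ex in xy; first by right; exact: (leaf_neighbor vu u1 xy).
by left; exact: leaf_neighbor uv v1 xy.
Qed.

(** A vertex outside [U] has valence one, for otherwise it would lie in every chunk. So each toral
    leaf contributes its tip, and no more: with two tips it would be the whole graph. *)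
Lemma card_toral_leaves : U != set0 -> #|toral_leaves| = #|~: U|.
Proof.
move=> U0; have [ch chP] := choice chunk_of_ex.
have val1 v : v \notin U -> valence v == 1%N.
  move=> vU; have [u vu] := exists_neighbor v; apply: (@not_branching_leaf _ u).
    by rewrite gadj_sym.
  move=> bv; have /set0Pn [x /nontoral_partP [L [cL ntL xL]]] := U0.
  by have vL := star_center vU bv cL; case/nontoral_partP: vU; exists L.
have e : toral_leaves = ch @: (~: U).
  apply/setP => L; apply/toral_leavesP/imsetP => [[cL tL]|[v + ->]].
    have [a [b [ab eL b1 m2]]] := toral_leaf_ends tL.
    have bL M : big_chunk M -> b \in M -> M = L.
      by move=> cM bM; rewrite eL; exact: (leaf_chunk connG ab b1 cM bM).
    exists b; last by case: (chP b) => c /bL ->.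
    rewrite in_setC; apply/nontoral_partP => -[M [cM ntM bM]].
    by apply: ntM; rewrite (bL M cM bM).
  by rewrite inE => vU; case: (chP v) => cv vv; split=> //; exact: toral_chunk vU cv vv.
rewrite e card_in_imset // => u v; rewrite !in_setC => uU vU euv.
have [w uw] := exists_neighbor u; have wu : gadj w u by rewrite gadj_sym.
have [cu uu] := chP u; have [cv vv] := chP v.
have eu := leaf_chunk connG wu (val1 u uU) cu uu.
apply/eqP; apply: contraT => nuv.
have vw : v = w.
  by move: vv; rewrite -euv eu => /set2P[] // vu; rewrite vu eqxx in nuv.
subst w; have all := two_leaves uw (val1 u uU) (val1 v vU).
have /set0Pn [x xU] := U0; case: (all x) => ex; rewrite ex in xU; first by rewrite xU in uU.
by rewrite xU in vU.
Qed.

(** When all chunks are toral leaves the graph is a star, and its centre is counted besides the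
    tips. *)
Lemma card_toral_star : U = set0 -> #|toral_leaves|.+1 = #|~: U|.
Proof.
move=> U0; have [ch chP] := choice chunk_of_ex.
have noU v : v \notin U by rewrite U0 inE.
have [c cc] : exists c : V, forall M : {set V}, big_chunk M -> c \in M.
  have [[v bv]|nb] := pselect (exists v : V, branching v).
    by exists v => M; exact: star_center.
  have [v0 _] := nontriv; have [u vu] := exists_neighbor v0.
  have uv : gadj u v0 by rewrite gadj_sym.
  have leaf (x y : V) : gadj x y -> valence y == 1%N.
    by move=> xy; apply: (not_branching_leaf xy) => bx; apply: nb; exists y.
  have all := two_leaves vu (leaf _ _ uv) (leaf _ _ vu).
  exists v0 => M cM; have /set0Pn [z zM] := (big_chunk_biconn cM).1.1.
  case: (all z) => ez; rewrite ez in zM => //.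
  by rewrite (leaf_chunk connG vu (leaf _ _ vu) cM zM) set21.
have cE v : v != c -> ch v = [set c; v].
  move=> vc; have [cv vv] := chP v; have [a [b [_ eL _ _]]] := toral_leaf_ends (toral_chunk (noU v) cv vv).
  have := cc _ cv; move: vv; rewrite eL => /set2P[] ev /set2P[] ec; rewrite -?ev -?ec //.
  - by rewrite ev ec eqxx in vc.
  - by rewrite setUC.
  - by rewrite ev ec eqxx in vc.
have e : toral_leaves = ch @: (~: [set c]).
  apply/setP => L; apply/toral_leavesP/imsetP => [[cL tL]|[v _ ->]]; last first.
    by case: (chP v) => cv vv; split=> //; exact: toral_chunk (noU v) cv vv.
  have [a [b [aL bL ab]]] : exists a b, [/\ a \in L, b \in L & a != b].
    have [a [b [ab aL bL]]] := chunk_edge cL; exists a, b; split=> //.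
    exact: (gadj_neq ab).
  have [v vL vc] : exists2 v, v \in L & v != c.
    by have [e|ne] := eqVneq a c; [exists b; rewrite // -e eq_sym|exists a].
  exists v; first by rewrite !inE.
  have [cv vv] := chP v.
  by apply: (@chunk_meet _ _ _ v c) => //; exact: cc.
rewrite e card_in_imset; last first.
  move=> u v; rewrite !inE => uc vc; rewrite !cE // => /setP /(_ u).
  by rewrite !inE eqxx orbT (negPf uc) /= => /esym/eqP.
by rewrite U0 setC0 cardsCs setCK cards1 cardsT subn1 prednK //; apply/card_gt0P; exists c.
Qed.

(* The homomorphisms to [Z/2] that vanish on the subgroups of nontoral chunks;
   counting them recovers the number of toral leaves from the group. *)
Definition odd_invariant (chi : {ffun V -> bool}) :=
  forall a b : V, gadj a b -> odd (glab a b) -> chi a = chi b.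

Definition killing : {set {ffun V -> bool}} :=
  [set chi : {ffun V -> bool} | `[< odd_invariant chi /\ forall v, v \in U -> chi v = false >]].

(** An edge with an odd label lies in a nontoral chunk, so invariance follows from vanishing on [U],
    and the values outside [U] are free. *)
Lemma card_killing : #|killing| = (2 ^ #|~: U|)%N.
Proof.
rewrite -[2%N]card_bool -(card_pffun_on false).
apply: eq_card => chi; rewrite [LHS]inE; apply/asboolP/pffun_onP => [[_ kU]|[/subsetP sU _]].
  split=> //; apply/subsetP => v cv; rewrite in_setC; apply/negP => vU.
  by move: cv; rewrite inE (kU v vU).
have kU v : v \in U -> chi v = false.
  move=> vU; apply/negbTE/negP => cv; have := sU v; rewrite in_setC vU inE cv.
  by move=> /(_ isT).
split=> // a b ab mo; have [M cM /andP[aM bM]] := edge_chunk ab.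
have ntM : ~ toral_leaf M by move=> tM; have [_ m2 _] := toral_edge tM ab aM bM; rewrite m2 in mo.
by rewrite !kU //; apply/nontoral_partP; exists M.
Qed.

Lemma parity_hom (chi : {ffun V -> bool}) : odd_invariant chi -> exists h : A -> bool,
  (forall x y, h (x * y) = h x (+) h y) /\ forall v, h (agen v) = chi v.
Proof.
move=> oi; have [a b ab mo|w [wM wv]] := @weight_exists _ (@gadj G) (@glab G) (fun v => Posz (chi v)).
  by rewrite (oi a b).
exists (fun x => odd `|w x|%N); split=> [x y|v]; first by rewrite wM; lia.
by rewrite wv absz_nat; case: (chi v).
Qed.

End ToralLeaves.

(** * Matching chunks *)

Section OneDirection.
Variables G G' : lgraph.
Notation A := (artin G).
Notation A' := (artin G').
Hypothesis connG : connected_graph G.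
Hypothesis connG' : connected_graph G'.
Hypothesis nontriv : exists u v : gV G, u != v.
Variables (phi : A -> A') (psi : A' -> A).
Hypothesis phiM : {morph phi : x y / x * y}.
Hypothesis psiM : {morph psi : x y / x * y}.
Hypothesis phiK : cancel phi psi.
Hypothesis psiK : cancel psi phi.

Lemma nontriv_target : exists u v : gV G', u != v.
Proof.
apply: contrapT => tr; have [u [v uv]] := nontriv.
have /set0Pn [w _] := connG'.1.
have all x : x = w by apply/eqP; apply: contrapT => /negP xw; apply: tr; exists x, w.
have cy := singleton_cyclic all.
exact: (phi_noncyclic psiM phiK uv (cy (phi (agen u))) (cy (phi (agen v)))).
Qed.

Lemma nontoral_maps_into (L : {set gV G}) : big_chunk L -> ~ toral_leaf L ->
  exists L', [/\ big_chunk L', ~ toral_leaf L' & maps_into phi L L'].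
Proof.
move=> cL ntL; have [a [b [ab aL bL]]] := chunk_edge connG nontriv cL.
have [L' cL' m] := chunk_maps_into connG connG' phiM psiM phiK psiK cL ntL ab aL bL.
exists L'; split=> //.
exact: (maps_into_not_toral connG connG' phiM psiM phiK ab aL bL cL ntL cL' m).
Qed.

Lemma nontoral_part_neq0 : nontoral_part G != set0 -> nontoral_part G' != set0.
Proof.
move=> /set0Pn [v /nontoral_partP [L [cL ntL _]]].
have [L' [cL' ntL' _]] := nontoral_maps_into cL ntL.
have /set0Pn [w wL'] := (big_chunk_biconn cL').1.1.
by apply/set0Pn; exists w; apply/nontoral_partP; exists L'.
Qed.

(** Homomorphisms are pulled back along [phi]. Vanishing on nontoral chunks is kept because these
    are mapped into conjugates of nontoral chunk groups, and the pullback is injective because [phi]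
    is onto. *)
Lemma card_killing_le : (#|killing G'| <= #|killing G|)%N.
Proof.
have exH (chi : {ffun gV G' -> bool}) : exists h : A' -> bool, odd_invariant chi ->
    (forall x y, h (x * y) = h x (+) h y) /\ forall v, h (agen v) = chi v.
  have [oi|no] := pselect (odd_invariant chi); last by exists (fun=> false).
  by have [h hP] := parity_hom oi; exists h.
have [H HP] := choice exH.
pose f (chi : {ffun gV G' -> bool}) : {ffun gV G -> bool} := [ffun v => H chi (phi (agen v))].
have h1 (B : groupType) (h : B -> bool) : (forall x y, h (x * y) = h x (+) h y) -> h 1 = false.
  by move=> hM; have := hM 1 1; rewrite mulg1 addbb.
have hJ (B : groupType) (h : B -> bool) : (forall x y, h (x * y) = h x (+) h y) ->
    forall x g, h (g * x * g^-1) = h x.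
  move=> hM x g; have := hM g g^-1; rewrite mulgV (h1 _ _ hM) !hM.
  by case: (h g); case: (h g^-1); case: (h x).
have fk chi : chi \in killing G' -> f chi \in killing G.
  rewrite inE => /asboolP [oi kU]; have [hM hv] := HP chi oi.
  rewrite inE; apply/asboolP; split=> [a b ab mo|v /nontoral_partP [L [cL ntL vL]]]; rewrite !ffunE.
    by have [k ->] := odd_conj ab mo; rewrite !phiM (morV phiM) hJ.
  have [L' [cL' ntL' [g m]]] := nontoral_maps_into cL ntL.
  have -> : phi (agen v) = g * (g^-1 * phi (agen v) * g) * g^-1.
    by rewrite !mulgA mulgV mul1g mulgK.
  rewrite hJ //; move: (m _ (std_gen vL)); move: (_ * g); apply: std_ind.
    split; first exact: h1.
      by move=> x y hx hy; rewrite hM hx hy.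
    by move=> x hx; have := hM x x^-1; rewrite mulgV h1 // hx.
  by move=> w wL'; rewrite hv; apply: kU; apply/nontoral_partP; exists L'.
have fI : {in killing G' &, injective f}.
  move=> c1 c2; rewrite !inE => /asboolP [oi1 _] /asboolP [oi2 _] e.
  have [hM1 hv1] := HP c1 oi1; have [hM2 hv2] := HP c2 oi2.
  have ev v : H c1 (phi (agen v)) = H c2 (phi (agen v)).
    by have := congr1 (fun c : {ffun _ -> _} => c v) e; rewrite !ffunE.
  have hV (h : A' -> bool) : (forall x y, h (x * y) = h x (+) h y) -> forall x, h x^-1 = h x.
    by move=> hM x; have := hM x x^-1; rewrite mulgV (h1 _ _ hM); case: (h x); case: (h x^-1).
  have all x : H c1 (phi x) = H c2 (phi x).
    elim/art_ind: x => [|v x IH|v x IH]; first by rewrite (mor1 phiM) !h1.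
      by rewrite phiM hM1 hM2 ev IH.
    by rewrite phiM (morV phiM) hM1 hM2 !hV // ev IH.
  by apply/ffunP => v; rewrite -hv1 -hv2 -[agen v : A']psiK all.
rewrite -(card_in_imset fI); apply: subset_leq_card.
by apply/subsetP => _ /imsetP [chi ck ->]; exact: fk.
Qed.

Lemma even_leaf_transfer (L : {set gV G}) (L' : {set gV G'}) : big_chunk L' ->
  even_leaf L -> ~ toral_leaf L -> conj_onto phi L L' -> even_leaf L'.
Proof.
move=> cL' [a [b [ab eL lf me]]] ntL [g gL].
have key x y : gadj x y -> L = [set x; y] -> valence y == 1%N ->
    ~~ odd (glab x y) -> even_leaf L'.
  move=> xy eL' y1 me'; have m3 : (2 < glab x y)%N.
    rewrite ltn_neqAle glab_ge2 // andbT; apply/eqP => m2; apply: ntL.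
    by exists x, y; rewrite y1 orbT.
  have gL' := gL; rewrite eL' in gL'.
  exact: (even_leaf_image connG connG' phiM psiM phiK psiK xy y1 me' m3 cL' gL').
case/orP: lf => v1; last exact: (key a b).
by apply: (key b a) => //; rewrite ?(gadj_sym b) // -?(glab_sym ab) // eL setUC.
Qed.

Lemma gens_maps_into (L : {set gV G}) : big_chunk L ->
  (forall v, exists g v', phi (agen v) = g * agen v' * g^-1) ->
  exists2 L', big_chunk L' & maps_into phi L L'.
Proof.
move=> cL gg; have [a [b [ab aL bL]]] := chunk_edge connG nontriv cL.
apply: (elliptic_maps_into connG' phiM psiM phiK (big_chunk_biconn cL) ab aL bL) => v _.
by right.
Qed.

(* The vertices conjugate to a given [v'] are a union of odd components, whose
   characteristic function is a homomorphism to [Z]. *)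
Lemma gens_inverse : (forall v, exists g v', phi (agen v) = g * agen v' * g^-1) ->
  forall v' : gV G', exists g v, psi (agen v') = g * agen v * g^-1.
Proof.
move=> gg v'; pose isc (u : gV G') := `[< exists k : A', agen u = k * agen v' * k^-1 >].
have [a b ab mo|w [wM wv]] := @weight_exists _ (@gadj G') (@glab G') (fun u => Posz (isc u)).
  congr (Posz (nat_of_bool _)); apply: asbool_equiv_eq.
  have [k ek] := odd_conj ab mo; split=> -[j ej].
    by exists (k * j); rewrite ek ej invgM !mulgA.
  exists (k^-1 * j); have -> : agen a = k^-1 * agen b * k.
    by rewrite ek !mulgA mulVg mul1g mulgVK.
  by rewrite ej invgM invgK !mulgA.
apply: contrapT => nv.
have w0 v : w (phi (agen v)) = 0%R.
  have [g [u e]] := gg v; rewrite e (addJ wM) wv /isc.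
  case: asboolP => // -[k ek]; case: nv; exists (psi (g * k)^-1), v.
  rewrite -[agen v]phiK -(morV psiM) -!psiM e ek; congr psi.
  have -> : g * (k * agen v' * k^-1) * g^-1 = (g * k) * agen v' * (g * k)^-1 by rewrite invgM !mulgA.
  by move: (g * k) => z; rewrite invgK !mulgA mulVg mul1g mulgVK.
have w1 x : w x = 0%R.
  rewrite -[x]psiK; move: (psi x) => {}x; elim/art_ind: x => [|v x IH|v x IH].
  - by rewrite (mor1 phiM) (add1 wM).
  - by rewrite phiM wM IH w0.
  - by rewrite phiM wM IH (morV phiM) (addV wM) w0.
have := wv v'; rewrite w1 /isc; case: asboolP => // -[]; exists 1.
by rewrite mul1g invg1 mulg1.
Qed.

End OneDirection.

(** [P] and [P'] express being nontoral in the first half of the theorem and are trivial in the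
    second. [maps_into_onto], applied to the round trip, shows that the choices made backwards
    invert those made forwards. *)
Lemma back_and_forth (G G' : lgraph) (phi : artin G -> artin G') (psi : artin G' -> artin G)
    (P : {set gV G} -> Prop) (P' : {set gV G'} -> Prop) :
  connected_graph G -> connected_graph G' -> (exists u v : gV G, u != v) ->
  {morph phi : x y / x * y} -> {morph psi : x y / x * y} -> cancel phi psi -> cancel psi phi ->
  (forall L, big_chunk L -> P L -> exists L', [/\ big_chunk L', P' L' & maps_into phi L L']) ->
  (forall L, big_chunk L -> P' L -> exists L', [/\ big_chunk L', P L' & maps_into psi L L']) ->
  exists F F', forall L, big_chunk L -> P L ->
    [/\ big_chunk (F L), P' (F L), maps_into phi L (F L), conj_onto phi L (F L) & F' (F L) = L].
Proof.
move=> connG connG' nt phiM psiM phiK psiK fP bP.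
have exF L : exists L', big_chunk L -> P L -> [/\ big_chunk L', P' L' & maps_into phi L L'].
  have [[cL PL]|n] := pselect (big_chunk L /\ P L); last by exists set0 => cL PL; case: n.
  by have [L' h] := fP L cL PL; exists L'.
have exF' L : exists L', big_chunk L -> P' L -> [/\ big_chunk L', P L' & maps_into psi L L'].
  have [[cL PL]|n] := pselect (big_chunk L /\ P' L); last by exists set0 => cL PL; case: n.
  by have [L' h] := bP L cL PL; exists L'.
have [F FP] := choice exF; have [F' FP'] := choice exF'.
exists F, F' => L cL PL; have [c1 p1 m1] := FP L cL PL; have [c2 p2 m2] := FP' _ c1 p1.
have [a [b [ab aL bL]]] := chunk_edge connG nt cL.
have nab := gadj_neq ab.
by have [] := maps_into_onto connG psiM phiK psiK nab aL bL cL c2 m1 m2.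
Qed.

Section BothDirections.
Variables G G' : lgraph.
Notation A := (artin G).
Notation A' := (artin G').
Hypothesis connG : connected_graph G.
Hypothesis connG' : connected_graph G'.
Hypothesis nontriv : exists u v : gV G, u != v.
Variables (phi : A -> A') (psi : A' -> A).
Hypothesis phiM : {morph phi : x y / x * y}.
Hypothesis psiM : {morph psi : x y / x * y}.
Hypothesis phiK : cancel phi psi.
Hypothesis psiK : cancel psi phi.

Let nontriv' := nontriv_target connG' nontriv psiM phiK.

(** The isomorphism preserves the cardinal of [killing], hence the number of vertices outside the
    nontoral part. Stars, where this number exceeds that of the leaves by one, correspond to each
    other because emptiness of the nontoral part is preserved too. *)
Lemma card_toral_leaves_eq : #|toral_leaves G| = #|toral_leaves G'|.
Proof.
have e : #|~: nontoral_part G| = #|~: nontoral_part G'|.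
  have le1 := card_killing_le connG connG' nontriv phiM psiM phiK psiK.
  have le2 := card_killing_le connG' connG nontriv' psiM phiM psiK phiK.
  apply/eqP; rewrite -(@eqn_exp2l 2) // -!card_killing eqn_leq le1 andbT //.
have [U0|U0] := eqVneq (nontoral_part G) set0.
  have U0' : nontoral_part G' = set0.
    apply/eqP; apply: contraTT isT => /(nontoral_part_neq0 connG' connG nontriv' psiM phiM psiK phiK).
    by rewrite U0 eqxx.
  by apply: succn_inj; rewrite !card_toral_star.
by rewrite !card_toral_leaves // (nontoral_part_neq0 connG connG' nontriv phiM psiM phiK psiK).
Qed.

Lemma nontoral_match : exists F F', forall L, big_chunk L -> ~ toral_leaf L ->
  [/\ big_chunk (F L), ~ toral_leaf (F L), maps_into phi L (F L), conj_onto phi L (F L) & F' (F L) = L].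
Proof.
apply: (back_and_forth (P := fun L => ~ toral_leaf L) (P' := fun L => ~ toral_leaf L)
  connG connG' nontriv phiM psiM phiK psiK) => L.
  exact: (nontoral_maps_into connG connG' nontriv phiM psiM phiK psiK).
exact: (nontoral_maps_into connG' connG nontriv' psiM phiM psiK phiK).
Qed.

End BothDirections.

Lemma toral_even (G : lgraph) (L : {set gV G}) : toral_leaf L -> even_leaf L.
Proof. by move=> [a [b [ab eL lf m2]]]; exists a, b; rewrite m2. Qed.

Section Matching.
Variables G G' : lgraph.
Notation A := (artin G).
Notation A' := (artin G').
Hypothesis connG : connected_graph G.
Hypothesis connG' : connected_graph G'.
Hypothesis nontriv : exists u v : gV G, u != v.
Variables (phi : A -> A') (psi : A' -> A).
Hypothesis phiM : {morph phi : x y / x * y}.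
Hypothesis psiM : {morph psi : x y / x * y}.
Hypothesis phiK : cancel phi psi.
Hypothesis psiK : cancel psi phi.

Let nontriv' := nontriv_target connG' nontriv psiM phiK.

Lemma chunk_matching : exists f : {set gV G} -> {set gV G'}, bc_bijection f /\
  forall L, big_chunk L -> [/\ ~ toral_leaf L -> conj_onto phi L (f L),
    toral_leaf L -> toral_leaf (f L) & even_leaf L -> even_leaf (f L)].
Proof.
have [F [F0 FP]] := nontoral_match connG connG' nontriv phiM psiM phiK psiK.
have [F' [F0' FP']] := nontoral_match connG' connG nontriv' psiM phiM psiK phiK.
have inv L : big_chunk L -> ~ toral_leaf L -> F' (F L) = L.
  move=> cL ntL; have [c1 n1 m1 _ _] := FP L cL ntL; have [c2 n2 m2 _ _] := FP' _ c1 n1.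
  have [a [b [ab aL bL]]] := chunk_edge connG nontriv cL.
  have nab := gadj_neq ab.
  by have [] := maps_into_onto connG psiM phiK psiK nab aL bL cL c2 m1 m2.
have inv' L : big_chunk L -> ~ toral_leaf L -> F (F' L) = L.
  move=> cL ntL; have [c1 n1 m1 _ _] := FP' L cL ntL; have [c2 n2 m2 _ _] := FP _ c1 n1.
  have [a [b [ab aL bL]]] := chunk_edge connG' nontriv' cL.
  have nab := gadj_neq ab.
  by have [] := maps_into_onto connG' phiM psiK phiK nab aL bL cL c2 m1 m2.
have ct := card_toral_leaves_eq connG connG' nontriv phiM psiM phiK psiK.
pose tl := enum (toral_leaves G); pose tl' := enum (toral_leaves G').
have szt : size tl = size tl' by rewrite -!cardE.
(* All toral leaves have isomorphic groups, so any bijection between them will do; they are paired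
   in the order of enumeration. *)
pose B L := nth set0 tl' (index L tl).
have Bin L : L \in toral_leaves G -> B L \in toral_leaves G'.
  move=> Lt; rewrite -(mem_enum (toral_leaves G')); apply: mem_nth.
  by rewrite -/tl' -szt index_mem mem_enum.
have BI L1 L2 : L1 \in toral_leaves G -> L2 \in toral_leaves G -> B L1 = B L2 -> L1 = L2.
  move=> t1 t2 /eqP; rewrite nth_uniq ?enum_uniq -?szt ?index_mem ?mem_enum // => /eqP e.
  by rewrite -(nth_index set0 (_ : L1 \in tl)) ?mem_enum // e nth_index // mem_enum.
have BS L' : L' \in toral_leaves G' -> exists2 L, L \in toral_leaves G & B L = L'.
  move=> t'; have i' : (index L' tl' < size tl)%N by rewrite szt index_mem mem_enum.
  exists (nth set0 tl (index L' tl')); first by rewrite -mem_enum mem_nth.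
  by rewrite /B index_uniq ?enum_uniq // nth_index // mem_enum.
pose f L := if L \in toral_leaves G then B L else F L.
have fB L : L \in toral_leaves G -> f L = B L by rewrite /f => ->.
have fF L : big_chunk L -> ~ toral_leaf L -> f L = F L.
  by move=> cL ntL; rewrite /f; case: toral_leavesP => // -[].
have tin H (L : {set gV H}) : big_chunk L -> toral_leaf L -> L \in toral_leaves H.
  by move=> cL tL; apply/toral_leavesP.
exists f; split; first split.
- move=> L cL; have [tL|ntL] := pselect (toral_leaf L).
    by rewrite fB ?tin //; have /toral_leavesP [] := Bin L (tin _ L cL tL).
  by rewrite fF //; case: (FP L cL ntL).
- move=> L1 L2 c1 c2; have [t1|t1] := pselect (toral_leaf L1); have [t2|t2] := pselect (toral_leaf L2).
  + by rewrite !fB ?tin //; apply: BI; exact: tin.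
  + rewrite fB ?tin // fF // => e; have /toral_leavesP [_] := Bin L1 (tin _ L1 c1 t1).
    by rewrite e; case: (FP L2 c2 t2).
  + rewrite fF // fB ?tin // => e; have /toral_leavesP [_] := Bin L2 (tin _ L2 c2 t2).
    by rewrite -e; case: (FP L1 c1 t1).
  + by rewrite !fF // => e; rewrite -(inv L1 c1 t1) e inv.
- move=> L' cL'; have [tL|ntL] := pselect (toral_leaf L').
    have [L tL' e] := BS L' (tin _ L' cL' tL); exists L; last by rewrite fB.
    by have /toral_leavesP [] := tL'.
  by have [c n _ _ _] := FP' L' cL' ntL; exists (F' L') => //; rewrite fF // inv'.
move=> L cL; have [tL|ntL] := pselect (toral_leaf L).
  have /toral_leavesP [_ tB] := Bin L (tin _ L cL tL).
  by rewrite fB ?tin //; split=> // _; exact: toral_even.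
have [c n m o _] := FP L cL ntL; rewrite fF //; split=> // ev.
exact: (even_leaf_transfer connG connG' phiM psiM phiK psiK c ev ntL o).
Qed.

Lemma chunk_matching_gens :
  (forall v, exists g v', phi (agen v) = g * agen v' * g^-1) ->
  exists f : {set gV G} -> {set gV G'}, bc_bijection f /\
  forall L, big_chunk L -> [/\ conj_onto phi L (f L) & even_leaf L -> even_leaf (f L)].
Proof.
move=> gg; have gg' := gens_inverse phiM psiM phiK psiK gg.
have mp L : big_chunk L -> exists L', [/\ big_chunk L', True & maps_into phi L L'].
  move=> cL; have [L' cL' m] := gens_maps_into connG connG' nontriv phiM psiM phiK cL gg.
  by exists L'.
have mp' L : big_chunk L -> exists L', [/\ big_chunk L', True & maps_into psi L L'].
  move=> cL; have [L' cL' m] := gens_maps_into connG' connG nontriv' psiM phiM psiK cL gg'.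
  by exists L'.
have [F [F' FP]] := back_and_forth (P := fun=> True) (P' := fun=> True) connG connG' nontriv
  phiM psiM phiK psiK (fun L cL _ => mp L cL) (fun L cL _ => mp' L cL).
exists F; split; first split.
- by move=> L cL; case: (FP L cL I).
- move=> L1 L2 c1 c2 e; have [_ _ _ _ <-] := FP L1 c1 I; rewrite e.
  by case: (FP L2 c2 I).
- move=> L' cL'; have [L [cL _ m]] := mp' L' cL'; exists L => //.
  have [c1 _ m1 _ _] := FP L cL I.
  have [a [b [ab aL bL]]] := chunk_edge connG' nontriv' cL'.
  have nab := gadj_neq ab.
  by have [] := maps_into_onto connG' phiM psiK phiK nab aL bL cL' c1 m m1.
move=> L cL; have [c1 _ m1 o _] := FP L cL I; split=> // ev.
have [tL|ntL] := pselect (toral_leaf L); last first.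
  exact: (even_leaf_transfer connG connG' phiM psiM phiK psiK c1 ev ntL o).
have [tF|ntF] := pselect (toral_leaf (F L)); first exact: toral_even.
(* If a toral [L] had a nontoral image, [psi] would carry that image into a nontoral chunk group,
   and the round trip would identify this chunk with [L]. *)
have [L2 [c2 nt2 m2]] := nontoral_maps_into connG' connG nontriv' psiM phiM psiK phiK c1 ntF.
have [a [b [ab aL bL]]] := chunk_edge connG nontriv cL.
have nab := gadj_neq ab.
have [e _] := maps_into_onto connG psiM phiK psiK nab aL bL cL c2 m1 m2.
by case: nt2; rewrite e.
Qed.

End Matching.

(** * Words *)

Definition rename (V W : Type) (r : V -> W) (w : word V) : word W := [seq (r l.1, l.2) | l <- w].

Lemma rename_prodw (V W : Type) (r : V -> W) a b n :
  rename r (prodw a b n) = prodw (r a) (r b) n.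
Proof. by elim: n a b => // n IH a b; rewrite !prodwS /= IH. Qed.

Lemma rename_winv (V W : Type) (r : V -> W) w : rename r (winv w) = winv (rename r w).
Proof. by rewrite /rename /winv map_rev -!map_comp. Qed.

Lemma ext_rename (V W U : Type) (r : W -> U) (f : V -> word W) w :
  ext (fun v => rename r (f v)) w = rename r (ext f w).
Proof.
elim: w => // -[a b] w IH; rewrite /ext /= -/(ext f w) -/(ext (fun v => rename r (f v)) w) IH.
by rewrite [in RHS]/rename map_cat; case: b; rewrite // -rename_winv.
Qed.

Lemma rename_over (V : finType) (r : V -> V) (L : {set V}) w :
  (forall x, r x \in L) -> word_over L (rename r w).
Proof. by move=> rL; rewrite /word_over all_map; apply/allP => l _ /=. Qed.

Lemma rename_id (V : finType) (r : V -> V) (L : {set V}) w :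
  (forall x, x \in L -> r x = x) -> word_over L w -> rename r w = w.
Proof.
move=> rid; elim: w => //= -[a b] w IH /andP[/= aL wL].
by rewrite rid // (IH wL).
Qed.

(* In particular the Artin group of the subgraph induced by [L] embeds in that
   of [G]. *)
Lemma rename_aeq (G : lgraph) (L : {set gV G}) (r : gV G -> gV G) u v :
  (forall x, x \in L -> r x = x) -> vmap_respects r L ->
  Aeq G u v -> aeq (restr_adj (@gadj G) L) (@glab G) (rename r u) (rename r v).
Proof.
move=> rid rR; elim=> {u v}.
- by move=> w; exact: aeq_refl.
- by move=> u v _; exact: aeq_sym.
- by move=> u v w _ uv _; exact: aeq_trans.
- by move=> u u' v v' _ uu _ vv; rewrite /rename !map_cat; exact: aeq_cat.
- by move=> a b; exact: aeq_free.
move=> a b ab; rewrite !rename_prodw; have [->|[aL bL]] := rR a b ab; first exact: aeq_refl.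
by rewrite !rid //; apply: aeq_rel; rewrite /restr_adj ab aL.
Qed.

Lemma cls_ext (G G' : lgraph) (phi : gV G -> word (gV G')) w :
  cls (@gadj G') (@glab G') (ext phi w) = ev (fun v => cls (@gadj G') (@glab G') (phi v)) w.
Proof.
by rewrite cls_ev ev_ext; apply: eq_ev => v; rewrite cls_ev.
Qed.

Lemma hom_respects (G G' : lgraph) (phi : gV G -> word (gV G')) :
  is_hom (@gadj G) (@glab G) (@gadj G') (@glab G') phi ->
  respects (fun v => cls (@gadj G') (@glab G') (phi v)) (@gadj G) (@glab G).
Proof.
by move=> h a b /h /cls_eq; rewrite !cls_ext !ev_prodw.
Qed.

Definition hom_of (G G' : lgraph) (phi : gV G -> word (gV G')) : artin G -> artin G' :=
  @lift _ _ (fun v => cls (@gadj G') (@glab G') (phi v)) (@gadj G) (@glab G).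

Lemma hom_of_cls (G G' : lgraph) (phi : gV G -> word (gV G')) w :
  is_hom (@gadj G) (@glab G) (@gadj G') (@glab G') phi ->
  hom_of phi (cls _ _ w) = cls _ _ (ext phi w).
Proof. by move=> h; rewrite /hom_of (lift_cls (hom_respects h)) cls_ext. Qed.

Lemma hom_ofM (G G' : lgraph) (phi : gV G -> word (gV G')) :
  is_hom (@gadj G) (@glab G) (@gadj G') (@glab G') phi ->
  {morph hom_of phi : x y / x * y}.
Proof. by move=> h; exact: liftM (hom_respects h). Qed.

Lemma in_stdP (G : lgraph) (L : {set gV G}) w : in_std L w <-> std L (cls _ _ w).
Proof.
split=> [[w' w'L /cls_eq ->]|[w' w'L /cls_eq e]]; first by exists w'.
by exists w'.
Qed.

Lemma std_rename (G : lgraph) (L : {set gV G}) (r : gV G -> gV G) w :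
  (forall x, x \in L -> r x = x) -> vmap_respects r L ->
  std L (cls (@gadj G) (@glab G) w) -> cls _ _ (rename r w) = cls (@gadj G) (@glab G) w.
Proof.
move=> rid rR [w' w'L /[dup] e /cls_eq ww']; rewrite e.
have fR := retract_respects rid rR.
rewrite -[in RHS](rename_id rid w'L).
have tr u : cls (@gadj G) (@glab G) (rename r u) = ev (fun v => agen (r v) : artin G) u.
  by rewrite cls_ev; elim: u => //= -[a b] u ->.
by rewrite !tr; exact: (ev_aeq fR).
Qed.

Section Iso.
Variables G G' : lgraph.
Variables (phi : gV G -> word (gV G')) (psi : gV G' -> word (gV G)).
Hypothesis iso : artin_iso phi psi.
Notation A := (artin G).
Notation A' := (artin G').
Let phiH : is_hom (@gadj G) (@glab G) (@gadj G') (@glab G') phi. Proof. by case: iso. Qed.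
Let psiH : is_hom (@gadj G') (@glab G') (@gadj G) (@glab G) psi. Proof. by case: iso. Qed.
Notation phi' := (hom_of phi).
Notation psi' := (hom_of psi).

Lemma hom_ofK : cancel phi' psi'.
Proof.
move=> x; have [w ->] := cls_surj x; rewrite (hom_of_cls _ phiH) (hom_of_cls _ psiH).
by apply/cls_eq; case: iso => _ _ + _; exact.
Qed.

Lemma hom_ofVK : cancel psi' phi'.
Proof.
move=> x; have [w ->] := cls_surj x; rewrite (hom_of_cls _ psiH) (hom_of_cls _ phiH).
by apply/cls_eq; case: iso => _ _ _; exact.
Qed.

Lemma conj_onto_image (L : {set gV G}) (L' : {set gV G'}) :
  conj_onto phi' L L' -> conj_image phi L L'.
Proof.
move=> [g gL]; exists (winv (arep g)) => w; rewrite winvK.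
have e : cls (@gadj G') (@glab G') (arep g ++ w ++ winv (arep g)) = g * cls _ _ w * g^-1.
  by rewrite !cls_cat cls_winv arepK mulgA.
rewrite in_stdP; have := gL (g * cls _ _ w * g^-1).
rewrite !mulgA mulVg mul1g mulgVK => ->; split=> [[y [u uL ->]]|[u uL /cls_eq]].
  by rewrite hom_of_cls // -e => /cls_eq ww; exists u.
by rewrite e -hom_of_cls // => ->; exists (cls _ _ u) => //; exists u.
Qed.

(** The chosen representatives of elements of [std L'] may use letters outside [L']. Renaming along
    the retraction gives words over the chunk and turns relations of the whole group into relations
    of the induced subgraph. *)
Lemma conj_onto_iso (L : {set gV G}) (L' : {set gV G'}) :
  connected_graph G -> connected_graph G' -> big_chunk L -> big_chunk L' ->
  conj_onto phi' L L' -> sub_iso L L'.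
Proof.
move=> connG connG' cL cL' [g gL].
have [r [rL rid rR]] := retraction connG cL.
have [r' [rL' rid' rR']] := retraction connG' cL'.
pose fwd x := g^-1 * phi' x * g; pose back y := psi' (g * y * g^-1).
have phiM := hom_ofM phiH; have psiM := hom_ofM psiH.
have fwdM : {morph fwd : x y / x * y} by move=> x y; rewrite /fwd phiM !mulgA mulgK.
have backM : {morph back : x y / x * y}.
  by move=> x y; rewrite /back -psiM; congr psi'; rewrite !mulgA mulgVK.
have fwdK x : back (fwd x) = x by rewrite /fwd /back !mulgA mulgV mul1g mulgK hom_ofK.
have backK y : fwd (back y) = y by rewrite /fwd /back hom_ofVK !mulgA mulVg mul1g mulgVK.
have fwdS x : std L x -> std L' (fwd x) by move=> xL; apply/gL; exists x.
have backS y : std L' y -> std L (back y).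
  move=> yL; have [|x xL e] := (gL (g * y * g^-1)).1; first by rewrite !mulgA mulVg mul1g mulgVK.
  by rewrite /back e hom_ofK.
pose f0 v := arep (fwd (agen v)); pose g0 v := arep (back (agen v)).
have f0E w : cls _ _ (ext f0 w) = fwd (cls _ _ w).
  rewrite cls_ext (cls_ev _ _ w) (ev_mor _ _ fwdM); apply: eq_ev => v; exact: arepK.
have g0E w : cls _ _ (ext g0 w) = back (cls _ _ w).
  rewrite cls_ext (cls_ev _ _ w) (ev_mor _ _ backM); apply: eq_ev => v; exact: arepK.
pose f v := rename r' (f0 v); pose h v := rename r (g0 v).
have fE w : std L (cls _ _ w) -> cls _ _ (ext f w) = fwd (cls _ _ w).
  by move=> wL; rewrite /f ext_rename (std_rename rid' rR') f0E //; exact: fwdS.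
have hE w : std L' (cls _ _ w) -> cls _ _ (ext h w) = back (cls _ _ w).
  by move=> wL; rewrite /h ext_rename (std_rename rid rR) g0E //; exact: backS.
exists f, h; split.
- by split=> v _; apply: rename_over.
- move=> a b /and3P[ab aL bL]; rewrite /f !ext_rename; apply: rename_aeq => //.
  by apply/cls_eq; rewrite !f0E; congr fwd; apply/cls_eq; exact: aeq_rel.
- move=> a b /and3P[ab aL bL]; rewrite /h !ext_rename; apply: rename_aeq => //.
  by apply/cls_eq; rewrite !g0E; congr back; apply/cls_eq; exact: aeq_rel.
- move=> w wL; rewrite /h ext_rename -[X in aeq _ _ _ X](rename_id rid wL).
  apply: rename_aeq => //; apply/cls_eq.
  by rewrite g0E fE ?fwdK //; exists w.
- move=> w wL; rewrite /f ext_rename -[X in aeq _ _ _ X](rename_id rid' wL).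
  apply: rename_aeq => //; apply/cls_eq.
  by rewrite f0E hE ?backK //; exists w.
Qed.

End Iso.

Definition pair_map (V W : eqType) (a : V) (c d : W) : V -> word W :=
  fun v => [:: (if v == a then c else d, false)].

Lemma pair_map_hom (G G' : lgraph) (a b : gV G) (c d : gV G') :
  gadj a b -> gadj c d -> glab a b = 2 -> glab c d = 2 ->
  is_hom (restr_adj (@gadj G) [set a; b]) (@glab G) (restr_adj (@gadj G') [set c; d]) (@glab G')
    (pair_map a c d).
Proof.
move=> ab cd m2 n2; have nab : (b == a) = false by apply/eqP => e; move: ab; rewrite e gadj_irr.
have cR : restr_adj (@gadj G') [set c; d] c d by rewrite /restr_adj cd set21 set22.
have cdR := aeq_rel (@glab G') cR; rewrite n2 in cdR.
move=> x y /and3P[xy /set2P[] ex /set2P[] ey]; rewrite ex ey in xy *;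
  rewrite ?gadj_irr // in xy.
  by rewrite m2 /pair_map /ext /= eqxx nab.
by rewrite -(glab_sym ab) m2 /pair_map /ext /= eqxx nab; exact: aeq_sym.
Qed.

Lemma pair_mapK (V W : finType) (a b : V) (c d : W) w : a != b -> c != d ->
  word_over [set a; b] w -> ext (pair_map c a b) (ext (pair_map a c d) w) = w.
Proof.
rewrite eq_sym => /negPf nab; rewrite eq_sym => /negPf ncd.
elim: w => //= -[v s] w IH /andP[/= vab /IH e]; rewrite -[in RHS]e.
by case/set2P: vab => ->; rewrite /pair_map /ext /= ?eqxx ?nab; case: s; rewrite /= ?eqxx ?ncd.
Qed.

Lemma toral_sub_iso (G G' : lgraph) (L : {set gV G}) (L' : {set gV G'}) :
  toral_leaf L -> toral_leaf L' -> sub_iso L L'.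
Proof.
move=> [a [b [ab -> _ m2]]] [c [d [cd -> _ n2]]].
have nab := gadj_neq ab.
have ncd := gadj_neq cd.
exists (pair_map a c d), (pair_map c a b); split.
- by split=> v _; rewrite /pair_map; case: ifP; rewrite /word_over /= ?set21 ?set22.
- exact: pair_map_hom.
- exact: pair_map_hom.
- by move=> w wL; rewrite pair_mapK //; exact: aeq_refl.
- by move=> w wL; rewrite pair_mapK //; exact: aeq_refl.
Qed.

Lemma singleton_chunk (G : lgraph) (v : gV G) (L : {set gV G}) : (forall x, x = v) ->
  big_chunk L -> L = setT.
Proof.
move=> all cL; have /set0Pn [x xL] := (big_chunk_biconn cL).1.1.
by apply/setP => y; rewrite inE (all y) -(all x) xL.
Qed.

Theorem theorem5p6 (G G' : lgraph) (phi : gV G -> word (gV G'))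
  (psi : gV G' -> word (gV G)) :
  connected_graph G -> connected_graph G' -> artin_iso phi psi ->
  (exists f : {set gV G} -> {set gV G'},
     bc_bijection f /\
     forall L, big_chunk L ->
       [/\ sub_iso L (f L),
           ~ toral_leaf L -> conj_image phi L (f L) &
           even_leaf L -> even_leaf (f L)]) /\
  (gens_to_conj_gens phi ->
   exists f : {set gV G} -> {set gV G'},
     bc_bijection f /\
     forall L, big_chunk L ->
       [/\ sub_iso L (f L), conj_image phi L (f L) &
           even_leaf L -> even_leaf (f L)]).
Proof.
move=> connG connG' iso.
have [phiH psiH _ _] := iso.
have phiM := hom_ofM phiH; have psiM := hom_ofM psiH.
have phiK := hom_ofK iso; have psiK := hom_ofVK iso.
(* The general argument starts from an edge inside each chunk. If there is only one vertex, both
   groups are infinite cyclic and the vertex is the only chunk. *)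
have [nt|tr] := pselect (exists u v : gV G, u != v); last first.
  have /set0Pn [v _] := connG.1.
  have all x : x = v by apply/eqP; apply: contrapT => /negP xv; apply: tr; exists x, v.
  have tr' : ~ exists u v : gV G', u != v.
    by move=> nt'; apply: tr; exact: (nontriv_target connG nt' phiM psiK).
  have /set0Pn [v' _] := connG'.1.
  have all' x : x = v' by apply/eqP; apply: contrapT => /negP xv; apply: tr'; exists x, v'.
  have cT : big_chunk [set: gV G].
    by have [L cL _] := vertex_chunk v; rewrite -(singleton_chunk all cL).
  have cT' : big_chunk [set: gV G'].
    by have [L cL _] := vertex_chunk v'; rewrite -(singleton_chunk all' cL).
  have bij : bc_bijection (fun _ : {set gV G} => [set: gV G']).
    split=> //.
      by move=> L1 L2 c1 c2 _; rewrite (singleton_chunk all c1) (singleton_chunk all c2).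
    by move=> L' cL'; exists [set: gV G] => //; rewrite (singleton_chunk all' cL').
  have onto : conj_onto (hom_of phi) [set: gV G] [set: gV G'].
    exists 1 => x; split=> _; last exact: std_setT.
    by exists (hom_of psi x); rewrite ?psiK //; exact: std_setT.
  have ev : ~ even_leaf [set: gV G].
    by move=> [a [b [ab _ _ _]]]; move: ab; rewrite (all a) (all b) gadj_irr.
  split=> [|_]; exists (fun=> [set: gV G']); split=> // L cL;
    rewrite (singleton_chunk all cL); split=> //.
  - exact: (conj_onto_iso iso connG connG' cT cT' onto).
  - by move=> _; exact: (conj_onto_image iso onto).
  - exact: (conj_onto_iso iso connG connG' cT cT' onto).
  - exact: (conj_onto_image iso onto).
split.
  have [f [fb fP]] := chunk_matching connG connG' nt phiM psiM phiK psiK.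
  exists f; split=> // L cL; have [f1 f2 f3] := fP L cL; split=> //.
    have [tL|ntL] := pselect (toral_leaf L); first exact: toral_sub_iso (f2 tL).
    have cf : big_chunk (f L) by case: fb => fc _ _; exact: fc.
    exact: (conj_onto_iso iso connG connG' cL cf (f1 ntL)).
  by move=> /f1; exact: (conj_onto_image iso).
move=> gg; have [|f [fb fP]] := chunk_matching_gens connG connG' nt phiM psiM phiK psiK.
  move=> v; have [v' [k e]] := gg v; exists (cls _ _ k)^-1, v'.
  rewrite invgK -cls_winv /gen -!cls_cat -catA.
  rewrite hom_of_cls //; apply/cls_eq; apply: aeq_trans e.
  by rewrite /ext /= cats0; exact: aeq_refl.
exists f; split=> // L cL; have [f1 f3] := fP L cL; split=> //.
  have cf : big_chunk (f L) by case: fb => fc _ _; exact: fc.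
  exact: (conj_onto_iso iso connG connG' cL cf f1).
exact: (conj_onto_image iso f1).
Qed.
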